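(* Let $p\ge 3$, $n\ge 3$, let $a$ satisfy $p/2+a+1>0$, and let $L:[1,\infty)\to[0,\infty)$ satisfy (L1)–(L3) (given in the context). Consider the generalized Bayes estimator of $\theta$ with respect to the prior $$\pi(\theta,\sigma^2)=\frac{1}{\sigma^2}\times\frac{1}{\sigma^p}\,G(\|\theta\|/\sigma;a,L).$$ (1) Suppose $a=-2$ and, for some $b>1$, $\{\log(y)\}^b/L(y)$ is monotone non-increasing in $y$. Then the generalized Bayes estimator is quasi-inadmissible. (2) Suppose $a<-2$. Then the generalized Bayes estimator is quasi-inadmissible.
   Context: Model: $X\sim N_p(\theta,\sigma^2 I_p)$ and $S\sim\sigma^2\chi^2_n$ are independent, $\theta\in\mathbb{R}^p$ and $\sigma^2>0$ both unknown. The mean $\theta$ is estimated under the loss $\|d-\theta\|^2/\sigma^2$. Let $W=\|X\|^2/S$ and, for $\phi:[0,\infty)\to\mathbb{R}$, $\delta_\phi(X,S)=(1-\phi(W)/W)X$. Prior: $$G(\|\mu\|;a,L)=\int_0^1\Big\{\frac{\lambda}{1-\lambda}\Big\}^{p/2}\exp\Big(-\frac{\lambda}{1-\lambda}\frac{\|\mu\|^2}{2}\Big)\lambda^aL(1/\lambda)\,d\lambda .$$ Assumptions on $L$ (''ultimately'' means on $[y_0,\infty)$ for some $y_0$): (L1) $L$ is slowly varying at infinity: $\lim_{y\to\infty}L(cy)/L(y)=1$ for all $c>0$; (L2) $L$ is ultimately monotone; (L3) $L$ is differentiable with ultimately monotone derivative $L'$. The generalized Bayes estimator minimizes posterior expected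 loss, i.e. it is $E[\theta/\sigma^2\mid X,S]/E[1/\sigma^2\mid X,S]$; it has the form $\delta_\phi$ with $$\phi(w)=\phi_{a,L}(w)=w\,\frac{\int_0^1\lambda^{p/2+a+1}L(1/\lambda)(1+w\lambda)^{-(p+n)/2-1}d\lambda}{\int_0^1\lambda^{p/2+a}L(1/\lambda)(1+w\lambda)^{-(p+n)/2-1}d\lambda}.$$ Quasi-inadmissibility: let $c_{p,n}=(p-2)/(n+2)$, $d_n=4/(n+2)$, and $$D_\phi(w)=\frac{\{\phi(w)-2c_{p,n}\}\phi(w)}{w}-d_n\phi'(w)\{1+\phi(w)\}.$$ $\varPhi$ is the class of functions $\phi:[0,\infty)\to\mathbb{R}$ that are absolutely continuous (on compact subintervals of $[0,\infty)$) and for which each term of $E[D_\phi(W)]$ is finite, i.e. $\phi(W)^2/W$, $\phi(W)/W$, $\phi'(W)$ and $\phi(W)\phi'(W)$ have finite expectation, for every $(\theta,\sigma^2)$. Let $$\Delta(w;\phi,g)=D_\phi(w)-D_{\phi+g}(w)=g(w)\Big\{2\frac{c_{p,n}-\phi(w)}{w}+d_n\phi'(w)-\frac{g(w)}{w}+d_ng'(w)\Big\}+d_ng'(w)\{1+\phi(w)\}.$$ $\delta_\phi$ is quasi-inadmissible if there exists $g\in\varPhi$, non-vanishing on some open interval, with $\Delta(w;\phi,g)\ge 0$ for all $w$ (at which it is defined, i.e. almost every $w\geq 0$). *)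

(* Defs.v *)
From HB Require Import structures.
From mathcomp Require Import all_boot all_order all_algebra.
From mathcomp Require Import all_classical all_reals all_analysis.
Set Implicit Arguments.
Unset Strict Implicit.
Unset Printing Implicit Defensive.
Import Order.TTheory GRing.Theory Num.Theory.
Import numFieldNormedType.Exports.
Local Open Scope classical_set_scope.
Local Open Scope ring_scope.

(* Conventions.  A point of R^p is a [p.-tuple R].  A function on [0, +oo[ or
   [1, +oo[ is a total function R -> R of which only the restriction to that
   interval matters.  The parameter sigma^2 is the variable [v]. *)

Definition cons_pair (T : Type) (n : nat) (z : T * n.-tuple T) : n.+1.-tuple T :=
  [the n.+1.-tuple T of z.1 :: z.2].

Lemma measurable_cons_pair d (T : measurableType d) n :
  measurable_fun [set: (T * n.-tuple T)%type] (@cons_pair T n).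
Proof. by apply: measurable_cons. Qed.

Section tuple_product.
Context d (T : measurableType d) (R : realType) (n : nat).
Variables (m1 : {sigma_finite_measure set T -> \bar R})
          (mn : {sigma_finite_measure set (n.-tuple T) -> \bar R}).

Definition tuple_product : set (n.+1.-tuple T) -> \bar R :=
  pushforward (m1 \x mn)%E (@cons_pair T n).

Let tuple_product0 : tuple_product set0 = 0%E.
Proof. by rewrite /tuple_product /pushforward preimage_set0; exact: measure0. Qed.

Let tuple_product_ge0 A : (0 <= tuple_product A)%E.
Proof. by apply: integral_ge0 => x _; exact: measure_ge0. Qed.

Let tuple_product_sigma_additive : semi_sigma_additive tuple_product.
Proof.
move=> F mF tF mUF; rewrite /tuple_product /pushforward preimage_bigcup.
have mc := @measurable_cons_pair _ T n.
apply: measure_semi_sigma_additive.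
- by move=> k; rewrite -[X in measurable X]setTI; exact: mc.
- apply/trivIsetP => /= i j _ _ ij; rewrite -preimage_setI.
  by move/trivIsetP : tF => /(_ _ _ _ _ ij) ->//; rewrite preimage_set0.
- by rewrite -preimage_bigcup -[X in measurable X]setTI; exact: mc.
Qed.

HB.instance Definition _ := isMeasure.Build _ _ _ tuple_product
  tuple_product0 tuple_product_ge0 tuple_product_sigma_additive.

Let tuple_product_sigma_finite : sigma_finite setT tuple_product.
Proof.
have /sigma_finiteP[F' [TF' ndF' Foo]] := sigma_finiteT m1.
have /sigma_finiteP[G' [TG' ndG' Goo]] := sigma_finiteT mn.
pose th (x : n.+1.-tuple T) : T := tnth x ord0.
pose tl (x : n.+1.-tuple T) : n.-tuple T := [tuple of behead x].
exists (fun k => (th @^-1` (F' k)) `&` (tl @^-1` (G' k))).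
  apply/seteqP; split => // x _.
  have [i _ Fi] : (\bigcup_i F' i) (th x) by rewrite -TF'.
  have [j _ Gj] : (\bigcup_i G' i) (tl x) by rewrite -TG'.
  exists (maxn i j) => //; split => /=.
  - by move: (th x) Fi; exact/subsetPset/ndF'/leq_maxl.
  - by move: (tl x) Gj; exact/subsetPset/ndG'/leq_maxr.
move=> k; have [mFk Fk] := Foo k; have [mGk Gk] := Goo k; split.
  apply: measurableI.
  - by rewrite -[X in measurable X]setTI; exact: measurable_tnth.
  - by rewrite -[X in measurable X]setTI; exact: measurable_behead.
rewrite /tuple_product /pushforward.
rewrite (_ : _ @^-1` _ = F' k `*` G' k); last first.
  apply/seteqP; split => -[a b] /=.
    by rewrite /th /tl /cons_pair/= => -[Fa Gb]; split => //=; move: Gb;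
      congr (G' k _); exact/val_inj.
  by rewrite /th /tl /cons_pair/= => -[Fa Gb]; split => //=; move: Gb;
    congr (G' k _); exact/val_inj.
by rewrite product_measure1E// lte_mul_pinfty// ge0_fin_numE.
Qed.

HB.instance Definition _ := Measure_isSigmaFinite.Build _ _ _ tuple_product
  tuple_product_sigma_finite.

End tuple_product.

Fixpoint lebesgue_tuple (R : realType) (n : nat) :
    {sigma_finite_measure set (n.-tuple (measurableTypeR R)) -> \bar R} :=
  match n with
  | 0 => dirac ([tuple] : 0.-tuple (measurableTypeR R))
  | n.+1 => tuple_product (@lebesgue_measure R) (lebesgue_tuple R n)
  end.

Definition sqnorm (R : realType) (p : nat) (x : p.-tuple R) : R :=
  \sum_(i < p) tnth x i ^+ 2.

Definition norm2 (R : realType) (p : nat) (x : p.-tuple R) : R :=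
  Num.sqrt (sqnorm x).

(* The values of (X, S) and of (theta, sigma^2) both range over
   R^p * ]0, +oo[, with reference measure the Lebesgue measure. *)

Definition half_space (R : realType) (p : nat) :
    set (p.-tuple (measurableTypeR R) * measurableTypeR R)%type :=
  [set z | (0 : R) < z.2].

Definition half_space_measure (R : realType) (p : nat) :=
  (lebesgue_tuple R p \x @lebesgue_measure R)%E.

Definition Gamma (R : realType) (x : R) : R :=
  \int[@lebesgue_measure R]_(t in `]0, +oo[) (t `^ (x - 1) * expR (- t)).

Definition chi2_pdf (R : realType) (n : nat) (t : R) : R :=
  t `^ (n%:R / 2 - 1) * expR (- t / 2) / (2 `^ (n%:R / 2) * Gamma (n%:R / 2)).

(* Joint density of (X, S): if S / v has density f then S has density f (s / v) / v. *)
Definition model_pdf (R : realType) (p n : nat) (theta : p.-tuple R) (v : R)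
    (x : p.-tuple R) (s : R) : R :=
  (\prod_(i < p) normal_pdf (tnth theta i) (Num.sqrt v) (tnth x i))
  * (v^-1 * chi2_pdf n (s / v)).

Definition Wstat (R : realType) (p : nat) (x : p.-tuple R) (s : R) : R :=
  sqnorm x / s.

Definition finite_expectation (R : realType) (p n : nat) (h : R -> R) : Prop :=
  forall (theta : p.-tuple R) (v : R), 0 < v ->
    (@half_space_measure R p).-integrable (@half_space R p)
      (fun z => (h (Wstat z.1 z.2) * model_pdf n theta v z.1 z.2)%:E).

(* Extended-real valued: the integral may diverge at mu = 0. *)
Definition G_prior (R : realType) (p : nat) (a : R) (L : R -> R) (r : R) : \bar R :=
  (\int[@lebesgue_measure R]_(l in `]0%R, 1%R[)
     ((l / (1 - l)) `^ (p%:R / 2) * expR (- (l / (1 - l)) * (r ^+ 2 / 2))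
      * l `^ a * L l^-1)%:E)%E.

Definition prior (R : realType) (p : nat) (a : R) (L : R -> R)
    (theta : p.-tuple R) (v : R) : \bar R :=
  ((v^-1 * (Num.sqrt v ^+ p)^-1)%:E
   * G_prior p a L (norm2 theta / Num.sqrt v))%E.

Definition unnormalized_posterior (R : realType) (p n : nat) (a : R)
    (L : R -> R) (h : p.-tuple R -> R -> R) (x : p.-tuple R) (s : R) : \bar R :=
  (\int[@half_space_measure R p]_(z in @half_space R p)
     ((h z.1 z.2 * model_pdf n z.1 z.2 x s)%:E * prior a L z.1 z.2))%E.

Definition posterior_expectation (R : realType) (p n : nat) (a : R)
    (L : R -> R) (h : p.-tuple R -> R -> R) (x : p.-tuple R) (s : R) : R :=
  fine (unnormalized_posterior n a L h x s)
  / fine (unnormalized_posterior n a L (fun _ _ => 1) x s).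

(* The minimizer E[theta / sigma^2 | X, S] / E[1 / sigma^2 | X, S] of the
   posterior expectation of |d - theta|^2 / sigma^2. *)
Definition generalized_Bayes (R : realType) (p n : nat) (a : R) (L : R -> R)
    (x : p.-tuple R) (s : R) : p.-tuple R :=
  [tuple posterior_expectation n a L (fun theta v => tnth theta i / v) x s
         / posterior_expectation n a L (fun _ v => v^-1) x s | i < p].

Definition slowly_varying (R : realType) (L : R -> R) : Prop :=
  forall c : R, 0 < c -> (fun y => L (c * y) / L y) @ +oo --> (1 : R).

Definition ultimately_nondecreasing (R : realType) (f : R -> R) : Prop :=
  exists y0 : R, {in `[y0, +oo[ &, {homo f : x y / x <= y}}.

Definition ultimately_nonincreasing (R : realType) (f : R -> R) : Prop :=
  exists y0 : R, {in `[y0, +oo[ &, {homo f : x y /~ x <= y}}.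

Definition ultimately_monotone (R : realType) (f : R -> R) : Prop :=
  ultimately_nondecreasing f \/ ultimately_nonincreasing f.

(* One-sided differentiability at the endpoint 1. *)
Definition differentiable_from1 (R : realType) (L : R -> R) : Prop :=
  (forall y : R, 1 < y -> derivable L y 1)
  /\ cvg ((fun h => h^-1 * (L (1 + h) - L 1)) @ (0 : R)^'+).

Definition L_assumptions (R : realType) (L : R -> R) : Prop :=
  [/\ slowly_varying L,
      ultimately_monotone L,
      differentiable_from1 L
    & ultimately_monotone (derive1 L)].

Definition delta_phi (R : realType) (p : nat) (phi : R -> R)
    (x : p.-tuple R) (s : R) : p.-tuple R :=
  [tuple (1 - phi (Wstat x s) / Wstat x s) * tnth x i | i < p].

Definition nonoverlapping (R : realType) (a b : R) (s : seq (R * R)) : bool :=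
  all (fun I => [&& a <= I.1, I.1 <= I.2 & I.2 <= b]) s
  && pairwise (fun I J => (I.2 <= J.1) || (J.2 <= I.1)) s.

Definition absolutely_continuous (R : realType) (a b : R) (f : R -> R) : Prop :=
  forall e : R, 0 < e -> exists2 d : R, 0 < d &
    forall s : seq (R * R), nonoverlapping a b s ->
      \sum_(I <- s) (I.2 - I.1) < d ->
      \sum_(I <- s) `|f I.2 - f I.1| < e.

Definition class_Phi (R : realType) (p n : nat) (phi : R -> R) : Prop :=
  (forall a b : R, 0 <= a -> a <= b -> absolutely_continuous a b phi)
  /\ [/\ finite_expectation p n (fun w => phi w ^+ 2 / w),
         finite_expectation p n (fun w => phi w / w),
         finite_expectation p n (derive1 phi)
       & finite_expectation p n (fun w => phi w * derive1 phi w)].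

Definition c_pn (R : realType) (p n : nat) : R := (p%:R - 2) / (n%:R + 2).

Definition d_n (R : realType) (n : nat) : R := 4 / (n%:R + 2).

Definition Delta (R : realType) (p n : nat) (phi g : R -> R) (w : R) : R :=
  g w * (2 * ((c_pn R p n - phi w) / w) + d_n R n * derive1 phi w
         - g w / w + d_n R n * derive1 g w)
  + d_n R n * derive1 g w * (1 + phi w).

Definition Delta_defined (R : realType) (phi g : R -> R) (w : R) : Prop :=
  [/\ 0 < w, derivable phi w 1 & derivable g w 1].

(* Delta must be nonnegative wherever it is defined; it has to be defined almost
   everywhere, so that this requirement is not vacuous. *)
Definition quasi_inadmissible (R : realType) (p n : nat)
    (delta : p.-tuple R -> R -> p.-tuple R) : Prop :=
  exists phi : R -> R,
    (forall (x : p.-tuple R) (s : R), 0 < s -> delta x s = delta_phi phi x s)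
    /\ exists g : R -> R,
      [/\ class_Phi p n g,
          exists c d : R, [/\ 0 <= c, c < d & forall w, c < w < d -> g w != 0],
          {ae @lebesgue_measure R, forall w, 0 <= w -> Delta_defined phi g w}
        & forall w : R, Delta_defined phi g w -> 0 <= Delta p n phi g w].

(* Main.v *)
Require Import Defs.
From HB Require Import structures.
From mathcomp Require Import all_boot all_order all_algebra.
From mathcomp Require Import all_classical all_reals all_analysis.
From mathcomp Require Import measurable_realfun normal_distribution.
From mathcomp Require Import ring lra.
Set Implicit Arguments.
Unset Strict Implicit.
Unset Printing Implicit Defensive.
Import Order.TTheory GRing.Theory Num.Theory.
Import numFieldNormedType.Exports.
Local Open Scope classical_set_scope.
Local Open Scope ring_scope.

(** Conditionally on the mixing variable [l] of the prior and on [v], the coordinates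
    of [theta] are a posteriori independent normals with mean [x * (1 - l)]
    ([gauss_pdf_conjugate]).  Integrating [theta] and then [v] out leaves
    one-dimensional moments of the density [l `^ (p / 2 + a) * L (1 / l)], and the
    generalized Bayes estimator is [delta_phi] of a ratio [phi] of such moments, called
    [shrink] below ([generalized_Bayes_shrink]).

    Put [c = c_pn] and write it as [alpha / beta] with [alpha = p / 2 - 1] and
    [beta = n / 2 + 1], so that [d_n = 2 / beta].  The decisive fact is how fast
    [phi w] approaches [c] from below.  If [y `^ (- 2 - a) * L y / (ln y) ^ b] is
    ultimately nondecreasing for some [b > 1], there is [b2 > 1] with
      [alpha - beta * phi w >= b2 / ln w * (1 + phi w)]   for all large [w]
    ([shrink_deficit]).  Indeed, for a pure power [l `^ (alpha - 1)] the integral of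
    [(1 + w * l) `^ (- alpha - beta - 1) * (alpha - beta * (w * l))] is that of an exact
    derivative.  Shifting the exponent [alpha - 1] by [- b3 / ln w], with
    [b2 < b3 < b], turns a factor [(ln (1 / l)) ^ b] into a monotone one on the range of
    [l] that matters.  There the actual density can be compared with the shifted power
    by its value where the integrand changes sign.  The difference between [b3] and [b2]
    leaves a gain of order [w `^ (- alpha) / ln w], which beats the contributions of the
    excluded ranges.

    A better function is then obtained by adding
      [g w = u `^ (- b1) / (1 + phi w)],   [u = ln w],  [1 < b1 < b2],
    smoothly cut off for small [w].  In [w * Delta] the deficit contributes
    [2 / beta * b2 / u] per unit of [g * (1 + phi)], the derivative of [g] costs at most
    [2 / beta * b1 / u], and the terms quadratic in [g] are, relative to [g], of size
    [u `^ (- b1)], which is smaller than [1 / u].  They are controlled because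
    [w * phi' w] is bounded by a multiple of [phi w] ([is_derive_shrink]).  This gives
    [deficit_improvable].  The perturbation is Lipschitz and vanishes near zero, so it
    lies in the required class ([class_Phi_smooth]).

    It remains to verify the monotonicity hypothesis.  When [a = - 2] it is the
    assumption on [L].  When [a < - 2] the power [y `^ (- 2 - a)] dominates: half of it
    absorbs the squared logarithm, and the other half makes [y `^ d * L y] ultimately
    nondecreasing, because slow variation and the monotonicity of [L'] force
    [y * L' y >= - d * L y] ([slowly_varying_derive_ge]). *)

(** * Lebesgue measure on tuples *)

Section affine_substitution.
Context {R : realType}.
Local Notation mu := (@lebesgue_measure R).
Implicit Types (c d : R).

Lemma measurable_affine c d :
  measurable_fun setT (fun x : measurableTypeR R => c * x + d : measurableTypeR R).
Proof. by apply: measurable_funD => //; exact: measurable_funM. Qed.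

(** Both sides are measures that agree on half-open intervals. *)
Lemma lebesgue_measure_affine c d (A : set R) : c != 0 -> measurable A ->
  mu A = (`|c|%:E * pushforward mu
     (fun x : measurableTypeR R => (c * x + d)%R : measurableTypeR R) A)%E.
Proof.
move=> c0 mA.
pose f := fun x : measurableTypeR R => c * x + d : measurableTypeR R.
have mf : measurable_fun setT f := measurable_affine c d.
pose fmix := isMeasurableFun.Build _ _ _ _ _ mf.
pose ff : {mfun _ >-> _} := HB.pack f fmix.
have nc : 0 <= `|c| by [].
have := @lebesgue_measure_unique R (mscale (NngNum nc) (pushforward mu ff)).
apply => // _ [[a b]] _ <-.
rewrite /= /mscale /= /pushforward /f /=.
have [c_gt0|c_lt0] := ltP 0 c.
  rewrite (_ : _ @^-1` _ = `](a - d) / c, (b - d) / c]%classic); last first.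
    apply/seteqP; split => x /=; rewrite !in_itv/= ltr_pdivrMr// ler_pdivlMr//;
    by rewrite (mulrC x) lerBrDr ltrBlDr.
  rewrite !lebesgue_measure_itv /= !lte_fin ltr_pM2r ?invr_gt0// ltrD2r.
  case: ifPn => _; last by rewrite mule0.
  rewrite -EFinB -EFinB -EFinM gtr0_norm//; congr EFin.
  by rewrite -mulrBl mulrCA mulfV// mulr1; ring.
have {}c_lt0 : c < 0 by rewrite lt_neqAle c0.
rewrite (_ : _ @^-1` _ = `[(b - d) / c, (a - d) / c[%classic); last first.
  apply/seteqP; split => x /=; rewrite !in_itv/= ltr_ndivlMr// ler_ndivrMr//;
  by rewrite (mulrC x) lerBrDr ltrBlDr andbC.
rewrite !lebesgue_measure_itv /= !lte_fin ltr_nM2r ?invr_lt0// ltrD2r.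
case: ifPn => _; last by rewrite mule0.
rewrite -EFinB -EFinB -EFinM ltr0_norm//; congr EFin.
by rewrite -mulrBl mulNr mulrCA mulfV// mulr1; ring.
Qed.

Lemma ge0_integral_affine c d (f : R -> \bar R) : c != 0 ->
  measurable_fun setT f -> (forall x, (0 <= f x)%E) ->
  (\int[mu]_x f x = `|c|%:E * \int[mu]_x f (c * x + d)%R)%E.
Proof.
move=> c0 mf f0.
pose g := fun x : measurableTypeR R => c * x + d : measurableTypeR R.
have mg : measurable_fun setT g := measurable_affine c d.
pose pm : {measure set (measurableTypeR R) -> \bar R} :=
  measure_function_pushforward__canonical__measure_function_Measure mu mg.
have nc : 0 <= `|c| by [].
transitivity (\int[mscale (NngNum nc) pm]_x f x)%E.
  apply: eq_measure_integral => A mA _.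
  by rewrite /mscale/= (@lebesgue_measure_affine c d).
rewrite ge0_integral_mscale//=; congr (_ * _)%E.
by rewrite (ge0_integral_pushforward mg)// preimage_setT.
Qed.

End affine_substitution.

Section tonelli_on.
Context d1 d2 (T1 : measurableType d1) (T2 : measurableType d2) (R : realType).
Variables (m1 : {sigma_finite_measure set T1 -> \bar R})
          (m2 : {sigma_finite_measure set T2 -> \bar R}).
Variables (A : set T1) (B : set T2) (f : T1 * T2 -> \bar R).
Hypotheses (mA : measurable A) (mB : measurable B).
Hypothesis mf : measurable_fun (A `*` B) f.
Hypothesis f0 : forall x y, A x -> B y -> (0 <= f (x, y))%E.

Let g := f \_ (A `*` B).

Let mg : measurable_fun setT g.
Proof. by apply/(measurable_restrictT _ _).1 => //; exact: measurableX. Qed.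

Let g0 z : (0 <= g z)%E.
Proof.
by rewrite /g patchE; case: ifPn => // /[!inE]; case: z => x y [/=]; exact: f0.
Qed.

Let g2E x : (\int[m2]_y g (x, y) = ((fun x => \int[m2]_(y in B) f (x, y)) \_ A) x)%E.
Proof.
rewrite [RHS]patchE; case: ifPn => Ax.
  rewrite [RHS]integral_mkcond; apply: eq_integral => y _.
  by rewrite /g !patchE in_setX/= Ax.
by apply: integral0_eq => y _; rewrite /g patchE in_setX/= (negbTE Ax).
Qed.

Let g1E y : (\int[m1]_x g (x, y) = ((fun y => \int[m1]_(x in A) f (x, y)) \_ B) y)%E.
Proof.
rewrite [RHS]patchE; case: ifPn => By.
  rewrite [RHS]integral_mkcond; apply: eq_integral => x _.
  by rewrite /g !patchE in_setX/= By andbT.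
by apply: integral0_eq => x _; rewrite /g patchE in_setX/= (negbTE By) andbF.
Qed.

(** Extending [f] by zero reduces Tonelli on a rectangle to the whole product, so
    that [f] has to be measurable and nonnegative on the rectangle only. *)
Lemma tonelli_on1 : (\int[m1 \x m2]_(z in A `*` B) f z
  = \int[m1]_(x in A) \int[m2]_(y in B) f (x, y))%E.
Proof.
rewrite integral_mkcond fubini_tonelli1// [RHS]integral_mkcond.
by apply: eq_integral => x _; rewrite -g2E.
Qed.

Lemma tonelli_on2 : (\int[m1 \x m2]_(z in A `*` B) f z
  = \int[m2]_(y in B) \int[m1]_(x in A) f (x, y))%E.
Proof.
rewrite integral_mkcond fubini_tonelli2// [RHS]integral_mkcond.
by apply: eq_integral => x _; rewrite -g1E.
Qed.

Lemma tonelli_on : (\int[m1]_(x in A) \int[m2]_(y in B) f (x, y)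
  = \int[m2]_(y in B) \int[m1]_(x in A) f (x, y))%E.
Proof. by rewrite -tonelli_on1 tonelli_on2. Qed.

End tonelli_on.

Section product_sigma_finite.
Context d1 d2 (T1 : measurableType d1) (T2 : measurableType d2) (R : realType).
Variables (m1 : {sigma_finite_measure set T1 -> \bar R})
          (m2 : {sigma_finite_measure set T2 -> \bar R}).

(** The product measure as a sigma-finite measure, so that Tonelli can be applied to
    a further product with it. *)
Definition product_sigma_finite_measure :
    {sigma_finite_measure set (T1 * T2)%type -> \bar R} :=
  HB.pack (m1 \x m2)%E (Measure_isSigmaFinite.Build _ _ _ (m1 \x m2)%E
    (@lebesgue_integral_fubini.product_measure_sigma_finite_subproof
      _ _ _ _ _ m1 m2)).

End product_sigma_finite.

Section tuple_integral.
Context {R : realType}.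
Local Notation mu := (@lebesgue_measure R).

Lemma measurable_comp_tnth p (i : 'I_p) (h : R -> R) : measurable_fun setT h ->
  measurable_fun setT (fun x : p.-tuple (measurableTypeR R) => h (tnth x i)).
Proof. by move=> mh; exact: (measurableT_comp mh (@measurable_tnth _ _ _ i)). Qed.

(** Tonelli, peeling off one coordinate at a time. *)
Lemma integral_lebesgue_tuple_prod p (f : 'I_p -> R -> R) :
  (forall i, measurable_fun setT (f i)) -> (forall i x, 0 <= f i x) ->
  (\int[lebesgue_tuple R p]_x (\prod_(i < p) f i (tnth x i))%:E
   = \prod_(i < p) \int[mu]_t (f i t)%:E)%E.
Proof.
elim: p f => [|p IH] f mf f0.
  rewrite big_ord0 /=.
  under eq_integral do rewrite big_ord0.
  by rewrite integral_dirac//= diracT mul1e.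
have mF : measurable_fun setT (fun x : p.+1.-tuple (measurableTypeR R) =>
   (\prod_(i < p.+1) f i (tnth x i))%:E).
  apply/measurable_EFinP; apply: measurable_prod => i _.
  exact: measurable_comp_tnth.
rewrite [LHS](_ : _ = \int[(mu \x lebesgue_tuple R p)%E]_z
  ((f ord0 z.1 * \prod_(i < p) f (lift ord0 i) (tnth z.2 i))%:E))%E; last first.
  rewrite /=.
  under [RHS]eq_integral => z _.
    rewrite (_ : _ * _ = \prod_(i < p.+1) f i (tnth (cons_pair z) i)); last first.
      rewrite big_ord_recl; congr (_ * _).
      by apply: eq_bigr => i _; rewrite /cons_pair tnthS.
    over.
  have mc := @measurable_cons_pair _ (measurableTypeR R) p.
  rewrite -(preimage_setT (@cons_pair R p)).
  rewrite -[RHS](@ge0_integral_pushforward _ _ _ _ _ _ mc (mu \x lebesgue_tuple R p)%E setT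
    (fun x => (\prod_(i < p.+1) f i (tnth x i))%:E))//.
  by move=> x _; rewrite lee_fin prodr_ge0.
rewrite fubini_tonelli1//=; last 2 first.
- apply/measurable_EFinP; apply: measurable_funM.
    exact: (measurableT_comp (mf ord0) measurable_fst).
  apply: measurable_prod => i _.
  apply: (@measurableT_comp _ _ _ _ _ _
    (fun x : p.-tuple (measurableTypeR R) => f (lift ord0 i) (tnth x i)) _ snd).
    exact: measurable_comp_tnth.
  exact: measurable_snd.
- by move=> z; rewrite lee_fin mulr_ge0// prodr_ge0.
rewrite big_ord_recl -IH//.
pose I := (\int[lebesgue_tuple R p]_z (\prod_(i < p) f (lift ord0 i) (tnth z i))%:E)%E.
transitivity (\int[mu]_x ((f ord0 x)%:E * I))%E.
  apply: eq_integral => x _; rewrite /fubini_F/= /I -ge0_integralZl//=.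
  - apply/measurable_EFinP; apply: measurable_prod => i _.
    exact: measurable_comp_tnth.
  - by move=> t _; rewrite lee_fin prodr_ge0.
  - by rewrite lee_fin.
have mf0 : measurable_fun setT (fun t => (f ord0 t)%:E) by exact/measurable_EFinP.
have I0 : (0 <= I)%E by apply: integral_ge0 => t _; rewrite lee_fin prodr_ge0.
rewrite ge0_integralZr; [by []|exact: measurableT|exact: mf0| |exact: I0].
by move=> t _; rewrite lee_fin.
Qed.

End tuple_integral.

(** * The normal density *)

Section real_measurability.
Context {R : realType}.

Lemma measurable_invr (D : set R) : measurable_fun D (fun x : R => x^-1).
Proof.
apply: measurable_funTS.
rewrite (_ : (fun x : R => x^-1) = (fun x => x * (x ^+ 2) `^ (-1))).
  apply: measurable_funM => //.
  apply: (measurableT_comp (measurable_powR _)).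
  exact: measurable_funX.
apply/funext => x; rewrite powR_inv1 ?sqr_ge0//.
have [->|x0] := eqVneq x 0; first by rewrite invr0 mul0r.
by rewrite expr2 invfM mulrA mulfV// mul1r.
Qed.

Lemma measurable_sqrtr (D : set R) : measurable_fun D (@Num.sqrt R).
Proof. by apply: measurable_funTS; apply: continuous_measurable_fun; exact: sqrt_continuous. Qed.

Context d (T : measurableType d).
Implicit Types (D : set T) (f g : T -> R).

Lemma measurable_funV D f : measurable_fun D f -> measurable_fun D (fun x => (f x)^-1).
Proof.
move=> mf; apply: (@measurableT_comp _ _ _ _ _ _ (fun x : R => x^-1)) => //.
exact: measurable_invr.
Qed.

Lemma measurable_fun_sqrt D f : measurable_fun D f ->
  measurable_fun D (fun x => Num.sqrt (f x)).
Proof.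
move=> mf; apply: (@measurableT_comp _ _ _ _ _ _ (@Num.sqrt R)) => //.
exact: measurable_sqrtr.
Qed.

Lemma measurable_fun_expR D f : measurable_fun D f ->
  measurable_fun D (fun x => expR (f x)).
Proof. by move=> mf; exact: (measurableT_comp (@measurable_expR R) mf). Qed.

Lemma measurable_fun_powR D f r : measurable_fun D f ->
  measurable_fun D (fun x => f x `^ r).
Proof. by move=> mf; exact: (measurableT_comp (@measurable_powR R r) mf). Qed.

End real_measurability.

Section gaussian.
Context {R : realType}.
Local Notation mu := (@lebesgue_measure R).
Implicit Types (m u t : R).

(** The normal density as a function of its variance.  Unlike the density indexed by
    the standard deviation, it has no special case for a degenerate law, hence it is
    jointly measurable in all its arguments. *)
Definition gauss_pdf m u t : R :=
  (Num.sqrt (u * pi *+ 2))^-1 * expR (- (t - m) ^+ 2 / (u *+ 2)).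

Lemma gauss_pdfE m u t : 0 < u -> normal_pdf m (Num.sqrt u) t = gauss_pdf m u t.
Proof.
move=> u0; rewrite normal_pdfE ?gt_eqF ?sqrtr_gt0//.
by rewrite /normal_peak /normal_fun sqr_sqrtr// ltW.
Qed.

Lemma gauss_pdf_ge0 m u t : 0 <= gauss_pdf m u t.
Proof. by rewrite mulr_ge0// ?invr_ge0 ?sqrtr_ge0// expR_ge0. Qed.

Lemma measurable_fun_gauss d (T : measurableType d) (D : set T) (f g h : T -> R) :
  measurable_fun D f -> measurable_fun D g -> measurable_fun D h ->
  measurable_fun D (fun z => gauss_pdf (f z) (g z) (h z)).
Proof.
move=> mf mg mh; apply: measurable_funM.
  apply/measurable_funV/measurable_fun_sqrt.
  under eq_fun do rewrite -mulr_natr.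
  by do 2 apply: measurable_funM => //.
apply: measurable_fun_expR; apply: measurable_funM.
  by apply: measurableT_comp => //; apply: measurable_funX; exact: measurable_funB.
apply: measurable_funV; under eq_fun do rewrite -mulr_natr.
exact: measurable_funM.
Qed.

Lemma measurable_gauss_pdf m u : measurable_fun setT (gauss_pdf m u).
Proof. exact: measurable_fun_gauss. Qed.

Lemma integral_gauss_pdf m u : 0 < u -> (\int[mu]_t (gauss_pdf m u t)%:E = 1)%E.
Proof.
move=> u0; rewrite -(@integral_normal_pdf R m (Num.sqrt u)).
by apply: eq_integral => t _; rewrite gauss_pdfE.
Qed.

(** A normal density of four times the variance absorbs the factor [`|t - m|], which
    gives the finiteness of the mean without computing it. *)
Lemma gauss_abs_le m u t : 0 < u ->
  `|t - m| * gauss_pdf m u t <= 2 * Num.sqrt u * gauss_pdf m (4 * u) t.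
Proof.
move=> u0; rewrite /gauss_pdf; set d := t - m.
have s0 : 0 < Num.sqrt u by rewrite sqrtr_gt0.
have su : Num.sqrt u ^+ 2 = u by rewrite sqr_sqrtr// ltW.
set X := u * pi *+ 2.
have X0 : 0 < X by rewrite /X mulrn_wgt0// mulr_gt0// pi_gt0.
have -> : Num.sqrt (4 * u * pi *+ 2) = 2 * Num.sqrt X.
  rewrite -mulrA -mulrnAr -/X sqrtrM//; congr (_ * _).
  by rewrite (_ : 4 = 2 ^+ 2); [rewrite sqrtr_sqr ger0_norm|ring].
have sX : 0 < Num.sqrt X by rewrite sqrtr_gt0.
rewrite invfM; set p := (Num.sqrt X)^-1.
rewrite [leRHS](_ : _ = p * (Num.sqrt u * expR (- d ^+ 2 / (4 * u *+ 2)))); last by field.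
rewrite mulrCA.
rewrite ler_pM2l ?invr_gt0//.
have -> : - d ^+ 2 / (4 * u *+ 2) = 3 * d ^+ 2 / (8 * u) + (- d ^+ 2 / (u *+ 2)).
  by field; rewrite gt_eqF.
rewrite expRD mulrA ler_pM2r ?expR_gt0//.
apply: (@le_trans _ _ (Num.sqrt u * (1 + 3 * d ^+ 2 / (8 * u)))); last first.
  by rewrite ler_pM2l// expR_ge1Dx.
move: s0 su; move: (Num.sqrt u) => s s0 <-.
have -> : s * (1 + 3 * d ^+ 2 / (8 * s ^+ 2)) = (s ^+ 2 + 3 / 8 * `|d| ^+ 2) / s.
  by rewrite real_normK ?num_real//; field; rewrite gt_eqF.
rewrite ler_pdivlMr//.
have := sqr_ge0 (s - `|d| / 2); have := sqr_ge0 (`|d|); nra.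
Qed.

Lemma measurable_maxr0 (f : R -> R) : measurable_fun setT f ->
  measurable_fun setT (fun t => Num.max (f t) 0).
Proof. by move=> mf; exact: measurable_maxr. Qed.

(** Reflection about [m] exchanges the two parts. *)
Lemma gauss_centred_parts m u : 0 < u ->
  (\int[mu]_t (Num.max (t - m) 0 * gauss_pdf m u t)%:E
   = \int[mu]_t (Num.max (m - t) 0 * gauss_pdf m u t)%:E)%E /\
  (\int[mu]_t (Num.max (t - m) 0 * gauss_pdf m u t)%:E
   <= (2 * Num.sqrt u)%:E)%E.
Proof.
move=> u0.
have mg : measurable_fun setT (fun t => (Num.max (t - m) 0 * gauss_pdf m u t)%:E).
  apply/measurable_EFinP; apply: measurable_funM; last exact: measurable_gauss_pdf.
  by apply: measurable_maxr0; exact: measurable_funB.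
have g0 t : (0 <= (Num.max (t - m) 0 * gauss_pdf m u t)%:E)%E.
  by rewrite lee_fin mulr_ge0 ?gauss_pdf_ge0// le_max lexx orbT.
split.
  rewrite [LHS](@ge0_integral_affine R (-1) (2 * m))//.
  rewrite normrN1 mul1e; apply: eq_integral => t _.
  rewrite /gauss_pdf; congr ((Num.max _ _ * (_ * expR (- _ / _)))%:E); ring.
rewrite -[leRHS]mule1 -(integral_gauss_pdf m (_ : 0 < 4 * u))//; last by rewrite mulr_gt0.
rewrite -ge0_integralZl//; last 2 first.
- by apply/measurable_EFinP; exact: measurable_gauss_pdf.
- by move=> t _; rewrite lee_fin gauss_pdf_ge0.
apply: ge0_le_integral => //.
  apply/measurable_EFinP; apply: measurable_funM => //; exact: measurable_gauss_pdf.
move=> t _; rewrite -EFinM lee_fin; apply: le_trans (gauss_abs_le m t u0).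
by rewrite ler_wpM2r ?gauss_pdf_ge0// ge_max normr_ge0 ler_norm.
Qed.

(** The bound is affine in the location and in the standard deviation, hence still
    integrable after averaging over both. *)
Lemma gauss_part_le (r : R -> R) m u : 0 < u -> measurable_fun setT r ->
  (forall t, 0 <= r t <= `|t|) ->
  (\int[mu]_t (r t * gauss_pdf m u t)%:E <= (`|m| + 4 * Num.sqrt u)%:E)%E.
Proof.
move=> u0 mr r0.
have mg := measurable_gauss_pdf m u.
have mp : measurable_fun setT (fun t => Num.max (t - m) 0).
  by apply: measurable_maxr0; exact: measurable_funB.
have mn : measurable_fun setT (fun t => Num.max (m - t) 0).
  by apply: measurable_maxr0; exact: measurable_funB.
have m0 (x : R) : 0 <= Num.max x 0 by rewrite le_max lexx orbT.
apply: (@le_trans _ _ (\int[mu]_t ((`|m| * gauss_pdf m u t)%:E +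
  ((Num.max (t - m) 0 * gauss_pdf m u t)%:E + (Num.max (m - t) 0 * gauss_pdf m u t)%:E)))%E).
  apply: ge0_le_integral => //.
  - by move=> t _; rewrite lee_fin mulr_ge0 ?gauss_pdf_ge0//; case/andP: (r0 t).
  - by apply/measurable_EFinP; exact: measurable_funM.
  - apply/measurable_EFinP; apply: measurable_funD; first exact: measurable_funM.
    by apply: measurable_funD; exact: measurable_funM.
  - move=> t _; rewrite -!EFinD lee_fin -!mulrDl ler_wpM2r ?gauss_pdf_ge0//.
    case/andP: (r0 t) => _ /le_trans; apply.
    have -> : t = m + (t - m) by ring.
    rewrite (le_trans (ler_normD _ _))// lerD2l.
    rewrite (_ : m + (t - m) - m = t - m); last by ring.
    rewrite (_ : m - (m + (t - m)) = - (t - m)); last by ring.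
    set x := t - m; have [x0|x0] := leP 0 x.
      by rewrite ger0_norm// lerDl.
    by rewrite ltr0_norm// add0r le_max lexx.
rewrite ge0_integralD//; last 4 first.
- by move=> t _; rewrite lee_fin mulr_ge0 ?gauss_pdf_ge0.
- by apply/measurable_EFinP; exact: measurable_funM.
- by move=> t _; rewrite adde_ge0// lee_fin mulr_ge0 ?gauss_pdf_ge0.
- by apply/measurable_EFinP; apply: measurable_funD; exact: measurable_funM.
rewrite ge0_integralD//; last 4 first.
- by move=> t _; rewrite lee_fin mulr_ge0 ?gauss_pdf_ge0.
- by apply/measurable_EFinP; exact: measurable_funM.
- by move=> t _; rewrite lee_fin mulr_ge0 ?gauss_pdf_ge0.
- by apply/measurable_EFinP; exact: measurable_funM.
have [e le] := gauss_centred_parts m u0.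
rewrite -e EFinD; apply: leeD.
  under eq_integral do rewrite EFinM.
  rewrite ge0_integralZl//; last 2 first.
  - exact/measurable_EFinP.
  - by move=> t _; rewrite lee_fin gauss_pdf_ge0.
  by rewrite integral_gauss_pdf// mule1.
rewrite (_ : 4 * Num.sqrt u = 2 * Num.sqrt u + 2 * Num.sqrt u); last by ring.
by rewrite EFinD leeD.
Qed.

(** The two signs are kept on separate sides so that only integrals of nonnegative
    functions occur. *)
Lemma gauss_mean m u : 0 < u ->
  (\int[mu]_t (Num.max t 0 * gauss_pdf m u t)%:E + (Num.max (- m) 0)%:E
   = \int[mu]_t (Num.max (- t) 0 * gauss_pdf m u t)%:E + (Num.max m 0)%:E)%E.
Proof.
move=> u0.
have mg := measurable_gauss_pdf m u.
have m0 (x : R) : 0 <= Num.max x 0 by rewrite le_max lexx orbT.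
have I (r s : R -> R) (c : R) : measurable_fun setT r -> measurable_fun setT s ->
   (forall t, 0 <= r t) -> (forall t, 0 <= s t) -> 0 <= c ->
  (\int[mu]_t ((r t + s t + c) * gauss_pdf m u t)%:E =
   \int[mu]_t (r t * gauss_pdf m u t)%:E + \int[mu]_t (s t * gauss_pdf m u t)%:E + c%:E)%E.
  move=> mr ms r0 s0 c0.
  under eq_integral do rewrite !mulrDl !EFinD.
  rewrite ge0_integralD//; last 4 first.
  - by move=> t _; rewrite -EFinD lee_fin addr_ge0// mulr_ge0 ?gauss_pdf_ge0.
  - by apply/measurable_EFinP; apply: measurable_funD; exact: measurable_funM.
  - by move=> t _; rewrite lee_fin mulr_ge0 ?gauss_pdf_ge0.
  - by apply/measurable_EFinP; exact: measurable_funM.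
  rewrite ge0_integralD//; last 4 first.
  - by move=> t _; rewrite lee_fin mulr_ge0 ?gauss_pdf_ge0.
  - by apply/measurable_EFinP; exact: measurable_funM.
  - by move=> t _; rewrite lee_fin mulr_ge0 ?gauss_pdf_ge0.
  - by apply/measurable_EFinP; exact: measurable_funM.
  congr (_ + _)%E.
  under eq_integral do rewrite EFinM.
  rewrite ge0_integralZl//; last 2 first.
  - exact/measurable_EFinP.
  - by move=> t _; rewrite lee_fin gauss_pdf_ge0.
  by rewrite integral_gauss_pdf// mule1.
have [e le] := gauss_centred_parts m u0.
have mid : measurable_fun setT (fun t : R => t) by [].
have mop : measurable_fun setT (fun t : R => - t) by exact: measurable_funN.
have mxB : measurable_fun setT (fun t : R => t - m) by exact: measurable_funB.
have mBx : measurable_fun setT (fun t : R => m - t) by exact: measurable_funB.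
have := I _ _ (Num.max (- m) 0) (measurable_maxr0 mid) (measurable_maxr0 mBx)
  (fun=> m0 _) (fun=> m0 _) (m0 _).
have := I _ _ (Num.max m 0) (measurable_maxr0 mop) (measurable_maxr0 mxB)
  (fun=> m0 _) (fun=> m0 _) (m0 _).
have -> : (\int[mu]_t ((Num.max (- t) 0 + Num.max (t - m) 0 + Num.max m 0) * gauss_pdf m u t)%:E
  = \int[mu]_t ((Num.max t 0 + Num.max (m - t) 0 + Num.max (- m) 0) * gauss_pdf m u t)%:E)%E.
  apply: eq_integral => t _; congr ((_ * _)%:E).
  have mx (x : R) : Num.max x 0 = Num.max (- x) 0 + x.
    by rewrite addr_maxl addNr add0r maxC.
  rewrite (mx t) (mx (t - m)) (mx m) opprB; ring.
move=> -> /esym; rewrite -e.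
set A := (\int[mu]_t (Num.max (t - m) 0 * _)%:E)%E in le *.
have A0 : (0 <= A)%E.
  by apply: integral_ge0 => t _; rewrite lee_fin mulr_ge0 ?gauss_pdf_ge0.
have Af : A \is a fin_num by rewrite ge0_fin_numE// (le_lt_trans le)// ltry.
rewrite !(addeAC _ A) => /(congr1 (fun x => x - A)%E).
by rewrite !addeK.
Qed.

End gaussian.

(** * Inverse gamma integrals *)

Lemma integral_gt0_on d (T : measurableType d) (R : realType)
    (mu : {measure set T -> \bar R}) (D B : set T) (f : T -> \bar R) :
  measurable D -> measurable B -> B `<=` D -> (0 < mu B)%E ->
  measurable_fun D f -> (forall x, D x -> (0 <= f x)%E) ->
  (forall x, B x -> (0 < f x)%E) -> (0 < \int[mu]_(x in D) f x)%E.
Proof.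
move=> mD mB BD muB mf f0 fB.
rewrite lt_neqAle integral_ge0// andbT eq_sym; apply/negP => /eqP I0.
have /(ae_eq_integral_abs _ mD mf) : (\int[mu]_(x in D) `|f x| = 0)%E.
  rewrite -I0; apply: eq_integral => x /[!inE] Dx.
  by rewrite gee0_abs// f0.
case=> N [mN N0 subN].
suff : (mu B <= mu N)%E by rewrite N0 leNgt muB.
apply: le_measure; rewrite ?inE// => x Bx.
apply: subN => /= /(_ (BD _ Bx)) fx0.
by have := fB _ Bx; rewrite fx0 ltxx.
Qed.

Section power_bounds.
Context {R : realType}.
Implicit Types (a x t c q : R).

(** From [expR (t / a) >= t / a]; the constant only has to be explicit. *)
Lemma powR_le_expR a t : 0 < a -> 0 <= t -> t `^ a <= a `^ a * expR t.
Proof.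
move=> a0 t0.
rewrite (_ : t = a * (t / a)); last by rewrite mulrCA mulfV ?gt_eqF// mulr1.
rewrite powRM ?divr_ge0// ?(ltW a0)// ler_pM2l ?powR_gt0//.
rewrite [a * _]mulrC expRM ge0_ler_powR ?nnegrE ?(ltW a0) ?divr_ge0 ?expR_ge0// ?(ltW a0)//.
by rewrite (le_trans _ (expR_ge1Dx _))// lerDr.
Qed.

End power_bounds.

Section inverse_gamma.
Context {R : realType}.
Local Notation mu := (@lebesgue_measure R).
Implicit Types (q c v : R).

Definition inv_gamma_fun q c v : R := v `^ (- q - 1) * expR (- c / v).

Lemma inv_gamma_fun_ge0 q c v : 0 <= inv_gamma_fun q c v.
Proof. by rewrite mulr_ge0 ?powR_ge0 ?expR_ge0. Qed.

Lemma inv_gamma_fun_gt0 q c v : 0 < v -> 0 < inv_gamma_fun q c v.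
Proof. by move=> v0; rewrite mulr_gt0 ?powR_gt0 ?expR_gt0. Qed.

Lemma measurable_inv_gamma_fun d (T : measurableType d) (D : set T) q (f g : T -> R) :
  measurable_fun D f -> measurable_fun D g ->
  measurable_fun D (fun z => inv_gamma_fun q (f z) (g z)).
Proof.
move=> mf mg; apply: measurable_funM; first exact: measurable_fun_powR.
apply: measurable_fun_expR; apply: measurable_funM; first exact: measurable_funN.
exact: measurable_funV.
Qed.

Definition inv_gamma q c : \bar R :=
  (\int[mu]_(v in `]0%R, +oo[) (inv_gamma_fun q c v)%:E)%E.

(** Substituting [c * v] for [v].  This is why the variance integrates out to a power
    of [s + l * |X|^2], that is, of [1 + w * l]. *)
Lemma inv_gamma_scale q c : 0 < c ->
  inv_gamma q c = ((c `^ (- q))%:E * inv_gamma q 1)%E.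
Proof.
move=> c0; rewrite /inv_gamma integral_mkcond [X in (_ * X)%E]integral_mkcond.
have mf (c' : R) : measurable_fun setT ((fun v => (inv_gamma_fun q c' v)%:E) \_ `]0%R, +oo[).
  apply/(measurable_restrictT _ _).1 => //.
  by apply/measurable_EFinP; exact: measurable_inv_gamma_fun.
have f0 (c' : R) v : (0 <= ((fun v => (inv_gamma_fun q c' v)%:E) \_ `]0%R, +oo[) v)%E.
  by rewrite patchE; case: ifPn => // _; rewrite lee_fin inv_gamma_fun_ge0.
rewrite [LHS](@ge0_integral_affine R c 0)//; last by rewrite gt_eqF.
have mfc : measurable_fun setT (fun v : measurableTypeR R =>
    ((fun v => (inv_gamma_fun q c v)%:E) \_ `]0%R, +oo[) (c * v + 0)).
  exact: (measurableT_comp (mf c) (measurable_affine c 0)).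
rewrite -[LHS](ge0_integralZl _ measurableT mfc)//.
rewrite -[RHS]ge0_integralZl; [|exact: measurableT|exact: mf|by move=> ? _; exact: f0|by rewrite lee_fin powR_ge0].
apply: eq_integral => v _; rewrite addr0 !patchE !mem_setE !in_itv/= !andbT pmulr_rgt0//.
case: ifPn => v0; last by rewrite !mule0.
rewrite -!EFinM /inv_gamma_fun; congr EFin.
have cc : c * c `^ (- q - 1) = c `^ (- q).
  rewrite -{1}(powRr1 (ltW c0)) -powRD ?(gt_eqF c0) ?implybT//.
  by congr (_ `^ _); ring.
rewrite gtr0_norm// powRM ?(ltW c0) ?(ltW v0)// -cc -!mulrA.
do 3 congr (_ * _); congr expR; field.
by rewrite !gt_eqF.
Qed.

Lemma integral_inv_sqr : (\int[mu]_(v in `[1%R, +oo[) (v ^- 2)%:E = 1)%E.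
Proof.
rewrite (@ge0_continuous_FTC2y R (fun v => v ^- 2) (fun v => - v^-1) 1 0).
- by rewrite sub0e -EFinN opprK invr1.
- by move=> v v1; rewrite invr_ge0 sqr_ge0.
- apply: continuous_in_subspaceT => v; rewrite inE/= in_itv/= andbT => v1.
  apply: cvgV; first by rewrite expf_neq0// gt_eqF// (lt_le_trans _ v1).
  exact: exprn_continuous.
- rewrite -oppr0; apply: cvgN.
  apply/(@gtr0_cvgV0 _ _ _ _ (fun x : R => x)); last exact: cvg_id.
  by near=> x; near: x; exact: nbhs_pinfty_gt.
- move=> v v1; apply: derivableN; apply: derivableV => //.
  by rewrite gt_eqF// (lt_trans _ v1).
- apply: cvg_at_right_filter; apply: cvgN; apply: cvgV => //.
- move=> v; rewrite in_itv/= andbT => v1.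
  have v0 : v != 0 by rewrite gt_eqF// (lt_trans _ v1).
  rewrite derive1E deriveN ?deriveV//; last exact: derivableV.
  by rewrite derive_id scaleNr opprK scaler1.
Unshelve. all: end_near. Qed.

(** Near zero the exponential beats the power; at infinity the integrand is below
    [v ^- 2]. *)
Lemma inv_gamma_lty q c : 1 <= q -> 0 < c -> (inv_gamma q c < +oo)%E.
Proof.
move=> q1 c0; rewrite /inv_gamma.
have mf (D : set R) : measurable_fun D (fun v => (inv_gamma_fun q c v)%:E).
  by apply/measurable_EFinP; exact: measurable_inv_gamma_fun.
pose C := (c^-1) `^ (q + 1) * (q + 1) `^ (q + 1).
have C0 : 0 <= C by rewrite mulr_ge0 ?powR_ge0.
rewrite (_ : `]0%R, +oo[%classic = `]0%R, 1%R] `|` `]1%R, +oo[ :> set R); last first.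
  by rewrite -itv_bndbnd_setU// bnd_simp.
rewrite ge0_integral_setU//; last 3 first.
- exact: mf.
- by move=> v _; rewrite lee_fin inv_gamma_fun_ge0.
- apply/disj_setPS => v []/=; rewrite !in_itv/= andbT => /andP[_ v1] v1'.
  by move: v1'; rewrite ltNge v1.
apply: lte_add_pinfty.
  apply: (@le_lt_trans _ _ (\int[mu]_(v in `]0%R, 1%R]) C%:E)%E); last first.
    by rewrite integral_cst//= lebesgue_measure_itv/= lte01 oppr0 adde0 mule1 ltry.
  apply: ge0_le_integral => //.
  - by move=> v _; rewrite lee_fin inv_gamma_fun_ge0.
  - exact: mf.
  - move=> v; rewrite /= in_itv/= => /andP[v0 v1]; rewrite lee_fin /inv_gamma_fun.
    rewrite (_ : - q - 1 = - (q + 1)); last by ring.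
    rewrite powRN mulNr expRN -invfM.
    rewrite -[leLHS]mul1r ler_pdivrMr ?mulr_gt0 ?powR_gt0 ?expR_gt0//.
    have vE : v^-1 = c^-1 * (c / v) by rewrite mulKf ?gt_eqF.
    have : (v^-1) `^ (q + 1) <= C * expR (c / v).
      rewrite {1}vE powRM ?invr_ge0 ?divr_ge0 ?(ltW c0) ?(ltW v0)//.
      rewrite /C -mulrA ler_wpM2l ?powR_ge0// powR_le_expR//.
        by rewrite ltr_wpDl// (le_trans _ q1).
      by rewrite divr_ge0 ?(ltW c0) ?(ltW v0).
    rewrite -powR_inv1 ?(ltW v0)// -powRrM mulN1r powRN => h.
    rewrite mulrCA -ler_pdivrMl ?powR_gt0// mulr1.
    by rewrite mulrC in h *.
apply: (@le_lt_trans _ _ (\int[mu]_(v in `[1%R, +oo[) (v ^- 2)%:E)%E); last first.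
  by rewrite integral_inv_sqr ltry.
rewrite (integral_itv_obnd_cbnd (mf _)).
apply: ge0_le_integral => //.
- by move=> v _; rewrite lee_fin inv_gamma_fun_ge0.
- exact: mf.
- apply/measurable_EFinP.
  by apply: (@measurableT_comp _ _ _ _ _ _ (fun x : R => x^-1)) => //; exact: measurable_invr.
- move=> v; rewrite /= in_itv/= andbT => v1; rewrite lee_fin /inv_gamma_fun.
  have v0 : 0 < v by rewrite (lt_le_trans _ v1).
  rewrite -[leRHS]mulr1; apply: ler_pM; rewrite ?powR_ge0 ?expR_ge0//.
    by rewrite -powR_invn ?(ltW v0)// ler_powR//; lra.
  by rewrite expR_le1 mulNr oppr_le0 divr_ge0 ?(ltW c0) ?(ltW v0).
Qed.

Lemma inv_gamma_gt0 q c : (0 < inv_gamma q c)%E.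
Proof.
have mu01 : (0 < mu `]0%R, 1%R]%classic)%E.
  by rewrite lebesgue_measure_itv/= lte01 oppr0 adde0.
rewrite /inv_gamma.
apply: (@integral_gt0_on _ _ R mu `]0%R, +oo[%classic `]0%R, 1%R]%classic) => //.
- by apply: subset_itvl; rewrite bnd_simp.
- by apply/measurable_EFinP; exact: measurable_inv_gamma_fun.
- by move=> v _; rewrite lee_fin inv_gamma_fun_ge0.
- by move=> v; rewrite /= in_itv/= => /andP[v0 _]; rewrite lte_fin inv_gamma_fun_gt0.
Qed.

End inverse_gamma.

(** * The posterior as an integral over the mixing variable and the variance *)

Section conjugacy.
Context {R : realType}.
Implicit Types (l v s t x a : R).

Lemma sqrt_half_powR x : 0 <= x -> Num.sqrt x = x `^ (1 / 2).
Proof. by move=> x0; rewrite div1r powR12_sqrt. Qed.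

Lemma sqrt_exprn_powR x p : 0 <= x -> Num.sqrt x ^+ p = x `^ (p%:R / 2).
Proof.
move=> x0; rewrite sqrt_half_powR// -powR_mulrn ?powR_ge0// -powRrM.
by congr (_ `^ _); rewrite mul1r mulrC.
Qed.

Lemma powR_div x y r : 0 <= x -> 0 < y -> (x / y) `^ r = x `^ r * y `^ (- r).
Proof.
move=> x0 y0; rewrite powRM ?invr_ge0 ?(ltW y0)//; congr (_ * _).
by rewrite -(powR_inv1 (ltW y0)) -powRrM mulN1r.
Qed.

(** Completing the square: under the scale-mixture prior the conditional law of
    a coordinate of the mean, given the observation and the mixing variable, is
    normal with mean [x * (1 - l)] and variance [v * (1 - l)]. *)
Lemma gauss_pdf_conjugate l v t x : 0 < l < 1 -> 0 < v ->
  gauss_pdf t v x * expR (- (l / (1 - l)) * (t ^+ 2 / v / 2)) =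
  Num.sqrt (1 - l) * expR (- (l * x ^+ 2) / (v * 2))
  * gauss_pdf (x * (1 - l)) (v * (1 - l)) t.
Proof.
move=> /andP[l0 l1] v0; have l1' : 0 < 1 - l by rewrite subr_gt0.
rewrite /gauss_pdf.
have swap (w : R) : v * (1 - l) * w *+ 2 = (1 - l) * (v * w *+ 2) by ring.
rewrite swap sqrtrM ?(ltW l1')//.
have q0 : Num.sqrt (1 - l) != 0 by rewrite gt_eqF// sqrtr_gt0.
set q := Num.sqrt (1 - l) in q0 *; rewrite [(q * _)^-1]invfM.
set r := (Num.sqrt (v * pi *+ 2))^-1.
rewrite [RHS](_ : _ = r * (expR (- (l * x ^+ 2) / (v * 2)) *
  expR (- (t - x * (1 - l)) ^+ 2 / (v * (1 - l) *+ 2)))); last by field.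
rewrite -!mulrA -!expRD; congr (_ * expR _).
field.
by rewrite !gt_eqF.
Qed.

Context (p n : nat).
Implicit Types (theta X : p.-tuple R).

Lemma model_pdfE theta v X s : 0 < v -> model_pdf n theta v X s =
  (\prod_(i < p) gauss_pdf (tnth theta i) v (tnth X i)) * (v^-1 * chi2_pdf n (s / v)).
Proof.
move=> v0; rewrite /model_pdf; congr (_ * _).
by apply: eq_bigr => i _; rewrite gauss_pdfE.
Qed.

Lemma Gamma_ge0 x : 0 <= Gamma x.
Proof. by apply: Rintegral_ge0 => t _; rewrite mulr_ge0 ?powR_ge0 ?expR_ge0. Qed.

Lemma chi2_pdf_ge0 t : 0 <= chi2_pdf n t.
Proof.
by rewrite mulr_ge0 ?invr_ge0 ?mulr_ge0 ?powR_ge0 ?expR_ge0 ?Gamma_ge0.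
Qed.

Lemma model_pdf_ge0 theta v X s : 0 < v -> 0 <= model_pdf n theta v X s.
Proof.
move=> v0; rewrite model_pdfE// mulr_ge0//.
  by apply: prodr_ge0 => i _; exact: gauss_pdf_ge0.
by rewrite mulr_ge0 ?chi2_pdf_ge0// invr_ge0 ltW.
Qed.

Lemma prod_gauss_conjugate l v theta X : 0 < l < 1 -> 0 < v ->
  (\prod_(i < p) gauss_pdf (tnth theta i) v (tnth X i))
  * expR (- (l / (1 - l)) * ((norm2 theta / Num.sqrt v) ^+ 2 / 2)) =
  (1 - l) `^ (p%:R / 2) * expR (- (l * sqnorm X) / (v * 2))
  * \prod_(i < p) gauss_pdf (tnth X i * (1 - l)) (v * (1 - l)) (tnth theta i).
Proof.
move=> l01 v0; have l1' : 0 < 1 - l by rewrite subr_gt0; case/andP: l01.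
have -> : (norm2 theta / Num.sqrt v) ^+ 2 = sqnorm theta / v.
  rewrite expr_div_n /norm2 !sqr_sqrtr ?(ltW v0)//.
  by apply: sumr_ge0 => i _; exact: sqr_ge0.
have -> : expR (- (l / (1 - l)) * (sqnorm theta / v / 2)) =
    \prod_(i < p) expR (- (l / (1 - l)) * (tnth theta i ^+ 2 / v / 2)).
  by rewrite -expR_sum; congr expR; rewrite /sqnorm -mulr_sumr -!mulr_suml.
have -> : expR (- (l * sqnorm X) / (v * 2)) =
    \prod_(i < p) expR (- (l * tnth X i ^+ 2) / (v * 2)).
  by rewrite -expR_sum; congr expR; rewrite /sqnorm -mulr_suml mulr_sumr sumrN.
have -> : (1 - l) `^ (p%:R / 2) = \prod_(i < p) Num.sqrt (1 - l).
  by rewrite prodr_const card_ord sqrt_exprn_powR ?(ltW l1').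
rewrite -!big_split /=; apply: eq_bigr => i _; exact: gauss_pdf_conjugate.
Qed.

(** The density of the mixing variable after its powers of [1 - l] have cancelled
    those produced by completing the square. *)
Definition mixing (a : R) (L : R -> R) l : R := l `^ (p%:R / 2 + a) * L l^-1.

(** The part of the chi-square density of [s / v] that is free of [v]. *)
Definition chi2_factor s : R :=
  s `^ (n%:R / 2 - 1) / (2 `^ (n%:R / 2) * Gamma (n%:R / 2)).

(** Likelihood times prior splits into a function of [l], an inverse gamma kernel
    in [v] and, given both, a product of normal densities in [theta]. *)
Lemma posterior_kernelE a (L : R -> R) l v s theta X :
  0 < l < 1 -> 0 < v -> 0 < s ->
  model_pdf n theta v X s * (v^-1 * (Num.sqrt v ^+ p)^-1)
  * ((l / (1 - l)) `^ (p%:R / 2)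
     * expR (- (l / (1 - l)) * ((norm2 theta / Num.sqrt v) ^+ 2 / 2))
     * l `^ a * L l^-1)
  = chi2_factor s * mixing a L l
    * inv_gamma_fun ((p + n)%:R / 2) ((s + l * sqnorm X) / 2) v
    * \prod_(i < p) gauss_pdf (tnth X i * (1 - l)) (v * (1 - l)) (tnth theta i).
Proof.
move=> l01 v0 s0; have [l0 l1] := andP l01.
have l1' : 0 < 1 - l by rewrite subr_gt0.
rewrite model_pdfE//.
set P := \prod_(i < p) _; set Q := \prod_(i < p) _; set E := expR _.
have PE : P * E = _ := prod_gauss_conjugate theta X l01 v0.
rewrite [LHS](_ : _ = (P * E) * (v^-1 * chi2_pdf n (s / v)) *
  (v^-1 * (Num.sqrt v ^+ p)^-1) * ((l / (1 - l)) `^ (p%:R / 2) * l `^ a * L l^-1));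
  last by ring.
rewrite PE -/Q /mixing /chi2_factor /chi2_pdf /inv_gamma_fun.
rewrite sqrt_exprn_powR ?(ltW v0)// -(powRN v).
rewrite (powR_div _ (ltW s0) v0) (powR_div _ (ltW l0) l1') (powRN (1 - l)).
rewrite [l `^ (_ + _)]powRD ?(gt_eqF l0) ?implybT//.
have -> : expR (- ((s + l * sqnorm X) / 2) / v) =
    expR (- (l * sqnorm X) / (v * 2)) * expR (- (s / v) / 2).
  by rewrite -expRD; congr expR; field; rewrite gt_eqF.
have -> : v `^ (- ((p + n)%:R / 2) - 1) =
    v^-1 * v `^ (- (n%:R / 2 - 1)) * v^-1 * v `^ (- (p%:R / 2)).
  rewrite -(powR_inv1 (ltW v0)) -!powRD ?(gt_eqF v0) ?implybT//.
  by congr (_ `^ _); rewrite natrD; field.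
have q0 : (1 - l) `^ (p%:R / 2) != 0 by rewrite gt_eqF// powR_gt0.
move: q0; set q := (1 - l) `^ _ => q0.
set e1 := expR _; set e2 := expR _; set v1 := v^-1.
set G := (_ * Gamma _)^-1.
by field.
Qed.

End conjugacy.

Section posterior_integral.
Context {R : realType}.
Local Notation mu := (@lebesgue_measure R).
Variables (p n : nat) (a : R) (L : R -> R).
Hypothesis mL : measurable_fun (`]0%R, 1%R[ : set (measurableTypeR R)) (fun l => L l^-1).
Hypothesis L0 : forall l : R, 0 < l < 1 -> 0 <= L l^-1.
Variables (hv : R -> R) (r : 'I_p -> R -> R).
Hypothesis mhv : measurable_fun setT hv.
Hypothesis hv0 : forall v : R, 0 < v -> 0 <= hv v.
Hypothesis mr : forall i, measurable_fun setT (r i).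
Hypothesis r0 : forall i t, 0 <= r i t.
Variables (X : p.-tuple R) (s : R).
Hypothesis s0 : 0 < s.

Local Notation q := ((p + n)%:R / 2).
Local Notation T1 := (p.-tuple (measurableTypeR R) * measurableTypeR R)%type.

Lemma mixing_ge0 (l : R) : 0 < l < 1 -> 0 <= mixing p a L l.
Proof. by move=> l01; rewrite mulr_ge0 ?powR_ge0 ?L0. Qed.

Lemma measurable_mixing :
  measurable_fun (`]0%R, 1%R[ : set (measurableTypeR R)) (mixing p a L).
Proof.
apply: measurable_funM => //; apply: measurable_fun_powR; exact: measurable_id.
Qed.

Lemma half_spaceE : @half_space R p =
  [set: p.-tuple (measurableTypeR R)] `*` (`]0%R, +oo[ : set (measurableTypeR R)).
Proof.
by apply/seteqP; split => -[x v] /=; rewrite /half_space/= in_itv/= andbT; [|case].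
Qed.

Let weight (l v : R) : R := chi2_factor n s * mixing p a L l *
  (hv v * inv_gamma_fun q ((s + l * sqnorm X) / 2) v).

Let weight_ge0 (l v : R) : 0 < l < 1 -> 0 < v -> 0 <= weight l v.
Proof.
move=> l01 v0; rewrite mulr_ge0//.
  rewrite mulr_ge0 ?mixing_ge0// mulr_ge0 ?powR_ge0//.
  by rewrite invr_ge0 mulr_ge0 ?powR_ge0 ?Gamma_ge0.
by rewrite mulr_ge0 ?hv0 ?inv_gamma_fun_ge0.
Qed.

Let mweight : measurable_fun
  ((`]0%R, 1%R[ : set (measurableTypeR R)) `*` (`]0%R, +oo[ : set (measurableTypeR R)))
  (fun z => weight z.1 z.2).
Proof.
apply: measurable_funM.
  apply: measurable_funM => //.
  apply: (measurable_comp _ _ measurable_mixing) => //; last exact: measurable_funTS.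
  by move=> _ [[l v] [/= l01 _] <-].
apply: measurable_funTS; apply: measurable_funM; first exact: measurableT_comp.
apply: measurable_inv_gamma_fun; last exact: measurable_snd.
apply: measurable_funM => //; apply: measurable_funD => //.
by apply: measurable_funM => //; exact: measurable_fst.
Qed.

(** For a product function of [theta] the innermost integral factors into
    one-dimensional normal expectations. *)
Lemma unnormalized_posterior_prodE :
  (unnormalized_posterior n a L (fun theta v => (hv v * \prod_(i < p) r i (tnth theta i))%R) X s
  = \int[mu]_(l in `]0%R, 1%R[) \int[mu]_(v in `]0%R, +oo[)
     ((weight l v)%:E *
      \prod_(i < p) \int[mu]_t (r i t * gauss_pdf (tnth X i * (1 - l)) (v * (1 - l)) t)%:E))%E.
Proof.
pose F (z : T1) (l : R) := weight l z.2 *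
  \prod_(i < p) (r i (tnth z.1 i) * gauss_pdf (tnth X i * (1 - l)) (z.2 * (1 - l)) (tnth z.1 i)).
have F0 z l : 0 < z.2 -> 0 < l < 1 -> 0 <= F z l.
  move=> z0 l01; rewrite mulr_ge0 ?weight_ge0// prodr_ge0// => i _.
  by rewrite mulr_ge0 ?gauss_pdf_ge0.
have mH : measurable (@half_space R p).
  by rewrite half_spaceE; exact: measurableX.
have mF : measurable_fun (@half_space R p `*` (`]0%R, 1%R[ : set (measurableTypeR R)))
    (fun z => (F z.1 z.2)%:E).
  apply/measurable_EFinP; apply: measurable_funM.
    apply: (measurable_comp _ _ mweight (g := fun z : T1 * measurableTypeR R => (z.2, z.1.2))).
    - exact: measurableX.
    - by move=> _ [[[t v] l] [/= v0 l01] <-]; split => //=; rewrite in_itv/= andbT.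
    - apply: measurable_funTS; apply: measurable_fun_pair; first exact: measurable_snd.
      exact: measurableT_comp.
  apply: measurable_funTS; apply: measurable_prod => i _.
  have mt : measurable_fun setT (fun z : T1 * measurableTypeR R => tnth z.1.1 i).
    apply: (measurableT_comp (@measurable_tnth _ _ _ i)).
    exact: measurableT_comp.
  have ml : measurable_fun setT (fun z : T1 * measurableTypeR R => 1 - z.2).
    apply: measurable_funB; first exact: measurable_cst.
    exact: measurable_snd.
  have mv : measurable_fun setT (fun z : T1 * measurableTypeR R => z.1.2).
    exact: (measurableT_comp measurable_snd measurable_fst).
  apply: measurable_funM; first exact: (measurableT_comp (mr i) mt).
  apply: measurable_fun_gauss; [|exact: measurable_funM|exact: mt].
  by apply: measurable_funM; [exact: measurable_cst|exact: ml].
transitivity (\int[@half_space_measure R p]_(z in @half_space R p)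
    \int[mu]_(l in `]0%R, 1%R[) (F z l)%:E)%E.
  apply: eq_integral => -[theta v] /[!inE] /= v0; rewrite /half_space/= in v0.
  rewrite /prior /G_prior muleA -EFinM -ge0_integralZl//=.
  - apply: eq_integral => l; rewrite inE/= in_itv/= => l01.
    rewrite -EFinM; congr EFin; rewrite /F /weight /= big_split/=.
    have := posterior_kernelE n a L theta X l01 v0 s0.
    set A := model_pdf _ _ _ _ _; set B := _ * _ `^ a * _.
    move=> e; transitivity (hv v * \prod_(i < p) r i (tnth theta i) *
      (A * (v^-1 / Num.sqrt v ^+ p) * B)); first by ring.
    by rewrite e; ring.
  - apply/measurable_EFinP; apply: measurable_funM => //.
    apply: measurable_funM; last exact: measurable_fun_powR.
    have ml : measurable_fun (`]0%R, 1%R[ : set (measurableTypeR R)) (fun l => l / (1 - l)).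
      by apply: measurable_funM => //; apply: measurable_funV; exact: measurable_funB.
    apply: measurable_funM; first exact: measurable_fun_powR.
    apply: measurable_fun_expR; apply: measurable_funM => //.
    exact: measurable_funN.
  - move=> l; rewrite /= in_itv/= => l01.
    by rewrite lee_fin !mulr_ge0 ?powR_ge0 ?expR_ge0 ?L0.
  - have h1 : 0 <= hv v * \prod_(i < p) r i (tnth theta i).
      by rewrite mulr_ge0 ?hv0 ?prodr_ge0.
    have h2 : 0 <= v^-1 / Num.sqrt v ^+ p.
      by rewrite divr_ge0 ?invr_ge0 ?(ltW v0)// exprn_ge0 ?sqrtr_ge0.
    rewrite lee_fin; apply: mulr_ge0 h2; apply: mulr_ge0 h1 _.
    exact: model_pdf_ge0.
have F0' (z : T1) (l : measurableTypeR R) : half_space z -> `]0%R, 1%R[%classic l ->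
    (0 <= (fun y : T1 * measurableTypeR R => (F y.1 y.2)%:E) (z, l))%E.
  by move=> z0; rewrite /= in_itv/= => l01; rewrite lee_fin F0.
have m01 : measurable (`]0%R, 1%R[ : set (measurableTypeR R)) by exact: measurable_itv.
pose m12 := product_sigma_finite_measure (lebesgue_tuple R p) mu.
apply: etrans; first exact: (@tonelli_on _ _ _ _ R m12 mu _ _ _ mH m01 mF F0').
apply: eq_integral => l; rewrite inE/= in_itv/= => l01.
rewrite half_spaceE.
have mFl : measurable_fun (setT `*` (`]0%R, +oo[ : set (measurableTypeR R)))
    (fun z : T1 => (F z l)%:E).
  rewrite -half_spaceE.
  apply: (measurable_comp _ _ mF (g := fun z : T1 => (z, l))).
  - exact: measurableX.
  - by move=> _ [[t v] /= v0 <-]; split => //=; rewrite in_itv.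
  - by apply: measurable_funTS; exact: measurable_fun_pair.
have Fl0 (t : p.-tuple (measurableTypeR R)) (v : measurableTypeR R) : [set: _] t ->
    `]0%R, +oo[%classic v -> (0 <= (fun z : T1 => (F z l)%:E) (t, v))%E.
  by move=> _; rewrite /= in_itv/= andbT => v0; rewrite lee_fin F0.
have m0y : measurable (`]0%R, +oo[ : set (measurableTypeR R)) by exact: measurable_itv.
apply: etrans; first exact: (tonelli_on2 _ _ measurableT m0y mFl Fl0).
apply: eq_integral => v; rewrite inE/= in_itv/= andbT => v0.
rewrite /F/=.
have mg i : measurable_fun setT (fun t => r i t *
    gauss_pdf (tnth X i * (1 - l)) (v * (1 - l)) t).
  by apply: measurable_funM => //; exact: measurable_gauss_pdf.
under eq_integral do rewrite EFinM.
rewrite ge0_integralZl//; last 3 first.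
- apply/measurable_EFinP; apply: measurable_prod => i _.
  exact: (measurable_comp_tnth i (mg i)).
- by move=> t _; rewrite lee_fin prodr_ge0// => i _; rewrite mulr_ge0 ?gauss_pdf_ge0.
- by rewrite lee_fin weight_ge0.
rewrite (@integral_lebesgue_tuple_prod R p (fun i t => r i t *
    gauss_pdf (tnth X i * (1 - l)) (v * (1 - l)) t))//.
by move=> i t; rewrite mulr_ge0 ?gauss_pdf_ge0.
Qed.

End posterior_integral.

(** * Gamma integrals *)

Section gamma_function.
Context {R : realType}.
Local Notation mu := (@lebesgue_measure R).
Implicit Types (x t c : R).

Definition gamma_fun x c t : R := t `^ (x - 1) * expR (- (c * t)).

Lemma gamma_fun_ge0 x c t : 0 <= gamma_fun x c t.
Proof. by rewrite mulr_ge0 ?powR_ge0 ?expR_ge0. Qed.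

Lemma measurable_gamma_fun x c (D : set (measurableTypeR R)) :
  measurable_fun D (gamma_fun x c).
Proof.
apply: measurable_funM; first by apply: measurable_fun_powR; exact: measurable_id.
apply: measurable_fun_expR; apply: measurable_funN.
by apply: measurable_funM => //; exact: measurable_id.
Qed.

Lemma integral_expR_lty c : 0 < c ->
  (\int[mu]_(t in `]0%R, +oo[) (expR (- (c * t)))%:E < +oo)%E.
Proof.
move=> c0.
have ci : 0 <= c^-1 by rewrite invr_ge0 ltW.
have mE : measurable_fun (`]0%R, +oo[ : set (measurableTypeR R))
    (fun t => (c^-1 * exponential_pdf c t)%:E).
  apply/measurable_EFinP; apply: measurable_funM => //.
  by apply: measurable_funTS; exact: measurable_exponential_pdf.
apply: (@le_lt_trans _ _ (\int[mu]_(t in `]0%R, +oo[) (c^-1 * exponential_pdf c t)%:E)%E).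
  apply: ge0_le_integral => //.
  - apply/measurable_EFinP; apply: measurable_fun_expR; apply: measurable_funN.
    by apply: measurable_funM => //; exact: measurable_id.
  - move=> t; rewrite /= in_itv/= andbT => t0.
    rewrite lee_fin exponential_pdfE ?(ltW t0)//.
    by rewrite mulKf ?gt_eqF// mulNr.
apply: (@le_lt_trans _ _ (\int[mu]_t (c^-1 * exponential_pdf c t)%:E)%E).
  apply: ge0_subset_integral => //.
    apply/measurable_EFinP; apply: measurable_funM => //.
    exact: measurable_exponential_pdf.
  by move=> t _; rewrite lee_fin mulr_ge0// exponential_pdf_ge0// ltW.
under eq_integral do rewrite EFinM.
rewrite ge0_integralZl//.
- by rewrite integral_exponential_pdf// mule1 ltry.
- by apply/measurable_EFinP; exact: measurable_exponential_pdf.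
- by move=> t _; rewrite lee_fin exponential_pdf_ge0// ltW.
Qed.

(** Half of the exponential absorbs the power, the other half is integrated. *)
Lemma integrable_gamma_fun x c : 1 <= x -> 0 < c ->
  mu.-integrable `]0%R, +oo[ (EFin \o gamma_fun x c).
Proof.
move=> x1 c0; apply/integrableP; split.
  by apply/measurable_EFinP; exact: measurable_gamma_fun.
have c2 : 0 < c / 2 by rewrite divr_gt0.
pose K : R := (2 / c) `^ x * x `^ x.
have K0 : 0 <= K by rewrite mulr_ge0 ?powR_ge0.
pose M : R := 1 + K.
apply: (@le_lt_trans _ _ (\int[mu]_(t in `]0%R, +oo[) (M * expR (- (c / 2 * t)))%:E)%E).
  apply: ge0_le_integral => //.
  - apply: measurableT_comp => //; apply/measurable_EFinP; exact: measurable_gamma_fun.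
  - apply/measurable_EFinP; apply: measurable_funM => //.
    apply: measurable_fun_expR; apply: measurable_funN.
    by apply: measurable_funM => //; exact: measurable_id.
  - move=> t; rewrite /= in_itv/= andbT => t0.
    rewrite lee_fin ger0_norm ?gamma_fun_ge0// /gamma_fun.
    rewrite (_ : expR (- (c * t)) = expR (- (c / 2 * t)) * expR (- (c / 2 * t))); last first.
      by rewrite -expRD; congr expR; field.
    rewrite mulrA ler_wpM2r ?expR_ge0//.
    have xp : 0 < x by rewrite (lt_le_trans _ x1).
    have [t1|t1] := leP t 1.
      apply: (@le_trans _ _ 1); last by rewrite lerDl.
      rewrite -[leRHS]mulr1; apply: ler_pM; rewrite ?powR_ge0 ?expR_ge0//.
        by rewrite -[leRHS](powRr0 t) ger_powR ?t0 ?t1// subr_ge0.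
      by rewrite expR_le1 oppr_le0 mulr_ge0 ?(ltW c2) ?(ltW t0).
    apply: (@le_trans _ _ (t `^ x * expR (- (c / 2 * t)))).
      by rewrite ler_wpM2r ?expR_ge0// ler_powR ?(ltW t1)// gerBl.
    apply: (@le_trans _ _ K); last by rewrite lerDr.
    rewrite expRN ler_pdivrMr ?expR_gt0//.
    have tE : t = 2 / c * (c / 2 * t) by field; rewrite gt_eqF.
    have h1 : 0 <= 2 / c by rewrite divr_ge0// ltW.
    have h2 : 0 <= c / 2 * t by rewrite mulr_ge0 ?(ltW c2) ?(ltW t0).
    rewrite [in leLHS]tE powRM// /K -[leRHS]mulrA.
    by rewrite ler_wpM2l ?powR_ge0// powR_le_expR.
under eq_integral do rewrite EFinM.
rewrite ge0_integralZl//.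
- by rewrite lte_mul_pinfty ?lee_fin ?addr_ge0// integral_expR_lty.
- apply/measurable_EFinP; apply: measurable_fun_expR; apply: measurable_funN.
  by apply: measurable_funM => //; exact: measurable_id.
- by rewrite lee_fin addr_ge0.
Qed.

Lemma Gamma_gt0 x : 1 <= x -> 0 < Gamma x.
Proof.
move=> x1.
have e : Gamma x = \int[mu]_(t in `]0%R, +oo[) gamma_fun x 1 t.
  by apply: eq_Rintegral => t _; rewrite /gamma_fun mul1r.
have i1 := integrable_gamma_fun x1 (ltr01).
have mu01 : (0 < mu `]0%R, 1%R]%classic)%E.
  by rewrite lebesgue_measure_itv/= lte01 oppr0 adde0.
rewrite e -lte_fin /Rintegral fineK; last exact: integrable_fin_num.
apply: (@integral_gt0_on _ _ R mu `]0%R, +oo[%classic `]0%R, 1%R]%classic) => //.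
- by apply: subset_itvl; rewrite bnd_simp.
- exact: (measurable_int _ i1).
- by move=> t _; rewrite lee_fin gamma_fun_ge0.
- move=> t; rewrite /= in_itv/= => /andP[t0 _].
  by rewrite lte_fin mulr_gt0 ?powR_gt0 ?expR_gt0.
Qed.

Lemma chi2_factor_gt0 n (s : R) : (2 <= n)%N -> 0 < s -> 0 < chi2_factor n s.
Proof.
move=> n2 s0; rewrite divr_gt0 ?powR_gt0// mulr_gt0 ?powR_gt0// Gamma_gt0//.
by rewrite ler_pdivlMr// mul1r (ler_nat R 2 n).
Qed.

End gamma_function.

(** * Moments of the mixing density *)

Section mixture_moments.
Context {R : realType}.
Local Notation mu := (@lebesgue_measure R).
Variable kap : R -> R.
Hypothesis kap_ge0 : forall l : R, 0 < l < 1 -> 0 <= kap l.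
Hypothesis kap_int : mu.-integrable `]0%R, 1%R[ (EFin \o kap).
Hypothesis kap_gt0 : (0 < \int[mu]_(l in `]0%R, 1%R[) (kap l)%:E)%E.
Implicit Types (w k l : R) (j : nat).

Definition moment_fun j k w l : R := kap l * (l ^+ j * (1 + w * l) `^ (- k)).

Definition moment j k w : R := \int[mu]_(l in `]0%R, 1%R[) moment_fun j k w l.

(** [shrink] divided by [w] is the posterior mean of the mixing variable under the
    weight [1 / v]: the factor by which the estimator shrinks [X]. *)
Definition shrink k w : R := w * moment 1 k w / moment 0 k w.

Lemma moment_fun_ge0 j k w l : 0 < l < 1 -> 0 <= moment_fun j k w l.
Proof.
move=> l01; rewrite mulr_ge0 ?kap_ge0// mulr_ge0 ?powR_ge0// exprn_ge0// ltW//.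
by case/andP: l01.
Qed.

Lemma measurable_moment_fun j k w :
  measurable_fun (`]0%R, 1%R[ : set (measurableTypeR R)) (moment_fun j k w).
Proof.
have /measurable_EFinP mk := measurable_int _ kap_int.
apply: measurable_funM => //; apply: measurable_funM.
  by apply: measurable_funX; exact: measurable_id.
by apply: measurable_fun_powR; apply: measurable_funD.
Qed.

Lemma moment_fun_le j k w l : 0 <= k -> 0 <= w -> 0 < l < 1 ->
  moment_fun j k w l <= kap l.
Proof.
move=> k0 w0 l01; have /andP[l0 l1] := l01.
rewrite -[leRHS]mulr1 ler_wpM2l ?kap_ge0//.
rewrite -[leRHS]mulr1; apply: ler_pM; rewrite ?powR_ge0 ?exprn_ge0 ?(ltW l0)//.
  by rewrite exprn_ile1 ?(ltW l0) ?(ltW l1).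
rewrite powRN invf_le1 ?powR_gt0 ?ltr_pwDl ?mulr_ge0 ?(ltW l0)//.
have l1w : 1 <= 1 + w * l by rewrite lerDl mulr_ge0// ltW.
by rewrite -[leLHS](powRr0 (1 + w * l)) ler_powR.
Qed.

Lemma integrable_moment j k w : 0 <= k -> 0 <= w ->
  mu.-integrable `]0%R, 1%R[ (EFin \o moment_fun j k w).
Proof.
move=> k0 w0; apply: (le_integrable _ _ _ kap_int) => //.
- by apply/measurable_EFinP; exact: measurable_moment_fun.
- move=> l; rewrite /= in_itv/= => l01; rewrite lee_fin.
  by rewrite !ger0_norm ?kap_ge0 ?moment_fun_ge0 ?moment_fun_le.
Qed.

Lemma moment_ge0 j k w : 0 <= moment j k w.
Proof.
by apply: Rintegral_ge0 => l; rewrite /= in_itv/= => l01; exact: moment_fun_ge0.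
Qed.

Lemma momentE j k w : 0 <= k -> 0 <= w ->
  (\int[mu]_(l in `]0%R, 1%R[) (moment_fun j k w l)%:E = (moment j k w)%:E)%E.
Proof.
move=> k0 w0; rewrite /moment /Rintegral fineK//.
by apply: integrable_fin_num => //; exact: integrable_moment.
Qed.

Lemma moment_gt0 j k w : 0 <= k -> 0 <= w -> 0 < moment j k w.
Proof.
move=> k0 w0; rewrite lt_neqAle moment_ge0 andbT eq_sym; apply/negP => /eqP m0.
have /measurable_EFinP mk := measurable_int _ kap_int.
have mm := measurable_moment_fun j k w.
have : (\int[mu]_(l in `]0%R, 1%R[) `|(moment_fun j k w l)%:E| = 0)%E.
  rewrite -[RHS](_ : (moment j k w)%:E = _); last by rewrite m0.
  rewrite -momentE//; apply: eq_integral => l; rewrite inE/= in_itv/= => l01.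
  by rewrite ger0_norm// moment_fun_ge0.
have mD : measurable (`]0%R, 1%R[ : set (measurableTypeR R)) by exact: measurable_itv.
have mmE : measurable_fun (`]0%R, 1%R[ : set (measurableTypeR R))
  (fun l => (moment_fun j k w l)%:E) by exact/measurable_EFinP.
move=> /(ae_eq_integral_abs mu mD mmE) h.
suff : (\int[mu]_(l in `]0%R, 1%R[) `|(kap l)%:E| = 0)%E.
  move=> k00; move: kap_gt0; rewrite -[X in (0 < X)%E](_ : 0%E = _) ?ltxx//.
  rewrite -k00; apply: eq_integral => l; rewrite inE/= in_itv/= => l01.
  by rewrite ger0_norm// kap_ge0.
apply/(ae_eq_integral_abs mu mD); first exact/measurable_EFinP.
apply: filterS h => l /= h; rewrite in_itv/= => l01.
have := h; rewrite /= in_itv/= l01 => /(_ isT) [].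
have /andP[l0 l1] := l01.
move=> /eqP; rewrite /moment_fun mulf_eq0 => /orP[/eqP->//|].
rewrite gt_eqF// mulr_gt0 ?exprn_gt0// powR_gt0//.
by rewrite ltr_pwDl// mulr_ge0// ltW.
Qed.

End mixture_moments.

(** * The generalized Bayes estimator *)

(** Recovers a signed quantity from an identity between integrals of parts. *)
Lemma sub_of_parts (R : realDomainType) (u v y z : R) :
  u + Num.max (- y) 0 * z = v + Num.max y 0 * z -> u - v = y * z.
Proof.
have -> : Num.max y 0 = Num.max (- y) 0 + y by rewrite addr_maxl addNr add0r maxC.
by rewrite mulrDl; set m := _ * z; set k := y * z => h; lra.
Qed.

Section posterior_mean.
Context {R : realType}.
Local Notation mu := (@lebesgue_measure R).
Variables (p n : nat) (a : R) (L : R -> R).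
Hypothesis n2 : (2 <= n)%N.
Hypothesis mL : measurable_fun (`]0%R, 1%R[ : set (measurableTypeR R)) (fun l => L l^-1).
Hypothesis L0 : forall l : R, 0 < l < 1 -> 0 <= L l^-1.
Local Notation kap := (mixing p a L).
Hypothesis kap_int : mu.-integrable `]0%R, 1%R[ (EFin \o kap).
Hypothesis kap_gt0 : (0 < \int[mu]_(l in `]0%R, 1%R[) (kap l)%:E)%E.
Variables (X : p.-tuple R) (s : R).
Hypothesis s0 : 0 < s.

Local Notation q := ((p + n)%:R / 2 : R).
Local Notation w := (sqnorm X / s).
Local Notation rate := (fun l : R => (s + l * sqnorm X) / 2).
Local Notation I01 := (`]0%R, 1%R[%classic : set (measurableTypeR R)).
Local Notation I0y := (`]0%R, +oo[%classic : set (measurableTypeR R)).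

Let kap_ge0 (l : R) : 0 < l < 1 -> 0 <= kap l.
Proof. exact: mixing_ge0. Qed.

Let mkap : measurable_fun I01 kap.
Proof. exact: measurable_mixing. Qed.

Let C0 : 0 < chi2_factor n s := chi2_factor_gt0 n2 s0.

Lemma sqnorm_ge0 : 0 <= sqnorm X.
Proof. by apply: sumr_ge0 => i _; exact: sqr_ge0. Qed.

Let w0 : 0 <= w.
Proof. by rewrite divr_ge0 ?sqnorm_ge0 ?(ltW s0). Qed.

Let rate_gt0 (l : R) : 0 < l < 1 -> 0 < rate l.
Proof.
move=> /andP[l0 _]; rewrite divr_gt0// ltr_pwDl// mulr_ge0 ?(ltW l0)//.
exact: sqnorm_ge0.
Qed.

Let rateE (l : R) : rate l = s / 2 * (1 + w * l).
Proof. by field; rewrite gt_eqF. Qed.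

Let q1 : 1 <= q.
Proof. by rewrite ler_pdivlMr// mul1r (ler_nat R 2) (leq_trans n2)// leq_addl. Qed.

(** The normalising constant left after integrating the scale out. *)
Definition scale_const (k : R) : R :=
  chi2_factor n s * ((s / 2) `^ (- k) * fine (inv_gamma k (1 : R))).

Let inv_gamma1_fin (k : R) : 1 <= k -> inv_gamma k (1 : R) \is a fin_num.
Proof.
by move=> k1; rewrite ge0_fin_numE ?inv_gamma_lty// ltW// inv_gamma_gt0.
Qed.

Lemma scale_const_gt0 k : 1 <= k -> 0 < scale_const k.
Proof.
move=> k1; rewrite mulr_gt0// mulr_gt0 ?powR_gt0 ?divr_gt0//.
by rewrite -lte_fin fineK ?inv_gamma_gt0// inv_gamma1_fin.
Qed.

Lemma scale_integral k (l : R) : 1 <= k -> 0 < l < 1 ->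
  (\int[mu]_(v in `]0%R, +oo[) (chi2_factor n s * kap l * inv_gamma_fun k (rate l) v)%:E
   = (scale_const k * (kap l * (1 + w * l) `^ (- k)))%:E)%E.
Proof.
move=> k1 l01; have [l0 l1] := andP l01.
under eq_integral do rewrite EFinM.
rewrite ge0_integralZl//; last 3 first.
- by apply/measurable_EFinP; apply: measurable_inv_gamma_fun => //; exact: measurable_id.
- by move=> v _; rewrite lee_fin inv_gamma_fun_ge0.
- by rewrite lee_fin mulr_ge0 ?kap_ge0 ?(ltW C0).
rewrite -/(inv_gamma k (rate l)) inv_gamma_scale ?rate_gt0// rateE.
have wl0 : 0 <= 1 + w * l by rewrite addr_ge0// mulr_ge0// ltW.
rewrite powRM ?divr_ge0 ?(ltW s0)// -(fineK (inv_gamma1_fin k1)) -!EFinM.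
by congr EFin; rewrite /scale_const; ring.
Qed.

Lemma measurable_scale_weight k :
  measurable_fun (I01 `*` I0y)
  (fun z => chi2_factor n s * kap z.1 * inv_gamma_fun k (rate z.1) z.2).
Proof.
apply: measurable_funM.
  apply: measurable_funM => //.
  apply: (measurable_comp _ _ mkap) => //; last exact: measurable_funTS.
  by move=> _ [[l v] [/= l01 _] <-].
apply: measurable_funTS; apply: measurable_inv_gamma_fun; last exact: measurable_snd.
apply: measurable_funM => //; apply: measurable_funD => //.
by apply: measurable_funM => //; exact: measurable_fst.
Qed.

Lemma scale_weight_ge0 k (l v : R) : 0 < l < 1 ->
  0 <= chi2_factor n s * kap l * inv_gamma_fun k (rate l) v.
Proof. by move=> l01; rewrite mulr_ge0 ?inv_gamma_fun_ge0// mulr_ge0 ?(ltW C0) ?kap_ge0. Qed.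

Let mI01 : measurable I01. Proof. exact: measurable_itv. Qed.
Let mI0y : measurable I0y. Proof. exact: measurable_itv. Qed.

Lemma double_integral_moment j k : 1 <= k ->
  (\int[mu]_(l in `]0%R, 1%R[) \int[mu]_(v in `]0%R, +oo[)
     (l ^+ j * (chi2_factor n s * kap l * inv_gamma_fun k (rate l) v))%:E
   = (scale_const k * moment kap j k w)%:E)%E.
Proof.
move=> k1; have k0 : 0 <= k by rewrite (le_trans _ k1).
rewrite EFinM -momentE// -ge0_integralZl//; last 3 first.
- by apply/measurable_EFinP; exact: measurable_moment_fun.
- by move=> l; rewrite /= in_itv/= => l01; rewrite lee_fin moment_fun_ge0.
- by rewrite lee_fin ltW// scale_const_gt0.
apply: eq_integral => l; rewrite inE/= in_itv/= => l01; have [l0 l1] := andP l01.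
under eq_integral do rewrite EFinM.
rewrite ge0_integralZl//; last 3 first.
- apply/measurable_EFinP; apply: measurable_funM => //.
  by apply: measurable_inv_gamma_fun => //; exact: measurable_id.
- by move=> v _; rewrite lee_fin scale_weight_ge0.
- by rewrite lee_fin exprn_ge0// ltW.
by rewrite scale_integral// -!EFinM /moment_fun; congr EFin; ring.
Qed.

Lemma unnormalized_posterior_scale (hv : R -> R) k : 1 <= k ->
  measurable_fun setT hv -> (forall v : R, 0 < v -> 0 <= hv v) ->
  (forall c v : R, 0 < v -> hv v * inv_gamma_fun q c v = inv_gamma_fun k c v) ->
  unnormalized_posterior n a L (fun _ v => hv v) X s
  = (scale_const k * moment kap 0 k w)%:E.
Proof.
move=> k1 mhv hv0 hvE.
transitivity (unnormalized_posterior n a L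
    (fun theta v => hv v * \prod_(i < p) cst 1 (tnth theta i)) X s).
  congr unnormalized_posterior; apply/funext => theta; apply/funext => v.
  by rewrite big1 ?mulr1.
rewrite (@unnormalized_posterior_prodE R p n a L mL L0 hv (fun _ => cst 1))//.
rewrite -double_integral_moment//; apply: eq_integral => l.
rewrite inE/= in_itv/= => l01; apply: eq_integral => v.
rewrite inE/= in_itv/= andbT => v0; have [l0 l1] := andP l01.
rewrite big1 ?mule1; first by rewrite expr0 mul1r hvE.
move=> i _; under eq_integral do rewrite mul1r.
by rewrite integral_gauss_pdf// mulr_gt0// subr_gt0.
Qed.

Lemma unnormalized_posterior_cst :
  unnormalized_posterior n a L (fun _ _ => 1) X s
  = (scale_const q * moment kap 0 q w)%:E.
Proof.
by apply: unnormalized_posterior_scale => // c v _; rewrite mul1r.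
Qed.

Let inv_mul_inv_gamma (k c v : R) : 0 < v ->
  v^-1 * inv_gamma_fun k c v = inv_gamma_fun (k + 1) c v.
Proof.
move=> v0; rewrite /inv_gamma_fun mulrA -{1}(powR_inv1 (ltW v0)) -powRD; last first.
  by rewrite (gt_eqF v0) implybT.
by congr (_ `^ _ * _); ring.
Qed.

Lemma unnormalized_posterior_precision :
  unnormalized_posterior n a L (fun _ v => v^-1) X s
  = (scale_const (q + 1) * moment kap 0 (q + 1) w)%:E.
Proof.
apply: unnormalized_posterior_scale => //.
- by rewrite ler_wpDr.
- exact: measurable_invr.
- by move=> v v0; rewrite invr_ge0 ltW.
- by move=> c v v0; rewrite inv_mul_inv_gamma.
Qed.

Local Notation D := (I01 `*` I0y).
Local Notation mu2 := (mu \x mu)%E.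
Local Notation k := (q + 1).
Local Notation weight := (fun z : measurableTypeR R * measurableTypeR R =>
  chi2_factor n s * kap z.1 * inv_gamma_fun k (rate z.1) z.2).

Let k1 : 1 <= k. Proof. by rewrite ler_wpDr. Qed.

Let mD : measurable D. Proof. exact: measurableX. Qed.

Let weight_ge0 z : D z -> 0 <= weight z.
Proof. by case=> /=; rewrite in_itv/= => l01 _; exact: scale_weight_ge0. Qed.

Let mweight : measurable_fun D weight. Proof. exact: measurable_scale_weight. Qed.

Variable j : 'I_p.
Local Notation x := (tnth X j).

Let cond_exp (rho : R -> R) (z : measurableTypeR R * measurableTypeR R) : \bar R :=
  (\int[mu]_t (rho t * gauss_pdf (x * (1 - z.1)) (z.2 * (1 - z.1)) t)%:E)%E.

Section coordinate_part.
Variable rho : R -> R.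
Hypothesis mrho : measurable_fun setT rho.
Hypothesis rho_le : forall t, 0 <= rho t <= `|t|.

Let rho0 t : 0 <= rho t. Proof. by case/andP: (rho_le t). Qed.

Lemma cond_exp_ge0 z : (0 <= cond_exp rho z)%E.
Proof. by apply: integral_ge0 => t _; rewrite lee_fin mulr_ge0 ?gauss_pdf_ge0. Qed.

Lemma measurable_cond_exp : measurable_fun setT (cond_exp rho).
Proof.
apply: (measurable_fun_fubini_tonelli_F (m2 := mu)
  (fun y : (measurableTypeR R * measurableTypeR R) * measurableTypeR R =>
  (rho y.2 * gauss_pdf (x * (1 - y.1.1)) (y.1.2 * (1 - y.1.1)) y.2)%:E)).
  apply/measurable_EFinP.
  have m1 : measurable_fun setT
     (fun y : (measurableTypeR R * measurableTypeR R) * measurableTypeR R => 1 - y.1.1).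
    apply: measurable_funB; first exact: measurable_cst.
    exact: (measurableT_comp measurable_fst measurable_fst).
  have m2 : measurable_fun setT
     (fun y : (measurableTypeR R * measurableTypeR R) * measurableTypeR R => y.1.2).
    exact: (measurableT_comp measurable_snd measurable_fst).
  have m3 : measurable_fun setT
     (fun y : (measurableTypeR R * measurableTypeR R) * measurableTypeR R => y.2).
    exact: measurable_snd.
  apply: measurable_funM; first exact: (measurableT_comp mrho m3).
  apply: measurable_fun_gauss; [|exact: measurable_funM|exact: m3].
  by apply: measurable_funM; [exact: measurable_cst|exact: m1].
by move=> y; rewrite lee_fin mulr_ge0 ?gauss_pdf_ge0.
Qed.

Lemma measurable_weight_cond_exp :
  measurable_fun D (fun z => (weight z)%:E * cond_exp rho z)%E.
Proof.
apply: emeasurable_funM; first exact/measurable_EFinP.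
by apply: measurable_funTS; exact: measurable_cond_exp.
Qed.

Lemma unnormalized_posterior_coord :
  unnormalized_posterior n a L (fun theta v => v^-1 * rho (tnth theta j)) X s
  = (\int[mu2]_(z in D) ((weight z)%:E * cond_exp rho z))%E.
Proof.
pose r := fun i : 'I_p => if i == j then rho else cst 1.
have prod1 (f : 'I_p -> R) : (forall i, i != j -> f i = 1) -> \prod_(i < p) f i = f j.
  by move=> f1; rewrite (bigD1 j)//= big1 ?mulr1.
transitivity (unnormalized_posterior n a L
    (fun theta v => v^-1 * \prod_(i < p) r i (tnth theta i)) X s).
  congr unnormalized_posterior; apply/funext => theta; apply/funext => v.
  rewrite (prod1 (fun i => r i (tnth theta i))) ?/r ?eqxx//.
  by move=> i /negbTE ->.
rewrite (@unnormalized_posterior_prodE R p n a L mL L0 (fun v => v^-1) r)//; last 4 first.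
- exact: measurable_invr.
- by move=> v v0; rewrite invr_ge0 ltW.
- by move=> i; rewrite /r; case: ifPn => // _; exact: measurable_cst.
- by move=> i t; rewrite /r; case: ifPn.
rewrite (tonelli_on1 mu mu mI01 mI0y measurable_weight_cond_exp); last first.
  move=> l v /= l01 v0; rewrite mule_ge0 ?cond_exp_ge0// lee_fin.
  by rewrite scale_weight_ge0// -[_ && _]in_itv.
apply: eq_integral => l; rewrite inE/= in_itv/= => l01; have [l0 l1] := andP l01.
apply: eq_integral => v; rewrite inE/= in_itv/= andbT => v0.
rewrite inv_mul_inv_gamma//; congr (_ * _)%E.
rewrite (bigD1 j)//= big1 ?mule1.
  by rewrite /cond_exp/=; apply: eq_integral => t _; rewrite /r eqxx.
move=> i ij; under eq_integral do rewrite /r (negbTE ij) mul1r.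
by rewrite integral_gauss_pdf// mulr_gt0// subr_gt0.
Qed.

(** Given [l] and [v], the conditional mean of the part is at most a constant plus
    [4 * v]; the factor [v] lowers the exponent of the inverse gamma kernel by one, and
    the result is still integrable. *)
Lemma unnormalized_posterior_coord_lty :
  (\int[mu2]_(z in D) ((weight z)%:E * cond_exp rho z) < +oo)%E.
Proof.
pose A := `|x| + 4.
have A0 : 0 <= A by rewrite addr_ge0.
pose W k' (z : measurableTypeR R * measurableTypeR R) :=
  chi2_factor n s * kap z.1 * inv_gamma_fun k' (rate z.1) z.2.
have mW k' : measurable_fun D (W k') := measurable_scale_weight k'.
have W0 k' z : D z -> 0 <= W k' z.
  by case=> /=; rewrite in_itv/= => l01 _; exact: scale_weight_ge0.
have iW k' : 1 <= k' -> (\int[mu2]_(z in D) (W k' z)%:E < +oo)%E.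
  move=> k'1; rewrite (tonelli_on1 mu mu mI01 mI0y (f := fun z => (W k' z)%:E)).
  - have := double_integral_moment 0 k'1.
    under eq_integral do under eq_integral do rewrite expr0 mul1r.
    by move=> ->; rewrite ltry.
  - exact/measurable_EFinP.
  - by move=> l v l01 v0; rewrite lee_fin W0.
apply: (@le_lt_trans _ _ (\int[mu2]_(z in D) (A%:E * (W k z)%:E + 4%:E * (W q z)%:E))%E).
  apply: ge0_le_integral => //.
  - by move=> z Dz; rewrite mule_ge0 ?cond_exp_ge0// lee_fin weight_ge0.
  - exact: measurable_weight_cond_exp.
  - apply: emeasurable_funD; apply: emeasurable_funM => //; exact/measurable_EFinP.
  - move=> [l v] [/=]; rewrite !in_itv/= andbT => l01 v0; have [l0 l1] := andP l01.
    have u0 : 0 < v * (1 - l) by rewrite mulr_gt0// subr_gt0.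
    have vl : v * (1 - l) <= v by rewrite ler_piMr ?(ltW v0)// gerBl ltW.
    have sq : Num.sqrt (v * (1 - l)) <= 1 + v.
      have := sqr_ge0 (Num.sqrt (v * (1 - l)) - 1).
      have := sqrtr_ge0 (v * (1 - l)).
      have : Num.sqrt (v * (1 - l)) ^+ 2 = v * (1 - l) by rewrite sqr_sqrtr ?(ltW u0).
      move: (Num.sqrt _) => y; nra.
    have xl : `|x * (1 - l)| <= `|x|.
      by rewrite normrM ler_piMr// ger0_norm ?subr_ge0 ?(ltW l1)// gerBl ltW.
    have ce : (cond_exp rho (l, v) <= (A + 4 * v)%:E)%E.
      apply: (le_trans (gauss_part_le _ u0 mrho rho_le)); rewrite lee_fin /A; lra.
    apply: (@le_trans _ _ ((weight (l, v))%:E * (A + 4 * v)%:E)%E).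
      by rewrite lee_wpmul2l// lee_fin scale_weight_ge0.
    rewrite -!EFinM -EFinD lee_fin /W/= -(inv_mul_inv_gamma q _ v0).
    by rewrite le_eqVlt; apply/orP; left; apply/eqP; field; rewrite gt_eqF.
rewrite ge0_integralD//; last 4 first.
- by move=> z Dz; rewrite mule_ge0// lee_fin W0.
- by apply: emeasurable_funM => //; exact/measurable_EFinP.
- by move=> z Dz; rewrite mule_ge0// lee_fin W0.
- by apply: emeasurable_funM => //; exact/measurable_EFinP.
have eZ (c k' : R) : 0 <= c -> (\int[mu2]_(z in D) (c%:E * (W k' z)%:E)
    = c%:E * \int[mu2]_(z in D) (W k' z)%:E)%E.
  move=> c0; apply: ge0_integralZl => //; first exact/measurable_EFinP.
  by move=> z Dz; rewrite lee_fin W0.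
rewrite !eZ//.
by rewrite lte_add_pinfty// lte_mul_pinfty// iW.
Qed.

End coordinate_part.

Let m0 (t : R) : 0 <= Num.max t 0. Proof. by rewrite le_max lexx orbT. Qed.

Let part_le (t : R) : 0 <= Num.max t 0 <= `|t|.
Proof. by rewrite m0 /= ge_max normr_ge0 ler_norm. Qed.

Let partN_le (t : R) : 0 <= Num.max (- t) 0 <= `|t|.
Proof. by rewrite m0 /= ge_max normr_ge0 -normrN ler_norm. Qed.

Let mpart : measurable_fun setT (fun t : R => Num.max t 0).
Proof. exact: measurable_maxr0. Qed.

Let mpartN : measurable_fun setT (fun t : R => Num.max (- t) 0).
Proof. by apply: measurable_maxr0; exact: measurable_funN. Qed.

Let Z := scale_const k * (moment kap 0 k w - moment kap 1 k w).

(** The integral of the conditional mean of a coordinate, divided by [x]. *)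
Let integral_one_minus : (\int[mu2]_(z in D) ((1 - z.1) * weight z)%:E = Z%:E)%E.
Proof.
have mfst : measurable_fun setT (fun z : measurableTypeR R * measurableTypeR R => z.1).
  exact: measurable_fst.
have m1 : measurable_fun D (fun z => ((1 - z.1) * weight z)%:E).
  apply/measurable_EFinP; apply: measurable_funM => //; apply: measurable_funTS.
  by apply: measurable_funB; [exact: measurable_cst|exact: mfst].
have m2 : measurable_fun D (fun z => (z.1 * weight z)%:E).
  by apply/measurable_EFinP; apply: measurable_funM => //; exact: measurable_funTS.
have p1 z : D z -> (0 <= ((1 - z.1) * weight z)%:E)%E.
  move=> Dz; rewrite lee_fin mulr_ge0 ?weight_ge0//.
  by case: Dz => /=; rewrite in_itv/= => /andP[_ /ltW] l1 _; rewrite subr_ge0.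
have p2 z : D z -> (0 <= (z.1 * weight z)%:E)%E.
  move=> Dz; rewrite lee_fin mulr_ge0 ?weight_ge0//.
  by case: Dz => /=; rewrite in_itv/= => /andP[/ltW].
have e0 : (\int[mu2]_(z in D) (weight z)%:E = (scale_const k * moment kap 0 k w)%:E)%E.
  rewrite -double_integral_moment//.
  rewrite (tonelli_on1 mu mu mI01 mI0y (f := fun z => (weight z)%:E)).
  - by under [RHS]eq_integral do under eq_integral do rewrite expr0 mul1r.
  - exact/measurable_EFinP.
  - by move=> l v l01 v0; rewrite lee_fin weight_ge0.
have e1 : (\int[mu2]_(z in D) (z.1 * weight z)%:E = (scale_const k * moment kap 1 k w)%:E)%E.
  rewrite -double_integral_moment//.
  rewrite (tonelli_on1 mu mu mI01 mI0y (f := fun z => (z.1 * weight z)%:E)) => //.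
  by move=> l v l01 v0; rewrite p2.
have : (\int[mu2]_(z in D) ((1 - z.1) * weight z)%:E + \int[mu2]_(z in D) (z.1 * weight z)%:E
  = \int[mu2]_(z in D) (weight z)%:E)%E.
  rewrite -ge0_integralD//; apply: eq_integral => z _.
  by rewrite -EFinD; congr EFin; ring.
rewrite e0 e1 => /(congr1 (fun y => y - (scale_const k * moment kap 1 k w)%:E)%E).
by rewrite addeK// => ->; rewrite -EFinB /Z mulrBr.
Qed.

Let integral_part (c : R) : 0 <= c ->
  (\int[mu2]_(z in D) ((weight z)%:E * (c * (1 - z.1))%:E) = (c * Z)%:E)%E.
Proof.
move=> c0; rewrite EFinM -integral_one_minus -ge0_integralZl//; last 2 first.
- apply/measurable_EFinP; apply: measurable_funM => //; apply: measurable_funTS.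
  by apply: measurable_funB; [exact: measurable_cst|exact: measurable_fst].
- move=> z Dz; rewrite lee_fin mulr_ge0 ?weight_ge0//.
  by case: Dz => /=; rewrite in_itv/= => /andP[_ /ltW] l1 _; rewrite subr_ge0.
by apply: eq_integral => z _; rewrite -!EFinM; congr EFin; ring.
Qed.

Let maxe_part_mul (t v M : R) (P : \bar R) : 0 < v -> 0 <= M -> (0 <= P)%E ->
  maxe ((t / v * M)%:E * P)%E 0%E = ((v^-1 * Num.max t 0 * M)%:E * P)%E.
Proof.
move=> v0 M0 P0; have [t0|t0] := leP 0 t.
  rewrite (mulrC v^-1); apply/max_idPl.
  by rewrite mule_ge0// lee_fin mulr_ge0// divr_ge0// ltW.
rewrite mulr0 mul0r mul0e; apply/max_idPr.
rewrite -oppe_ge0 -mulNe -EFinN mule_ge0// lee_fin -!mulNr mulr_ge0//.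
by rewrite divr_ge0 ?oppr_ge0 ?(ltW v0) ?(ltW t0).
Qed.

(** Given [l] and [v], the expectations of the two parts of the coordinate differ by
    its conditional mean [x * (1 - l)]. *)
Lemma posterior_coord_parts :
  exists up um : R, [/\ up - um = x * Z,
  unnormalized_posterior n a L (fun theta v => v^-1 * Num.max (tnth theta j) 0) X s = up%:E &
  unnormalized_posterior n a L (fun theta v => v^-1 * Num.max (- tnth theta j) 0) X s = um%:E].
Proof.
rewrite (unnormalized_posterior_coord mpart part_le).
rewrite (unnormalized_posterior_coord mpartN partN_le).
set Hp := (\int[mu2]_(z in D) _)%E; set Hm := (\int[mu2]_(z in D) _)%E.
have Hp0 : (0 <= Hp)%E.
  by apply: integral_ge0 => z Dz; rewrite mule_ge0 ?lee_fin ?weight_ge0// cond_exp_ge0.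
have Hm0 : (0 <= Hm)%E.
  by apply: integral_ge0 => z Dz; rewrite mule_ge0 ?lee_fin ?weight_ge0// cond_exp_ge0.
have Hpf : Hp \is a fin_num.
  by rewrite ge0_fin_numE//; apply: unnormalized_posterior_coord_lty; [exact: mpart|exact: part_le].
have Hmf : Hm \is a fin_num.
  by rewrite ge0_fin_numE//; exact: (unnormalized_posterior_coord_lty mpartN partN_le).
have mpt (c : R) : measurable_fun D (fun z => ((weight z)%:E * (c * (1 - z.1))%:E)%E).
  apply: emeasurable_funM; first exact/measurable_EFinP.
  apply/measurable_EFinP; apply: measurable_funM => //; apply: measurable_funTS.
  by apply: measurable_funB; [exact: measurable_cst|exact: measurable_fst].
have ppt (c : R) : 0 <= c -> forall z, D z -> (0 <= (weight z)%:E * (c * (1 - z.1))%:E)%E.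
  move=> c0 z Dz; rewrite mule_ge0// lee_fin ?weight_ge0// mulr_ge0//.
  by case: Dz => /=; rewrite in_itv/= => /andP[_ /ltW] l1 _; rewrite subr_ge0.
have pce rho : (forall t : R, 0 <= rho t <= `|t|) -> forall z, D z ->
    (0 <= (weight z)%:E * cond_exp rho z)%E.
  by move=> h z Dz; rewrite mule_ge0 ?lee_fin ?weight_ge0// cond_exp_ge0.
have e : (Hp + (Num.max (- x) 0 * Z)%:E = Hm + (Num.max x 0 * Z)%:E)%E.
  rewrite -(integral_part (m0 (- x))) -(integral_part (m0 x)) /Hp /Hm.
  rewrite -[LHS]ge0_integralD; [|exact: mD|exact: (pce _ part_le)|
    exact: (measurable_weight_cond_exp mpart)|exact: (ppt _ (m0 _))|exact: mpt].
  rewrite -[RHS]ge0_integralD; [|exact: mD|exact: (pce _ partN_le)|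
    exact: (measurable_weight_cond_exp mpartN)|exact: (ppt _ (m0 _))|exact: mpt].
  apply: eq_integral => -[l v]; rewrite inE/= => -[/=]; rewrite !in_itv/= andbT.
  move=> l01 v0; have [l0 l1] := andP l01.
  have l1' : 0 < 1 - l by rewrite subr_gt0.
  have u0 : 0 < v * (1 - l) by rewrite mulr_gt0.
  rewrite -!ge0_muleDr ?cond_exp_ge0 ?lee_fin ?mulr_ge0 ?(ltW l1')//.
  congr (_ * _)%E.
  have := gauss_mean (x * (1 - l)) u0.
  by rewrite -mulNr -{2 4}(mul0r (1 - l)) -!maxr_pMl ?(ltW l1').
clearbody Hp Hm; move: e; rewrite -(fineK Hpf) -(fineK Hmf) -!EFinD => -[] /= e.
by exists (fine Hp), (fine Hm); split => //; exact: sub_of_parts e.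
Qed.

(** The posterior integral of a signed function is defined through its positive and
    negative parts, which were computed separately. *)
Lemma unnormalized_posterior_mean :
  unnormalized_posterior n a L (fun theta v => tnth theta j / v) X s = (x * Z)%:E.
Proof.
have [up [um [e ep em]]] := posterior_coord_parts.
rewrite -e EFinB -ep -em /unnormalized_posterior integralE.
have P0 theta v : 0 < v -> (0 <= prior a L (theta : p.-tuple R) v)%E.
  move=> v0; rewrite mule_ge0 ?lee_fin ?divr_ge0 ?invr_ge0 ?exprn_ge0 ?sqrtr_ge0 ?(ltW v0)//.
  apply: integral_ge0 => l; rewrite /= in_itv/= => l01.
  by rewrite lee_fin !mulr_ge0 ?powR_ge0 ?expR_ge0 ?L0.
congr (_ - _)%E; apply: eq_integral => -[theta v] /[!inE];
  rewrite /half_space/= => v0.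
  rewrite funeposE/=; exact: (maxe_part_mul _ v0 (model_pdf_ge0 n theta X s v0) (P0 theta v v0)).
rewrite -(maxe_part_mul _ v0 (model_pdf_ge0 n theta X s v0) (P0 theta v v0)).
by rewrite funenegE/= -mulNe -EFinN -!mulNr.
Qed.

End posterior_mean.

Theorem generalized_Bayes_shrink (R : realType) (p n : nat) (a : R) (L : R -> R)
    (X : p.-tuple R) (s : R) :
  (2 <= n)%N ->
  measurable_fun (`]0%R, 1%R[ : set (measurableTypeR R)) (fun l => L l^-1) ->
  (forall l : R, 0 < l < 1 -> 0 <= L l^-1) ->
  (@lebesgue_measure R).-integrable `]0%R, 1%R[ (EFin \o mixing p a L) ->
  (0 < \int[@lebesgue_measure R]_(l in `]0%R, 1%R[) (mixing p a L l)%:E)%E ->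
  0 < s ->
  generalized_Bayes n a L X s =
  delta_phi (shrink (mixing p a L) ((p + n)%:R / 2 + 1)) X s.
Proof.
move=> n2 mL L0 kap_int kap_gt0 s0.
apply: eq_from_tnth => j; rewrite !tnth_mktuple /posterior_expectation.
rewrite (unnormalized_posterior_mean n2 mL L0 kap_int)//.
rewrite (unnormalized_posterior_cst n2 mL L0 kap_int)//.
rewrite (unnormalized_posterior_precision n2 mL L0 kap_int)//.
rewrite /= /Wstat /shrink.
have q1 : 1 <= (p + n)%:R / 2 :> R.
  by rewrite ler_pdivlMr// mul1r (ler_nat R 2) (leq_trans n2)// leq_addl.
have k1 : 1 <= (p + n)%:R / 2 + 1 :> R by rewrite ler_wpDr.
have kge0 : forall l : R, 0 < l < 1 -> 0 <= mixing p a L l by move=> l; exact: mixing_ge0.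
have w0 : 0 <= sqnorm X / s by rewrite divr_ge0 ?sqnorm_ge0 ?(ltW s0).
set k := _ + 1 in k1 *; set q := (p + n)%:R / 2 in q1 *; set w := _ / s in w0 *.
have U1 : scale_const n s q * moment (mixing p a L) 0 q w != 0.
  by rewrite mulf_neq0 ?gt_eqF ?scale_const_gt0 ?moment_gt0// (le_trans _ q1).
have Mk : moment (mixing p a L) 0 k w != 0.
  by rewrite gt_eqF ?moment_gt0// (le_trans _ k1).
have Ck : scale_const n s k != 0 by rewrite gt_eqF ?scale_const_gt0.
have [wE|wn0] := eqVneq w 0.
  have -> : tnth X j = 0.
    have /eqP : sqnorm X = 0.
      by move: wE => /eqP; rewrite /w mulf_eq0 invr_eq0 (gt_eqF s0) orbF => /eqP.
    rewrite psumr_eq0; last by move=> i _; exact: sqr_ge0.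
    by move=> /allP /(_ j (mem_index_enum _)) /=; rewrite sqrf_eq0 => /eqP.
  by rewrite !mul0r mulr0.
move: (scale_const n s q * _) U1 (scale_const n s k) Ck (moment _ 0 k w) Mk (moment _ 1 k w).
move=> u u0 c c0 m mm0 m1; field.
by rewrite wn0 mm0 u0 c0.
Qed.

(** * How fast the shrinkage function approaches its limit *)

Section growth.
Context {R : realType}.
Implicit Types (u w C e : R).

Lemma near_ln (P : R -> Prop) :
  (\forall u \near +oo, P u) -> \forall w \near +oo, P (ln w).
Proof.
move=> [M [Mreal MP]]; exists (expR M); split; first exact: num_real.
move=> w wM; apply: MP; rewrite -(expRK M) ltr_ln// posrE ?expR_gt0//.
exact: lt_trans (expR_gt0 _) wM.
Qed.

Lemma near_mul_expRN e C : 0 < e -> 0 < C ->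
  \forall u \near +oo, u * expR (- (e * u)) <= C.
Proof.
move=> e0 C0; near=> u.
have u0 : 0 < u by near: u; exact: nbhs_pinfty_gt.
have uC : 2 / (e ^+ 2 * C) <= u by near: u; apply: nbhs_pinfty_ge; exact: num_real.
have := @expR_ge1Dxn R (e * u) 1; rewrite mulr_ge0 ?(ltW e0) ?(ltW u0)// => /(_ isT).
rewrite expRN ler_pdivrMr ?expR_gt0// => h.
apply: (@le_trans _ _ (C * ((e * u) ^+ 2 / 2))); last first.
  by rewrite ler_pM2l// (le_trans _ h)// lerDr.
rewrite ler_pdivrMr ?mulr_gt0 ?exprn_gt0// in uC.
rewrite (_ : C * _ = u * (u * (e ^+ 2 * C)) / 2); last by rewrite exprMn; ring.
by rewrite ler_pdivlMr// ler_pM2l.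
Unshelve. all: end_near. Qed.

Lemma powR_expR w r : 0 < w -> w `^ r = expR (r * ln w).
Proof. by move=> w0; rewrite mulrC expRM lnK. Qed.

Lemma is_derive_powR r (x : R) : 0 < x ->
  is_derive x 1 (fun y => y `^ r) (r * x `^ (r - 1)).
Proof.
move=> x0; apply: DeriveDef; first by apply: derivable_powR; rewrite in_itv/= andbT.
by rewrite -derive1E powR_derive1// in_itv/= andbT.
Qed.

Lemma is_derive_powR_affine r w (x : R) : 0 < 1 + w * x ->
  is_derive x 1 (fun y => (1 + w * y) `^ r) (w * (r * (1 + w * x) `^ (r - 1))).
Proof.
move=> wx0.
have d1 : is_derive x 1 (fun y : R => 1 + w * y) w.
  have d := is_deriveD (is_derive_cst (1 : R) x 1) (is_deriveZ w (is_derive_id x (1 : R))).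
  by apply: (is_derive_eq d); rewrite add0r /GRing.scale/= mulr1.
have := @is_derive1_comp R (fun y => y `^ r) (fun y => 1 + w * y) x _ _
  (is_derive_powR r wx0) d1.
by rewrite /comp => d; apply: (is_derive_eq d); rewrite mulrC.
Qed.

(** The logarithmic derivative [b / t - e] is nonnegative up to [b / e]. *)
Lemma powR_expRN_le b e (t t' : R) : 0 <= b -> 0 < t -> t <= t' -> e * t' <= b ->
  t `^ b * expR (- (e * t)) <= t' `^ b * expR (- (e * t')).
Proof.
move=> b0 t0 tt' et'; have t'0 : 0 < t' := lt_le_trans t0 tt'.
rewrite !powR_expR// -!expRD ler_expR.
have l : ln (t / t') <= t / t' - 1.
  have := @le_ln1Dx R (t / t' - 1); rewrite [1 + _]addrC subrK; apply.
  by rewrite ltrBrDr addNr divr_gt0.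
rewrite ln_div ?posrE// in l.
have h : (t' - t) / t' <= ln t' - ln t.
  rewrite mulrBl divff ?gt_eqF//; lra.
have : b * ((t' - t) / t') <= b * (ln t' - ln t) by rewrite ler_wpM2l.
have : e * t' * ((t' - t) / t') <= b * ((t' - t) / t').
  by rewrite ler_wpM2r// divr_ge0 ?subr_ge0 ?(ltW t'0).
rewrite (_ : e * t' * ((t' - t) / t') = e * (t' - t)); last by field; rewrite gt_eqF.
by move=> h1 h2; have := le_trans h1 h2; rewrite !mulrBr; lra.
Qed.

End growth.

Section tail.
Context {R : realType}.
Local Notation mu := (@lebesgue_measure R).
Variable kap : R -> R.
Hypothesis kap_ge0 : forall l : R, 0 < l < 1 -> 0 <= kap l.
Hypothesis kap_int : mu.-integrable `]0%R, 1%R[ (EFin \o kap).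
Variables (alpha beta b l0 K : R).
Hypotheses (alpha0 : 0 < alpha) (beta0 : 0 < beta) (b1 : 1 < b).
Hypothesis l01 : 0 < l0 < 1.
Hypothesis kap_mono : forall l l' : R, 0 < l -> l <= l' -> l' <= l0 ->
  kap l' * l' `^ (1 - alpha) / (- ln l') `^ b <= kap l * l `^ (1 - alpha) / (- ln l) `^ b.
Hypothesis kap_l0 : 0 < kap l0.
Hypothesis kap_le : forall l : R, l0 <= l < 1 -> kap l <= K.

Local Notation k := (alpha + beta + 1).

Let l0gt0 : 0 < l0. Proof. by case/andP: l01. Qed.
Let l0lt1 : l0 < 1. Proof. by case/andP: l01. Qed.

(** With [A = alpha - eta] and [B = beta + eta], nonnegativity of the integral of [T]
    is the claimed deficit. *)
Let T (A B w l : R) := kap l * (1 + w * l) `^ (- k) * (A - B * (w * l)).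

(** The interval is cut at [l1 = expR (- b / b3 * ln w)] and at [l0].  Below [l1] the
    affine factor is nonnegative.  For [l >= l1] the number [t = - ln l] stays below the
    mode [b / eta'] of [t ^ b * exp (- eta' * t)], so that multiplying by [l `^ eta']
    makes the weight monotone.  Beyond [l0] the integrand is only bounded.  The affine factor
    changes sign at [ls]. *)
Section fixed_w.
Variables (b2 b3 w : R).
Hypotheses (b21 : 1 < b2) (b23 : b2 < b3).
Hypothesis w1 : 1 < w.
Local Notation u := (ln w).
Local Notation eta := (b2 / u).
Local Notation eta' := (b3 / u).
Local Notation A := (alpha - eta).
Local Notation B := (beta + eta).
Local Notation l1 := (expR (- (b / b3 * u))).
Local Notation ls := (A / (B * w)).
Hypothesis eta'1 : eta' <= 1.
Hypothesis eta'alpha : eta' <= alpha / 2.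
Hypothesis l1ls : l1 <= ls.
Hypothesis lsl0 : ls <= l0.
Hypothesis l1w : l1 <= (2 * w)^-1.
Hypothesis wl0 : w^-1 <= l0.

Let w0 : 0 < w. Proof. exact: lt_trans w1. Qed.
Let u0 : 0 < u. Proof. exact: ln_gt0. Qed.
Let b30 : 0 < b3. Proof. by rewrite (lt_trans _ b23)// (lt_trans _ b21). Qed.
Let eta0 : 0 < eta. Proof. by rewrite divr_gt0// (lt_trans _ b21). Qed.
Let eta'0 : 0 < eta'. Proof. by rewrite divr_gt0. Qed.
Let etalt : eta < eta'. Proof. by rewrite ltr_pM2r ?invr_gt0. Qed.
Let A0 : 0 < A. Proof. rewrite subr_gt0; have := etalt; have := eta'alpha; move: alpha0; lra. Qed.
Let B0 : 0 < B. Proof. by rewrite addr_gt0. Qed.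
Let l10 : 0 < l1. Proof. exact: expR_gt0. Qed.
Let l1l0 : l1 <= l0. Proof. exact: le_trans l1ls lsl0. Qed.

Let affine_ge0 l : l <= ls -> 0 <= A - B * (w * l).
Proof.
by rewrite ler_pdivlMr ?mulr_gt0// => h; rewrite subr_ge0 mulrA [B * w * l]mulrC.
Qed.

Let affine_le0 l : ls <= l -> A - B * (w * l) <= 0.
Proof.
by rewrite ler_pdivrMr ?mulr_gt0// => h; rewrite subr_le0 mulrA [B * w * l]mulrC.
Qed.

(** The density divided by [l `^ (alpha - 1 - eta')]. *)
Let M l := kap l * l `^ (1 - alpha) * l `^ eta'.

Let M_mono l l' : l1 <= l -> l <= l' -> l' <= l0 -> M l' <= M l.
Proof.
move=> l1l ll' l'l0; have lp : 0 < l := lt_le_trans l10 l1l.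
have l'p : 0 < l' := lt_le_trans lp ll'.
have l'1 : l' < 1 := le_lt_trans l'l0 l0lt1.
have lt1 : l < 1 := le_lt_trans ll' l'1.
pose h y := (- ln y) `^ b * y `^ eta'.
have hE y : 0 < y -> y < 1 -> M y = kap y * y `^ (1 - alpha) / (- ln y) `^ b * h y.
  move=> y0 y1; have ny : 0 < - ln y by rewrite oppr_gt0 ln_lt0// y0 y1.
  by rewrite /M /h mulrA divfK// gt_eqF// powR_gt0.
have hle : h l' <= h l.
  rewrite /h (powR_expR _ lp) (powR_expR _ l'p).
  have eN z : eta' * ln z = - (eta' * - ln z) by rewrite mulrN opprK.
  rewrite !eN.
  apply: powR_expRN_le.
  - by rewrite (le_trans _ (ltW b1)).
  - by rewrite oppr_gt0 ln_lt0// l'p.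
  - by rewrite lerN2 ler_ln ?posrE.
  - have lnl : - (b / b3 * u) <= ln l by rewrite -[leLHS]expRK ler_ln ?posrE ?expR_gt0.
    have -> : b = eta' * (b / b3 * u) by field; rewrite !gt_eqF.
    by rewrite ler_wpM2l ?(ltW eta'0)// lerNl.
rewrite !hE//; apply: ler_pM => //.
- rewrite divr_ge0 ?powR_ge0// mulr_ge0 ?powR_ge0// kap_ge0// l'p//.
- by rewrite mulr_ge0 ?powR_ge0.
- exact: kap_mono.
Qed.

(** The antiderivative available for the exponent [alpha - 1 - eta'] when the affine
    factor has the parameter [eta'] instead of [eta]. *)
Let P l := l `^ (alpha - eta') * (1 + w * l) `^ (1 - k).
Let dP l := l `^ (alpha - 1 - eta') * (1 + w * l) `^ (- k)
            * ((alpha - eta') - (beta + eta') * (w * l)).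

Let one_wl l : 0 <= l -> 0 < 1 + w * l.
Proof. by move=> lp; rewrite ltr_pwDl// mulr_ge0// ltW. Qed.

Let is_derive_P (l : R) : 0 < l -> is_derive l 1 P (dP l).
Proof.
move=> lp; have wl := one_wl (ltW lp).
have d1 := is_derive_powR (alpha - eta') lp.
have d2 := is_derive_powR_affine (1 - k) wl.
have := is_deriveM d1 d2; rewrite /GRing.scale/= => d; apply: (is_derive_eq d).
rewrite /dP.
have -> : l `^ (alpha - eta') = l * l `^ (alpha - 1 - eta').
  rewrite -{2}(powRr1 (ltW lp)) -powRD ?(gt_eqF lp) ?implybT//.
  by congr (_ `^ _); ring.
have -> : (1 + w * l) `^ (1 - k) = (1 + w * l) * (1 + w * l) `^ (- k).
  rewrite -{2}(powRr1 (ltW wl)) -powRD ?(gt_eqF wl) ?implybT//.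
have -> : 1 - k - 1 = - k by ring.
have -> : alpha - eta' - 1 = alpha - 1 - eta' by ring.
ring.
Qed.

Let P_ge0 l : 0 <= P l. Proof. by rewrite mulr_ge0 ?powR_ge0. Qed.

(** Since [b / b3 > 1], this is of smaller order than [w `^ (- alpha) / ln w]. *)
Let P_l1 : P l1 <= expR b * w `^ (- (alpha * (b / b3))).
Proof.
rewrite /P; apply: (@le_trans _ _ (l1 `^ (alpha - eta'))).
  rewrite -[leRHS]mulr1 ler_wpM2l ?powR_ge0//.
  rewrite -[leRHS](powRr0 (1 + w * l1)) ler_powR//.
    by rewrite lerDl mulr_ge0// ltW.
  by move: alpha0 beta0; lra.
rewrite (powR_expR _ l10) (powR_expR _ w0) expRK -expRD ler_expR.
by rewrite le_eqVlt; apply/orP; left; apply/eqP; field; rewrite !gt_eqF.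
Qed.

(** A crude lower bound for the gain, located where [w * l] is of order one. *)
Let gain := 2 `^ (1 - k) * (2 * w) `^ (- alpha) * w.

Let gain_le l : (2 * w)^-1 <= l <= w^-1 ->
  gain <= l `^ (alpha - 1 - eta') * (1 + w * l) `^ (1 - k).
Proof.
move=> /andP[wl lw]; have lp : 0 < l by rewrite (lt_le_trans _ wl)// invr_gt0 mulr_gt0.
have l_le1 : l <= 1 by rewrite (le_trans lw)// invf_le1// ltW.
have wl1 := one_wl (ltW lp).
rewrite /gain -mulrA mulrC; apply: ler_pM; rewrite ?mulr_ge0 ?powR_ge0 ?(ltW w0)//.
  apply: (@le_trans _ _ (l `^ (alpha - 1))); last first.
    by rewrite ger_powR ?lp ?l_le1// gerBl ltW.
  rewrite [l `^ (alpha - 1)]powRD ?(gt_eqF lp) ?implybT// .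
  apply: ler_pM; rewrite ?powR_ge0 ?(ltW w0)//.
    rewrite -powR_inv1 ?mulr_ge0 ?(ltW w0)// in wl.
    rewrite -[- alpha]mulN1r powRrM ge0_ler_powR ?nnegrE ?powR_ge0 ?(ltW lp) ?(ltW alpha0)//.
  rewrite powR_inv1 ?(ltW lp)// -[leLHS]invrK lef_pV2 ?posrE ?invr_gt0//.
rewrite (_ : 1 - k = - (alpha + beta)); last by ring.
rewrite !powRN lef_pV2 ?posrE ?powR_gt0//.
rewrite ge0_ler_powR ?nnegrE ?addr_ge0 ?mulr_ge0 ?(ltW alpha0) ?(ltW beta0) ?(ltW w0) ?(ltW lp)//.
rewrite (_ : 2 = 1 + 1) ?lerD2l; last by ring.
by rewrite -(mulfV (lt0r_neq0 w0)) ler_pM2l.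
Qed.

Let Ms := M ls.

Let ls0 : 0 < ls. Proof. by rewrite divr_gt0 ?mulr_gt0. Qed.

Let Ms_ge0 : 0 <= Ms.
Proof.
rewrite /Ms /M !mulr_ge0 ?powR_ge0// kap_ge0// ls0/=.
exact: le_lt_trans lsl0 l0lt1.
Qed.

Let Ms_ge : kap l0 * l0 `^ (1 - alpha) * l0 <= Ms.
Proof.
apply: le_trans (M_mono l1ls lsl0 (lexx l0)).
rewrite /M ler_wpM2l ?mulr_ge0 ?powR_ge0 ?(ltW kap_l0)//.
by rewrite ger1_powR// l0gt0 ltW.
Qed.

(** On the middle range the weight is replaced by a constant multiple of a power,
    by comparing both sides of the sign change of the affine factor. *)
Let T_middle l : l1 <= l -> l <= l0 ->
  Ms * (l `^ (alpha - 1 - eta') * (1 + w * l) `^ (- k) * (A - B * (w * l))) <= T A B w l.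
Proof.
move=> l1l ll0; have lp : 0 < l := lt_le_trans l10 l1l.
have -> : T A B w l = M l * (l `^ (alpha - 1 - eta') * (1 + w * l) `^ (- k) * (A - B * (w * l))).
  have e : l `^ (1 - alpha) * l `^ eta' * l `^ (alpha - 1 - eta') = 1.
    rewrite -!powRD ?(gt_eqF lp) ?implybT//.
    by rewrite (_ : 1 - alpha + eta' + _ = 0) ?powRr0//; ring.
  rewrite /T /M; move: (l `^ (1 - alpha)) (l `^ eta') (l `^ (alpha - 1 - eta')) e => x y z e.
  by rewrite -[kap l in LHS]mulr1 -e; ring.
have [lls|lls] := leP l ls.
  apply: ler_wpM2r; last exact: M_mono.
  by rewrite !mulr_ge0 ?powR_ge0 ?affine_ge0.
apply: ler_wnM2r; last by rewrite M_mono// ltW.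
by rewrite mulr_ge0_le0 ?mulr_ge0 ?powR_ge0// affine_le0// ltW.
Qed.

Let T_low l : 0 < l -> l <= l1 -> 0 <= T A B w l.
Proof.
move=> lp ll1; rewrite mulr_ge0//.
  rewrite mulr_ge0 ?powR_ge0// kap_ge0// lp/=.
  by rewrite (le_lt_trans _ l0lt1)// (le_trans ll1).
by rewrite affine_ge0// (le_trans ll1).
Qed.

Let T_high l : l0 <= l < 1 -> - (K * (beta + 1) * (w * l0) `^ (1 - k)) <= T A B w l.
Proof.
move=> ll; have /andP[l0l l_1] := ll; have lp : 0 < l := lt_le_trans l0gt0 l0l.
have wl := one_wl (ltW lp).
have K0 : 0 <= K by rewrite (le_trans _ (kap_le ll))// kap_ge0// lp.
have B1 : B <= beta + 1 by rewrite lerD2l (le_trans (ltW etalt)).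
apply: (@le_trans _ _ (- (kap l * (1 + w * l) `^ (- k) * (B * (w * l))))); last first.
  rewrite -mulrN /T ler_wpM2l ?lerBDl ?lerDr ?(ltW A0)//.
    by rewrite mulr_ge0 ?powR_ge0// kap_ge0// lp.
  by rewrite lerDl ltW.
rewrite lerN2.
apply: (@le_trans _ _ (K * (beta + 1) * ((1 + w * l) `^ (- k) * (1 + w * l)))).
  rewrite -!mulrA [leLHS](_ : _ = kap l * (B * ((1 + w * l) `^ (- k) * (w * l)))); last by ring.
  apply: ler_pM; rewrite ?mulr_ge0 ?powR_ge0 ?(ltW B0) ?(ltW w0) ?(ltW lp)//.
  - by rewrite kap_ge0// lp.
  - exact: kap_le.
  - apply: ler_pM; rewrite ?mulr_ge0 ?powR_ge0 ?(ltW B0) ?(ltW w0) ?(ltW lp)//.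
    by rewrite ler_wpM2l ?powR_ge0// lerDr.
have -> : (1 + w * l) `^ (- k) * (1 + w * l) = (1 + w * l) `^ (1 - k).
  rewrite -{2}(powRr1 (ltW wl)) -powRD ?(gt_eqF wl) ?implybT//.
  by congr (_ `^ _); ring.
rewrite ler_wpM2l ?mulr_ge0 ?addr_ge0 ?(ltW beta0)//.
rewrite (_ : 1 - k = - (alpha + beta)); last by ring.
rewrite !powRN lef_pV2 ?posrE ?powR_gt0 ?mulr_gt0//.
rewrite ge0_ler_powR ?nnegrE ?addr_ge0 ?mulr_ge0 ?(ltW alpha0) ?(ltW beta0) ?(ltW w0) ?(ltW lp) ?(ltW l0gt0)//.
by rewrite (@le_trans _ _ (w * l))// ?ler_pM2l// lerDr.
Qed.

Let measurable_T : measurable_fun (`]0%R, 1%R[ : set (measurableTypeR R)) (T A B w).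
Proof.
have /measurable_EFinP mk := measurable_int _ kap_int.
have mid : measurable_fun (`]0%R, 1%R[ : set (measurableTypeR R)) (fun l => w * l).
  by apply: measurable_funM => //; exact: measurable_id.
apply: measurable_funM.
  apply: measurable_funM => //; apply: measurable_fun_powR.
  exact: measurable_funD.
apply: measurable_funB => //; exact: measurable_funM.
Qed.

Let integrable_T : mu.-integrable `]0%R, 1%R[ (EFin \o T A B w).
Proof.
have ik : mu.-integrable `]0%R, 1%R[ (fun l : R => (A + B * w)%:E * (kap l)%:E)%E.
  exact: integrableZl.
apply: (le_integrable _ _ _ ik) => //.
  by apply/measurable_EFinP; exact: measurable_T.
move=> l; rewrite /= in_itv/= => l01'; have /andP[lp l_1] := l01'.
rewrite lee_fin !normrM [leRHS]mulrC -mulrA ler_wpM2l//.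
rewrite ger0_norm ?powR_ge0//.
apply: (@le_trans _ _ (1 * `|A - B * (w * l)|)).
  rewrite ler_wpM2r// powRN invf_le1 ?powR_gt0 ?one_wl ?(ltW lp)//.
  rewrite -[leLHS](powRr0 (1 + w * l)) ler_powR//; last first.
    by move: alpha0 beta0; lra.
  by rewrite lerDl mulr_ge0 ?(ltW w0) ?(ltW lp).
have Bw0 : 0 <= B * w by rewrite mulr_ge0 ?(ltW w0)// ltW.
have A0' : 0 <= A by exact: ltW.
have AB0 : 0 <= A + B * w by exact: addr_ge0.
rewrite mul1r (ger0_norm AB0) (le_trans (ler_normB _ _))// (ger0_norm A0') lerD2l.
have Bwl0 : 0 <= B * w * l := mulr_ge0 Bw0 (ltW lp).
by rewrite mulrA (ger0_norm Bwl0) ler_piMr// ltW.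
Qed.

Local Notation Ilow := (`]0%R, l1[%classic : set (measurableTypeR R)).
Local Notation Imid := (`[l1, l0]%classic : set (measurableTypeR R)).
Local Notation Ihigh := (`]l0, 1%R[%classic : set (measurableTypeR R)).
Local Notation Igain := (`[(2 * w)^-1, w^-1]%classic : set (measurableTypeR R)).

Let l1lt : l1 < l0.
Proof.
rewrite (le_lt_trans l1w)// (lt_le_trans _ wl0)// ltf_pV2 ?posrE ?mulr_gt0//.
by rewrite ltr_pMl// ltr1n.
Qed.

Let l1_1 : l1 < 1. Proof. exact: lt_trans l1lt l0lt1. Qed.

Let T_split : \int[mu]_(l in `]0%R, 1%R[) T A B w l =
  \int[mu]_(l in Ilow) T A B w l +
  (\int[mu]_(l in Imid) T A B w l + \int[mu]_(l in Ihigh) T A B w l).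
Proof.
have e1 : `]0%R, 1%R[%classic = `]0%R, l1[ `|` `[l1, 1%R[ :> set R.
  by rewrite -itv_bndbnd_setU// bnd_simp// ltW.
have e2 : `[l1, 1%R[%classic = `[l1, l0] `|` `]l0, 1%R[ :> set R.
  by rewrite -itv_bndbnd_setU// bnd_simp// ltW.
rewrite e1 Rintegral_setU//.
- rewrite e2 Rintegral_setU//.
  + by rewrite -e2; apply: integrableS integrable_T => //; apply: subset_itvr; rewrite bnd_simp.
  + apply/disj_setPS => l []/=; rewrite !in_itv/= => /andP[_ h] /andP[h' _].
    by move: h'; rewrite ltNge h.
- by rewrite -e1; exact: integrable_T.
- apply/disj_setPS => l []/=; rewrite !in_itv/= => /andP[_ h] /andP[h' _].
  by move: h; rewrite ltNge h'.
Qed.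

Let integrable_sub (I : set (measurableTypeR R)) : measurable I ->
  I `<=` `]0%R, 1%R[ -> mu.-integrable I (EFin \o T A B w).
Proof. by move=> mI sI; apply: integrableS integrable_T. Qed.

Let continuous_dP : {within `[l1, l0], continuous dP}.
Proof.
apply: derivable_within_continuous => l; rewrite in_itv/= => /andP[l1l _].
have lp : 0 < l := lt_le_trans l10 l1l.
have wl := one_wl (ltW lp).
have d1 := is_derive_powR (alpha - 1 - eta') lp.
have d2 := is_derive_powR_affine (- k) wl.
have d3 := is_deriveB (is_derive_cst (alpha - eta') l (1 : R))
  (is_deriveZ (beta + eta') (is_deriveZ w (is_derive_id l (1 : R)))).
exact: (@ex_derive _ _ _ _ _ _ _ (is_deriveM (is_deriveM d1 d2) d3)).
Qed.

Let integrable_dP : mu.-integrable Imid (EFin \o dP).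
Proof.
apply: continuous_compact_integrable; first exact: segment_compact.
exact: continuous_dP.
Qed.

Let integral_dP : \int[mu]_(l in Imid) dP l = P l0 - P l1.
Proof.
have dP' l : 0 < l -> derivable P l 1.
  by move=> lp; exact: (@ex_derive _ _ _ _ _ _ _ (is_derive_P lp)).
have cP l : 0 < l -> {for l, continuous P}.
  by move=> lp; apply: differentiable_continuous; apply/derivable1_diffP; exact: dP'.
rewrite /Rintegral (@continuous_FTC2 R dP P)//.
- split.
  + by move=> l; rewrite in_itv/= => /andP[l1l _]; apply: dP'; exact: lt_trans l1l.
  + exact/cvg_at_right_filter/cP.
  + exact/cvg_at_left_filter/cP.
- move=> l; rewrite in_itv/= => /andP[l1l _].
  have lp : 0 < l := lt_trans l10 l1l.
  by rewrite derive1E; exact: (@derive_val _ _ _ _ _ _ _ (is_derive_P lp)).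
Qed.

Let sub_gain : Igain `<=` Imid.
Proof.
move=> l /=; rewrite !in_itv/= => /andP[h1 h2].
by rewrite (le_trans l1w h1) (le_trans h2 wl0).
Qed.

Let gain0 : 0 <= gain.
Proof. by rewrite mulr_ge0 ?(ltW w0)// mulr_ge0 ?powR_ge0. Qed.

(** The affine factor with [eta] exceeds the one with [eta'] by exactly
    [(eta' - eta) * (1 + w * l)], which is the source of the gain. *)
Let middle_le l : Imid l ->
  Ms * (dP l + (eta' - eta) * (gain * \1_Igain l)) <= T A B w l.
Proof.
rewrite /= in_itv/= => /andP[l1l ll0].
have lp : 0 < l := lt_le_trans l10 l1l.
have wl := one_wl (ltW lp).
apply: le_trans (T_middle l1l ll0); rewrite ler_wpM2l//.
rewrite [leRHS](_ : _ = dP l + (eta' - eta) *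
  (l `^ (alpha - 1 - eta') * (1 + w * l) `^ (1 - k))); last first.
  rewrite (_ : (1 + w * l) `^ (1 - k) = (1 + w * l) * (1 + w * l) `^ (- k)).
    rewrite /dP; ring.
  by rewrite -{2}(powRr1 (ltW wl)) -powRD ?(gt_eqF wl) ?implybT.
rewrite lerD2l ler_wpM2l ?subr_ge0 ?(ltW etalt)//.
rewrite indicE; have [|_] := boolP (l \in _); last by rewrite mulr0 mulr_ge0 ?powR_ge0.
by rewrite inE/= in_itv/= mulr1; exact: gain_le.
Qed.

Let integrable_gain : mu.-integrable Imid (EFin \o (fun l => gain * \1_Igain l)).
Proof.
have : mu.-integrable Imid (fun l => gain%:E * (\1_Igain l)%:E)%E.
  apply: integrableZl => //; apply: (integrableS measurableT) => //.
  exact: integrable_indic_itv.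
by apply: eq_integrable => // l _; rewrite /= EFinM.
Qed.

Let integral_gain : \int[mu]_(l in Imid) (gain * \1_Igain l) = gain / (2 * w).
Proof.
have i1 : mu.-integrable Imid (EFin \o \1_Igain).
  by apply: (integrableS measurableT) => //; exact: integrable_indic_itv.
rewrite RintegralZl//; congr (_ * _).
rewrite /Rintegral integral_indic//= setIidl//.
have -> : (mu Igain = ((2 * w)^-1)%:E)%E.
  rewrite lebesgue_measure_itv/= lte_fin ltf_pV2 ?posrE ?mulr_gt0// ltr_pMl// ltr1n.
  by rewrite -EFinB; congr EFin; field; rewrite gt_eqF.
by [].
Qed.

Let middle_integral :
  Ms * (P l0 - P l1 + (eta' - eta) * (gain / (2 * w))) <= \int[mu]_(l in Imid) T A B w l.
Proof.
have ig : mu.-integrable Imid (EFin \o (fun l => (eta' - eta) * (gain * \1_Igain l))).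
  have : mu.-integrable Imid (fun l => (eta' - eta)%:E * (gain * \1_Igain l)%:E)%E.
    exact: integrableZl.
  by apply: eq_integrable => // l _; rewrite /= EFinM.
have is_ : mu.-integrable Imid (EFin \o (fun l => dP l + (eta' - eta) * (gain * \1_Igain l))).
  have mI : measurable Imid by exact: measurable_itv.
  have := integrableD mI integrable_dP ig.
  by apply: eq_integrable => // l _; rewrite /= EFinD.
rewrite -integral_dP -integral_gain -RintegralZl// -RintegralD// -RintegralZl//.
apply: le_Rintegral => //.
- have : mu.-integrable Imid (fun l => Ms%:E * (dP l + (eta' - eta) * (gain * \1_Igain l))%:E)%E.
    exact: integrableZl.
  by apply: eq_integrable => // l _; rewrite /= EFinM.
- apply: integrable_sub => // l /=; rewrite !in_itv/= => /andP[h1 h2].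
  by rewrite (lt_le_trans l10 h1) (le_lt_trans h2).
Qed.

Let H := K * (beta + 1) * (w * l0) `^ (1 - k).

Let high_integral : - H <= \int[mu]_(l in Ihigh) T A B w l.
Proof.
have K0 : 0 <= K by apply: le_trans (ltW kap_l0) (kap_le _); rewrite lexx.
have H0 : 0 <= H by rewrite mulr_ge0 ?powR_ge0// mulr_ge0 ?addr_ge0 ?(ltW beta0).
have mu1 : (mu Ihigh = (1 - l0)%:E)%E by rewrite lebesgue_measure_itv/= lte_fin l0lt1.
apply: (@le_trans _ _ (\int[mu]_(l in Ihigh) cst (- H) l)).
  have e : \int[mu]_(l in Ihigh) cst (- H) l = - H * (1 - l0).
    by rewrite Rintegral_cst//; congr (_ * _); exact: (congr1 fine mu1).
  rewrite e mulNr lerN2 ler_piMr//.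
  by rewrite gerBl ltW.
apply: le_Rintegral => //.
- apply: measurable_bounded_integrable => //; first by rewrite [ltLHS](_ : _ = (1 - l0)%:E) ?ltry//; exact: mu1.
  exact: bounded_cst.
- apply: integrable_sub => // l /=; rewrite !in_itv/= => /andP[h1 ->].
  by rewrite (lt_trans l0gt0 h1).
- by move=> l; rewrite /= in_itv/= => /andP[/ltW h1 h2]; apply: T_high; rewrite h1.
Qed.

(** Gain on the middle range minus the losses at its lower end and beyond [l0]. *)
Lemma tail_integral_ge :
  let bracket := (eta' - eta) * (2 `^ (1 - k) * (2 * w) `^ (- alpha) / 2)
     - expR b * w `^ (- (alpha * (b / b3))) in
  0 <= bracket ->
  kap l0 * l0 `^ (1 - alpha) * l0 * bracket - K * (beta + 1) * (w * l0) `^ (1 - k)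
  <= \int[mu]_(l in `]0%R, 1%R[) T A B w l.
Proof.
move=> bracket br0; rewrite T_split.
have low0 : 0 <= \int[mu]_(l in Ilow) T A B w l.
  by apply: Rintegral_ge0 => l; rewrite /= in_itv/= => /andP[lp /ltW]; exact: T_low.
apply: (@le_trans _ _ (Ms * bracket - H)).
  by rewrite lerD2r ler_wpM2r// Ms_ge.
apply: (@le_trans _ _ (0 + (Ms * (P l0 - P l1 + (eta' - eta) * (gain / (2 * w))) - H))).
  rewrite add0r lerD2r ler_wpM2l// /bracket addrC lerD//.
    by rewrite (le_trans _ (_ : - P l1 <= _)) ?lerN2 ?P_l1// lerDr.
  rewrite ler_wpM2l ?subr_ge0 ?(ltW etalt)// /gain le_eqVlt; apply/orP; left; apply/eqP.
  by field; rewrite gt_eqF.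
apply: lerD => //; apply: lerD; [exact: middle_integral | exact: high_integral].
Qed.

End fixed_w.

Let k0 : 0 <= k. Proof. by move: alpha0 beta0; lra. Qed.

Lemma integral_affine_moment A B w : 0 <= w ->
  \int[mu]_(l in `]0%R, 1%R[) T A B w l =
  A * moment kap 0 k w - B * (w * moment kap 1 k w).
Proof.
move=> w0.
have i0 := integrable_moment kap_ge0 kap_int 0 k0 w0.
have i1 := integrable_moment kap_ge0 kap_int 1 k0 w0.
have mI : measurable (`]0%R, 1%R[%classic : set (measurableTypeR R)) by exact: measurable_itv.
have iZ (c : R) j : mu.-integrable `]0%R, 1%R[ (EFin \o moment_fun kap j k w) ->
  mu.-integrable `]0%R, 1%R[ (EFin \o (fun l => c * moment_fun kap j k w l)).
  move=> i; have : mu.-integrable `]0%R, 1%R[ (fun l => c%:E * (moment_fun kap j k w l)%:E)%E.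
    exact: integrableZl.
  by apply: eq_integrable => // l _; rewrite /= EFinM.
rewrite mulrA -[A * _]RintegralZl// -[(B * w) * _]RintegralZl// -RintegralB//; [|exact: iZ..].
by apply: eq_Rintegral => l _; rewrite /T /moment_fun expr0 expr1; ring.
Qed.

(** The limit [alpha / beta] exceeds the shrinkage function by at least a multiple,
    with a factor larger than one, of the inverse logarithm. *)
Theorem shrink_deficit : exists2 b2 : R, 1 < b2 & \forall w \near +oo,
  b2 / ln w * (moment kap 0 k w + w * moment kap 1 k w) <=
  alpha * moment kap 0 k w - beta * (w * moment kap 1 k w).
Proof.
(* 1 < b2 < b3 < b, equally spaced. *)
pose d := (b - 1) / 3.
have d0 : 0 < d by rewrite /d; move: b1; lra.
have dE : d = (b - 1) / 3 by [].
clearbody d; pose b2 := 1 + d; pose b3 := 1 + 2 * d.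
exists b2; first by rewrite /b2; lra.
have b21 : 1 < b2 by rewrite /b2; lra.
have b23 : b2 < b3 by rewrite /b2 /b3; lra.
have b3b : b3 < b by rewrite /b3; lra.
have b30 : 0 < b3 by lra.
pose e1 := b / b3 - 1.
have e10 : 0 < e1 by rewrite subr_gt0 ltr_pdivlMr// mul1r.
pose c1 := d * (2 `^ (1 - k) * 2 `^ (- alpha) / 2).
have c10 : 0 < c1 by rewrite mulr_gt0// divr_gt0// mulr_gt0// powR_gt0.
pose m0 := kap l0 * l0 `^ (1 - alpha) * l0.
have m00 : 0 < m0 by rewrite mulr_gt0 ?l0gt0// mulr_gt0// powR_gt0 ?l0gt0.
have l0p := l0gt0.
have K0 : 0 <= K by apply: le_trans (ltW kap_l0) (kap_le _); rewrite lexx l0lt1.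
pose H0 := K * (beta + 1) * l0 `^ (1 - k).
have H00 : 0 <= H0 by rewrite mulr_ge0 ?powR_ge0// mulr_ge0 ?addr_ge0 ?(ltW beta0).
have near1 : \forall w \near +oo, ln w * expR (- (e1 * ln w)) <=
    Num.min (alpha / (2 * (beta + 1))) (1 / 2).
  apply: (near_ln (P := fun u => u * expR (- (e1 * u)) <= _)).
  apply: near_mul_expRN => //.
  by rewrite lt_min !divr_gt0// mulr_gt0// addr_gt0.
have near2 : \forall w \near +oo,
    ln w * expR (- (alpha * e1 * ln w)) <= c1 / 2 / expR b.
  apply: (near_ln (P := fun u => u * expR (- (alpha * e1 * u)) <= _)).
  apply: near_mul_expRN; first by rewrite mulr_gt0.
  by rewrite !divr_gt0// expR_gt0.
have near3 : \forall w \near +oo,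
    ln w * expR (- (beta * ln w)) <= m0 * (c1 / 2) / (H0 + 1).
  apply: (near_ln (P := fun u => u * expR (- (beta * u)) <= _)).
  apply: near_mul_expRN => //.
  by rewrite divr_gt0 ?ltr_wpDl// mulr_gt0// divr_gt0.
have near4 : \forall w \near +oo, Num.max 1 (Num.max b3 (2 * b3 / alpha)) <= ln w.
  apply: (near_ln (P := fun u => _ <= u)).
  by apply: nbhs_pinfty_ge; exact: num_real.
near=> w.
have w1 : 1 < w by near: w; apply: nbhs_pinfty_gt; exact: num_real.
have w0 : 0 < w by exact: lt_trans w1.
have wl0 : l0^-1 <= w by near: w; apply: nbhs_pinfty_ge; exact: num_real.
have wab : alpha / (beta * l0) <= w by near: w; apply: nbhs_pinfty_ge; exact: num_real.
have h1 : ln w * expR (- (e1 * ln w)) <= Num.min (alpha / (2 * (beta + 1))) (1 / 2).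
  by near: w; exact: near1.
have h2 : ln w * expR (- (alpha * e1 * ln w)) <= c1 / 2 / expR b.
  by near: w; exact: near2.
have h3 : ln w * expR (- (beta * ln w)) <= m0 * (c1 / 2) / (H0 + 1).
  by near: w; exact: near3.
have h4 : Num.max 1 (Num.max b3 (2 * b3 / alpha)) <= ln w by near: w; exact: near4.
rewrite !ge_max in h4; have /andP[u1 /andP[ub3 uba]] := h4.
set u := ln w in h1 h2 h3 u1 ub3 uba *.
have u0 : 0 < u by exact: lt_le_trans u1.
rewrite le_min in h1; have /andP[h1a h1b] := h1.
have eta'1 : b3 / u <= 1 by rewrite ler_pdivrMr// mul1r.
have eta'alpha : b3 / u <= alpha / 2.
  by move: uba; rewrite ler_pdivrMr// => uba; rewrite ler_pdivrMr//; lra.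
have etalt : b2 / u < b3 / u by rewrite ltr_pM2r ?invr_gt0.
have eta0 : 0 < b2 / u by rewrite divr_gt0//; lra.
have E1 : expR (- (e1 * u)) <= u * expR (- (e1 * u)) by rewrite ler_peMl ?expR_ge0.
have l1E : expR (- (b / b3 * u)) = expR (- (e1 * u)) / w.
  rewrite -{1}(lnK w0) -expRN -expRD; congr expR; rewrite -/u /e1; ring.
have l1ls : expR (- (b / b3 * u)) <= (alpha - b2 / u) / ((beta + b2 / u) * w).
  rewrite l1E invfM mulrA ler_pM2r ?invr_gt0//.
  rewrite (le_trans (le_trans E1 h1a))// ler_pdivlMr; last by rewrite addr_gt0.
  rewrite mulrAC ler_pdivrMr ?mulr_gt0 ?addr_gt0//.
  have : alpha * (beta + b2 / u) <= alpha * (beta + 1).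
    by rewrite ler_pM2l// lerD2l; move: etalt eta'1; lra.
  have : alpha / 2 * (2 * (beta + 1)) <= (alpha - b2 / u) * (2 * (beta + 1)).
    by rewrite ler_pM2r ?mulr_gt0 ?addr_gt0//; move: etalt eta'alpha; lra.
  move=> a1 a2; apply: (le_trans a2); apply: le_trans a1.
  by rewrite le_eqVlt; apply/orP; left; apply/eqP; field.
have lsl0 : (alpha - b2 / u) / ((beta + b2 / u) * w) <= l0.
  rewrite ler_pdivrMr ?mulr_gt0 ?addr_gt0//.
  rewrite ler_pdivrMr ?mulr_gt0// in wab.
  apply: (@le_trans _ _ alpha); first by rewrite gerBl ltW.
  apply: (le_trans wab); rewrite (_ : w * (beta * l0) = l0 * (beta * w)); last by ring.
  by rewrite ler_pM2l// ler_pM2r// lerDl ltW.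
have l1w : expR (- (b / b3 * u)) <= (2 * w)^-1.
  by rewrite l1E invfM ler_pM2r ?invr_gt0// -div1r (le_trans E1).
have wl0' : w^-1 <= l0 by rewrite -[leRHS]invrK lef_pV2 ?posrE ?invr_gt0.
have := tail_integral_ge b21 b23 w1 eta'1 eta'alpha l1ls lsl0 l1w wl0'.
rewrite /= -/u integral_affine_moment ?(ltW w0)//.
set br := (_ - _ : R); rewrite -/m0 => br_ge.
have wa : w `^ (- alpha) = expR (- (alpha * u)) by rewrite powR_expR// mulNr.
have eE : (b3 / u - b2 / u) * (2 `^ (1 - k) * (2 * w) `^ (- alpha) / 2) =
    c1 * (expR (- (alpha * u)) / u).
  rewrite powRM ?(ltW w0)// wa /c1 /b3 /b2; field; rewrite gt_eqF//.
have pE : w `^ (- (alpha * (b / b3))) = expR (- (alpha * u)) / u * (u * expR (- (alpha * e1 * u))).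
  rewrite powR_expR// -/u [RHS]mulrA divfK ?gt_eqF// -expRD; congr expR.
  by rewrite /e1; field; rewrite gt_eqF.
have X0 : 0 < expR (- (alpha * u)) / u by rewrite divr_gt0// expR_gt0.
set X := expR _ / u in eE pE X0.
(* The gain in the bracket is c1 * X, and half of it covers the loss at l1. *)
have br_X : c1 / 2 * X <= br.
  rewrite /br eE pE.
  have : expR b * (X * (u * expR (- (alpha * e1 * u)))) <= c1 / 2 * X.
    rewrite mulrCA [leRHS]mulrC ler_pM2l//.
    by rewrite ler_pdivlMr ?expR_gt0// in h2; rewrite mulrC.
  by move: (expR b * _) => y hy; lra.
have br0 : 0 <= br by apply: le_trans br_X; rewrite mulr_ge0 ?(ltW X0)// divr_ge0// ltW.
have {}br_ge := br_ge br0.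
have HE : K * (beta + 1) * (w * l0) `^ (1 - k) = H0 * (X * (u * expR (- (beta * u)))).
  rewrite powRM ?(ltW w0) ?(ltW l0p)// /H0 (powR_expR _ w0) -/u.
  have -> : X * (u * expR (- (beta * u))) = expR ((1 - k) * u).
    by rewrite /X mulrA divfK ?gt_eqF// -expRD; congr expR; ring.
  by ring.
have H_le : K * (beta + 1) * (w * l0) `^ (1 - k) <= m0 * br.
  rewrite HE; apply: (@le_trans _ _ (m0 * (c1 / 2 * X))); last by rewrite ler_pM2l.
  rewrite mulrCA mulrA [leRHS]mulrA [leRHS]mulrC -mulrA ler_pM2l//.
  rewrite ler_pdivlMr ?ltr_wpDl// in h3; apply: le_trans h3.
  by rewrite mulrC ler_wpM2l ?lerDl// mulr_ge0 ?expR_ge0 ?(ltW u0).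
have : 0 <= (alpha - b2 / u) * moment kap 0 k w - (beta + b2 / u) * (w * moment kap 1 k w).
  by apply: le_trans br_ge; rewrite subr_ge0.
move: (moment _ 0 _ _) (w * moment _ _ _ _) => x y; rewrite mulrBl mulrDl mulrDr; lra.
Unshelve. all: end_near. Qed.

End tail.

(** * Derivative of the shrinkage function *)

Section moment_derivative.
Context {R : realType}.
Local Notation mu := (@lebesgue_measure R).
Variable kap : R -> R.
Hypothesis kap_ge0 : forall l : R, 0 < l < 1 -> 0 <= kap l.
Hypothesis kap_int : mu.-integrable `]0%R, 1%R[ (EFin \o kap).
Hypothesis kap_gt0 : (0 < \int[mu]_(l in `]0%R, 1%R[) (kap l)%:E)%E.
Variable k : R.
Hypothesis k0 : 0 <= k.
Implicit Types (w l : R) (j : nat).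

Let k10 : 0 <= k + 1. Proof. by rewrite addr_ge0. Qed.

Lemma is_derive_moment_fun j w l : 0 < w -> 0 < l ->
  is_derive w 1 (fun y => moment_fun kap j k y l) (- k * moment_fun kap j.+1 (k + 1) w l).
Proof.
move=> w0 l0; have wl0 : 0 < 1 + l * w by rewrite ltr_wpDr// mulr_ge0 ?ltW.
have d := is_deriveZ (kap l * l ^+ j) (is_derive_powR_affine (- k) wl0).
have -> : (fun y => moment_fun kap j k y l) =
    (kap l * l ^+ j \*: (fun y : R => (1 + l * y) `^ (- k))).
  by apply/funext => y; rewrite /moment_fun /GRing.scale/= mulrA [y * l]mulrC.
apply: (is_derive_eq d); rewrite /GRing.scale/= /moment_fun exprS [w * l]mulrC.
by rewrite (_ : - (k + 1) = - k - 1); ring.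
Qed.

(** Differentiation under the integral sign, dominated by [k * `|kap|]. *)
Lemma is_derive_moment j w : 0 < w ->
  is_derive w 1 (moment kap j k) (- k * moment kap j.+1 (k + 1) w).
Proof.
move=> w0.
pose f (y l : R) := moment_fun kap j k y l.
have mD : measurable (`]0%R, 1%R[%classic : set (measurableTypeR R)) by exact: measurable_itv.
have Iw : `]0%R, (2 * w)[%classic w by rewrite /= in_itv/= w0 ltr_pMl// ltr1n.
have itf x : `]0%R, (2 * w)[%classic x -> mu.-integrable `]0%R, 1%R[ (EFin \o f x).
  by rewrite /= in_itv/= => /andP[x0 _]; apply: integrable_moment => //; exact: ltW.
have df x l : `]0%R, (2 * w)[%classic x -> `]0%R, 1%R[%classic l -> derivable (f ^~ l) x 1.
  rewrite /= !in_itv/= => /andP[x0 _] /andP[l0 _].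
  exact: (@ex_derive _ _ _ _ _ _ _ (is_derive_moment_fun j x0 l0)).
have dfE x l : `]0%R, (2 * w)[%classic x -> `]0%R, 1%R[%classic l ->
    partial1of2 f x l = - k * moment_fun kap j.+1 (k + 1) x l.
  rewrite /= !in_itv/= => /andP[x0 _] /andP[l0 _].
  rewrite partial1of2E.
  exact: (@derive_val _ _ _ _ _ _ _ (is_derive_moment_fun j x0 l0)).
pose G l := k * `|kap l|.
have G0 l : 0 <= G l by rewrite mulr_ge0.
have iG : mu.-integrable `]0%R, 1%R[ (EFin \o G).
  have : mu.-integrable `]0%R, 1%R[ (fun l => k%:E * (`|(kap l)%:E|))%E.
    by apply: integrableZl => //; exact: integrable_abse.
  by apply: eq_integrable.
have Gub x l : `]0%R, (2 * w)[%classic x -> `]0%R, 1%R[%classic l ->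
    `|partial1of2 f x l| <= G l.
  move=> xI lI; rewrite dfE//; move: xI lI; rewrite /= !in_itv/= => /andP[x0 _] l01.
  rewrite normrM normrN (ger0_norm k0) ler_wpM2l// !ger0_norm ?kap_ge0 ?moment_fun_ge0//.
  by rewrite moment_fun_le// ltW.
apply: DeriveDef.
  exact: (derivable_under_integral mD Iw itf df G0 iG Gub).
rewrite -derive1E (differentiation_under_integral mD Iw itf df G0 iG Gub).
rewrite /moment -RintegralZl//; last by apply: integrable_moment => //; exact: ltW.
by apply: eq_Rintegral => l; rewrite inE => lI; exact: dfE.
Qed.

(** Because [w * l <= 1 + w * l]. *)
Lemma mul_moment_le j w : 0 <= w -> w * moment kap j.+1 (k + 1) w <= moment kap j k w.
Proof.
move=> w0; have i1 := integrable_moment kap_ge0 kap_int j.+1 k10 w0.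
rewrite /moment -RintegralZl//; apply: le_Rintegral => //.
- have : mu.-integrable `]0%R, 1%R[ (fun l => w%:E * (moment_fun kap j.+1 (k + 1) w l)%:E)%E.
    exact: integrableZl.
  by apply: eq_integrable.
- exact: integrable_moment.
- move=> l; rewrite /= in_itv/= => l01; have /andP[l0 l1] := l01.
  rewrite /moment_fun mulrCA ler_wpM2l ?kap_ge0// exprS !mulrA.
  rewrite [_ * l ^+ j]mulrC -!mulrA ler_wpM2l ?exprn_ge0 ?(ltW l0)//.
  have wl : 0 < 1 + w * l by rewrite ltr_pwDl// mulr_ge0// ltW.
  have -> : (1 + w * l) `^ (- k) = (1 + w * l) * (1 + w * l) `^ (- (k + 1)).
    rewrite -{2}(powRr1 (ltW wl)) -powRD ?(gt_eqF wl) ?implybT//.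
    by congr (_ `^ _); ring.
  by rewrite mulrA ler_wpM2r ?powR_ge0// lerDr.
Qed.

Lemma shrink_ge0 w : 0 <= w -> 0 <= shrink kap k w.
Proof. by move=> w0; rewrite divr_ge0 ?mulr_ge0 ?moment_ge0. Qed.

(** The derivative with respect to [ln w] is controlled by the function itself: each
    differentiation of a moment lowers it by a factor [w], up to the constant [k]. *)
Lemma is_derive_shrink w : 0 < w -> exists2 dphi : R,
  is_derive w 1 (shrink kap k) dphi & `|w * dphi| <= (1 + 2 * k) * shrink kap k w.
Proof.
move=> w0; have w0' := ltW w0.
have m0gt := moment_gt0 kap_ge0 kap_int kap_gt0 0 k0 w0'.
have m1ge := moment_ge0 kap_ge0 1 k w.
have n1ge := moment_ge0 kap_ge0 1 (k + 1) w.
have n2ge := moment_ge0 kap_ge0 2 (k + 1) w.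
have le1 := mul_moment_le 0 w0'.
have le2 := mul_moment_le 1 w0'.
have d0 := is_derive_moment 0 w0.
have d1 := is_derive_moment 1 w0.
have m0n : moment kap 0 k w != 0 by rewrite gt_eqF.
have dV := is_deriveV m0n d0.
have dN := is_deriveM (is_derive_id w (1 : R)) d1.
have := is_deriveM dN dV.
set dphi := (X in is_derive _ _ _ X); move=> d.
exists dphi; first by [].
have -> : w * dphi = shrink kap k w
    - k * (w * (w * moment kap 2 (k + 1) w) / moment kap 0 k w)
    + k * (shrink kap k w * (w * moment kap 1 (k + 1) w / moment kap 0 k w)).
  rewrite /dphi /shrink /GRing.scale/= (_ : (id * moment kap 1 k) w = w * moment kap 1 k w)//.
  move: (moment kap 2 _ w) (moment kap 1 (k + 1) w) (moment kap 1 k w) (moment kap 0 k w) m0n.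
  by move=> x2 x1 y1 y0 y0n; rewrite mulr1; field.
have s0 := shrink_ge0 w0'.
have : w * (w * moment kap 2 (k + 1) w) / moment kap 0 k w <= shrink kap k w.
  by rewrite /shrink (ler_pM2r (x := (moment kap 0 k w)^-1)) ?invr_gt0 ?(ler_pM2l w0).
have : w * moment kap 1 (k + 1) w / moment kap 0 k w <= 1.
  by rewrite ler_pdivrMr ?mul1r.
have : 0 <= w * (w * moment kap 2 (k + 1) w) / moment kap 0 k w.
  exact: divr_ge0 (mulr_ge0 w0' (mulr_ge0 w0' n2ge)) (ltW m0gt).
have : 0 <= w * moment kap 1 (k + 1) w / moment kap 0 k w.
  exact: divr_ge0 (mulr_ge0 w0' n1ge) (ltW m0gt).
move: (w * moment kap 1 _ w / _) (w * (w * _) / _) (shrink kap k w) s0 => r2 r1 s s0.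
move=> r20 r10 r21 r1s {d dphi dN dV d0 d1 m0n m0gt m1ge n1ge n2ge le1 le2}.
have k1 : k * r1 <= k * s by exact: ler_wpM2l.
have k2 : k * (s * r2) <= k * s by apply: ler_wpM2l => //; rewrite ler_piMr.
have k3 : 0 <= k * r1 by exact: mulr_ge0.
have k4 : 0 <= k * (s * r2) by apply: mulr_ge0 => //; exact: mulr_ge0.
rewrite ler_norml mulrDl mul1r -mulrA.
move: (k * r1) (k * s) (k * (s * r2)) k1 k2 k3 k4 => x y z *.
by apply/andP; split; lra.
Qed.

End moment_derivative.

(** * The improving perturbation *)

Section squared_positive_part.
Context {R : realType}.
Implicit Types t : R.

Definition sqpos t : R := Num.max t 0 ^+ 2.

(** The square makes the cut-off continuously differentiable. *)
Lemma is_derive_sqpos t : is_derive t 1 sqpos (2 * Num.max t 0).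
Proof.
have [t0|t0|->] := ltgtP t 0.
- rewrite mulr0; have := is_derive_cst (0 : R) t (1 : R).
  apply: near_eq_is_derive; near=> y; rewrite /sqpos max_r ?expr0n//.
  by apply: ltW; near: y; exact: lt_nbhsl.
- have := is_deriveX 2 (is_derive_id t (1 : R)) => d.
  have {}d : is_derive t 1 (fun y : R => y ^+ 2) (2 * t).
    by apply: (is_derive_eq d); rewrite /GRing.scale/= expr1 mulr1.
  move: d; apply: near_eq_is_derive; near=> y; rewrite /sqpos max_l//.
  by apply: ltW; near: y; exact: lt_nbhsr.
- rewrite mulr0.
  have c : (fun h : R => h^-1 *: (sqpos (h *: 1 + 0) - sqpos 0)) @ 0^' --> (0 : R).
    apply/cvgrPdist_le => /= e e0; near=> h.
    have h0 : h != 0 by near: h; exact: nbhs_dnbhs_neq.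
    rewrite sub0r normrN /sqpos (max_r (lexx 0)) expr0n/= subr0 addr0 /GRing.scale/= mulr1.
    have [h00|h00] := leP h 0; first by rewrite expr0n/= mulr0 normr0 ltW.
    rewrite expr2 mulrA mulVf// mul1r ger0_norm ?(ltW h00)//.
    by rewrite -[h]ger0_norm ?(ltW h00)//; near: h; exact: dnbhs0_le.
  apply: DeriveDef; first by apply/cvg_ex; exists 0.
  by apply/cvg_lim.
Unshelve. all: end_near. Qed.

End squared_positive_part.

Section improvement.
Context {R : realType}.
Implicit Types (u w : R).
Variables (phi : R -> R) (alpha beta C0 b2 : R).
Hypotheses (beta0 : 0 < beta) (b21 : 1 < b2).
Hypothesis phi_ge0 : forall w : R, 0 <= w -> 0 <= phi w.
Hypothesis C0_ge0 : 0 <= C0.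
Hypothesis phi_derive : forall w : R, 0 < w -> exists2 dphi : R,
  is_derive w 1 phi dphi & `|w * dphi| <= C0 * phi w.

Local Notation d := (2 / beta).
Let b1 := (1 + b2) / 2.
Let b11 : 1 < b1. Proof. by rewrite /b1; move: b21; lra. Qed.
Let b12 : b1 < b2. Proof. by rewrite /b1; move: b21; lra. Qed.
Let b10 : 0 < b1. Proof. exact: lt_trans b11. Qed.
Let d0 : 0 < d. Proof. exact: divr_gt0. Qed.

Variable u0 : R.
Hypothesis u01 : 1 <= u0.
Hypothesis u0_deficit : forall w : R, expR u0 <= w ->
  b2 / ln w * (1 + phi w) <= alpha - beta * phi w.
Hypothesis u0_large : forall u : R, u0 <= u ->
  (1 + d * b1 + d * C0) * u `^ (- b1) <= d * (b2 - b1) / u.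

(** The profile of the perturbation in the logarithmic variable: slightly smaller
    than [u ^ (- b1)], cut off in a continuously differentiable way at [u0]. *)
Let G u := sqpos (u - u0) * u `^ (- b1 - 2).
Let dG u := 2 * Num.max (u - u0) 0 * u `^ (- b1 - 2)
  + sqpos (u - u0) * ((- b1 - 2) * u `^ (- b1 - 3)).

Let is_derive_G u : 0 < u -> is_derive u 1 G (dG u).
Proof.
move=> up.
have ds : is_derive u 1 (fun y : R => y - u0) 1.
  have dd := is_deriveB (is_derive_id u (1 : R)) (is_derive_cst u0 u (1 : R)).
  by apply: (is_derive_eq dd); rewrite subr0.
have d1 := @is_derive1_comp R sqpos (fun y => y - u0) u _ _ (is_derive_sqpos _) ds.
have d2 := is_derive_powR (- b1 - 2) up.
have := is_deriveM d1 d2; rewrite /GRing.scale/= /comp => dd; apply: (is_derive_eq dd).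
by rewrite /dG (_ : - b1 - 2 - 1 = - b1 - 3); ring.
Qed.

Let G_ge0 u : 0 <= G u. Proof. by rewrite mulr_ge0 ?powR_ge0 ?sqr_ge0. Qed.

Let G_low u : u <= u0 -> G u = 0.
Proof. by move=> uu; rewrite /G /sqpos max_r ?subr_le0// expr0n mul0r. Qed.

Let sqr_powR r (u : R) : 0 < u -> u ^+ 2 * u `^ (r - 2) = u `^ r.
Proof.
move=> up; rewrite -powR_mulrn ?(ltW up)// -powRD ?(gt_eqF up) ?implybT//.
by congr (_ `^ _); ring.
Qed.

Let G_le u : u0 <= u -> G u <= u `^ (- b1).
Proof.
move=> uu; have up : 0 < u by rewrite (lt_le_trans _ uu)// (lt_le_trans _ u01).
rewrite -(sqr_powR _ up) ler_wpM2r ?powR_ge0// /sqpos max_l ?subr_ge0//.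
by rewrite ler_sqr ?nnegrE ?subr_ge0 ?(ltW up)// gerBl (le_trans _ u01).
Qed.

Let G_le1 u : u0 <= u -> G u <= 1.
Proof.
move=> uu; rewrite (le_trans (G_le uu))// powRN invf_le1 ?powR_gt0 ?(lt_le_trans _ uu) ?(lt_le_trans _ u01)//.
by rewrite -[leLHS](powRr0 u) ler_powR ?(le_trans u01)// ltW.
Qed.

(** The cut-off factor is increasing, so it can only raise the logarithmic derivative
    above the exponent [- b1]. *)
Let dG_ge u : u0 < u -> - (b1 * G u / u) <= dG u.
Proof.
move=> uu; have up : 0 < u by rewrite (lt_trans _ uu)// (lt_le_trans _ u01).
have u0p : 0 < u0 by exact: lt_le_trans u01.
have su : 0 < u - u0 by rewrite subr_gt0.
have pE : u `^ (- b1 - 2) = u `^ (- b1 - 3) * u.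
  rewrite -{3}(powRr1 (ltW up)) -powRD ?(gt_eqF up) ?implybT//.
  by congr (_ `^ _); ring.
rewrite /dG /G /sqpos max_l ?(ltW su)// pE -subr_ge0.
rewrite [leRHS](_ : _ = 2 * (u - u0) * u0 * u `^ (- b1 - 3)); last first.
  by field; rewrite gt_eqF.
by rewrite !mulr_ge0 ?powR_ge0 ?ltW.
Qed.

Let dG_le u : u0 < u -> `|dG u| <= b1 + 4.
Proof.
move=> uu; have up : 0 < u by rewrite (lt_trans _ uu)// (lt_le_trans _ u01).
have u0p : 0 < u0 by exact: lt_le_trans u01.
have u1 : 1 <= u by exact: le_trans u01 (ltW uu).
have su : 0 < u - u0 by rewrite subr_gt0.
have suu : u - u0 <= u by rewrite gerBl ltW.
have p2 : (u - u0) * u `^ (- b1 - 2) <= 1.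
  apply: (@le_trans _ _ (u ^+ 2 * u `^ (- b1 - 2))).
    by rewrite ler_wpM2r ?powR_ge0// (le_trans suu)// expr2 ler_peMl ?(ltW up).
  rewrite sqr_powR// -[leRHS](powRr0 u) ler_powR// oppr_le0.
  exact: ltW.
have p3 : (u - u0) ^+ 2 * u `^ (- b1 - 3) <= 1.
  apply: (@le_trans _ _ (u ^+ 2 * u `^ ((- b1 - 1) - 2))).
    rewrite (_ : - b1 - 1 - 2 = - b1 - 3); last by ring.
    by rewrite ler_wpM2r ?powR_ge0// ler_sqr ?nnegrE ?(ltW su) ?(ltW up).
  rewrite sqr_powR// -[leRHS](powRr0 u) ler_powR//; move: b10; lra.
have q2 : 0 <= (u - u0) * u `^ (- b1 - 2) by rewrite mulr_ge0 ?powR_ge0 ?ltW.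
have q3 : 0 <= (u - u0) ^+ 2 * u `^ (- b1 - 3) by rewrite mulr_ge0 ?powR_ge0 ?sqr_ge0.
rewrite /dG /sqpos max_l ?(ltW su)//.
apply: le_trans (ler_normD _ _) _.
have -> : `|2 * (u - u0) * u `^ (- b1 - 2)| = 2 * ((u - u0) * u `^ (- b1 - 2)).
  by rewrite -mulrA ger0_norm// mulr_ge0.
rewrite [X in `|X|]mulrCA [X in _ + X]normrM (ger0_norm q3).
have -> : `|- b1 - 2| = b1 + 2 by rewrite -opprD normrN ger0_norm// addr_ge0// ltW.
have : (b1 + 2) * ((u - u0) ^+ 2 * u `^ (- b1 - 3)) <= (b1 + 2) * 1.
  by rewrite ler_wpM2l// addr_ge0// ltW.
move: (_ * _ ) p2 => x p2 h; lra.
Qed.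

Definition perturbation w := G (ln w) / (1 + phi w).

Local Notation g := perturbation.
Local Notation w0 := (expR u0).

Let one_phi w : 0 <= w -> 0 < 1 + phi w.
Proof. by move=> wp; rewrite ltr_pwDl// phi_ge0. Qed.

Lemma perturbation_low w : w <= w0 -> g w = 0.
Proof.
move=> ww; rewrite /g G_low ?mul0r//.
have [wp|wp] := ltP 0 w; first by rewrite -[leRHS]expRK ler_ln ?posrE ?expR_gt0.
by rewrite ln0// (le_trans _ u01).
Qed.

Let ln_gt w : w0 < w -> u0 < ln w.
Proof.
by move=> ww; rewrite -[ltLHS]expRK ltr_ln ?posrE ?expR_gt0// (lt_trans (expR_gt0 u0)).
Qed.

Lemma perturbation_neq0 w : w0 < w -> g w != 0.
Proof.
move=> ww; have uw := ln_gt ww; have wp : 0 < w := lt_trans (expR_gt0 u0) ww.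
rewrite mulf_neq0 ?invr_neq0 ?gt_eqF ?one_phi ?(ltW wp)//.
rewrite mulr_gt0 ?powR_gt0//; last by rewrite (lt_trans _ uw)// (lt_le_trans _ u01).
by rewrite exprn_gt0// lt_max subr_gt0 uw.
Qed.

Lemma perturbation_ge0 w : 0 <= g w.
Proof.
have [ww|ww] := leP w w0; first by rewrite perturbation_low.
by rewrite divr_ge0// ltW// one_phi// ltW// (lt_trans (expR_gt0 u0)).
Qed.

Lemma perturbation_le1 w : g w <= 1.
Proof.
have [ww|ww] := leP w w0; first by rewrite perturbation_low.
have wp : 0 < w := lt_trans (expR_gt0 u0) ww.
rewrite ler_pdivrMr ?one_phi ?(ltW wp)// mul1r (le_trans (G_le1 (ltW (ln_gt ww))))//.
by rewrite lerDl phi_ge0// ltW.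
Qed.

Let is_derive_high w (wp : 0 < w) (dphi : R) : is_derive w 1 phi dphi -> 1 < w ->
  is_derive w 1 g ((dG (ln w) / w - g w * dphi) / (1 + phi w)).
Proof.
move=> dp w1; have up : 0 < ln w by exact: ln_gt0.
have d1 := @is_derive1_comp R G (@ln R) w _ _ (is_derive_G up) (is_derive1_ln wp).
have d2 := is_deriveD (is_derive_cst (1 : R) w (1 : R)) dp.
have n0 : (cst 1 + phi) w != 0 by rewrite gt_eqF//; exact: one_phi (ltW wp).
have := is_deriveM d1 (is_deriveV n0 d2); rewrite /GRing.scale/= => dd.
apply: (is_derive_eq dd).
rewrite (_ : (cst 1 + phi) w = 1 + phi w)//.
rewrite /g; have := one_phi (ltW wp).
move: (G _) (dG _) (1 + phi w) => x y z z0; field.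
by rewrite (gt_eqF wp) (gt_eqF z0).
Qed.

Lemma derivable_perturbation w : derivable g w 1.
Proof.
have [ww|ww] := ltP w w0.
  apply: (@near_eq_derivable _ _ _ (cst 0)); last exact: derivable_cst.
  near=> y; rewrite perturbation_low//; apply: ltW.
  by near: y; exact: lt_nbhsl.
have wp : 0 < w := lt_le_trans (expR_gt0 u0) ww.
have w1 : 1 < w by rewrite (lt_le_trans _ ww)// expR_gt1 (lt_le_trans _ u01).
have [dphi dp _] := phi_derive wp.
exact: (@ex_derive _ _ _ _ _ _ _ (is_derive_high wp dp w1)).
Unshelve. all: end_near. Qed.

Lemma derive_perturbation_low w : w <= w0 -> 'D_1 g w = 0.
Proof.
rewrite le_eqVlt => /orP[/eqP ->|ww].
  have wp : 0 < w0 := expR_gt0 u0.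
  have w1 : 1 < w0 by rewrite expR_gt1 (lt_le_trans _ u01).
  have [dphi dp _] := phi_derive wp.
  rewrite (@derive_val _ _ _ _ _ _ _ (is_derive_high wp dp w1)) perturbation_low//.
  by rewrite expRK /dG /sqpos subrr maxxx expr0n mulr0 !mul0r addr0 mul0r subr0 mul0r.
rewrite (@near_eq_derive _ _ _ _ (cst 0)) ?derive_cst//.
near=> y; rewrite perturbation_low//; apply: ltW.
by near: y; exact: lt_nbhsl.
Unshelve. all: end_near. Qed.

Lemma derive_perturbation_le w : `|'D_1 g w| <= b1 + 4 + C0.
Proof.
have C0' : 0 <= b1 + 4 + C0 by rewrite !addr_ge0// ltW.
have [ww|ww] := leP w w0; first by rewrite derive_perturbation_low ?normr0.
have wp : 0 < w := lt_trans (expR_gt0 u0) ww.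
have w1 : 1 < w by rewrite (lt_trans _ ww)// expR_gt1 (lt_le_trans _ u01).
have [dphi dp dple] := phi_derive wp.
rewrite (@derive_val _ _ _ _ _ _ _ (is_derive_high wp dp w1)).
have hG := dG_le (ln_gt ww).
have g0 := perturbation_ge0 w; have g1 := perturbation_le1 w.
have p0 := phi_ge0 (ltW wp); have op := one_phi (ltW wp).
rewrite -(@ler_pM2r _ w)// (_ : `|_| * w = `|(dG (ln w) / w - g w * dphi) / (1 + phi w) * w|); last first.
  by rewrite [RHS]normrM (gtr0_norm wp).
rewrite (_ : _ / _ * w = (dG (ln w) - g w * (w * dphi)) / (1 + phi w)); last first.
  by field; rewrite !gt_eqF.
rewrite normrM normfV (gtr0_norm op) ler_pdivrMr//.
apply: le_trans (ler_normB _ _) _; rewrite normrM (ger0_norm g0).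
apply: (@le_trans _ _ (b1 + 4 + 1 * (C0 * phi w))).
  by apply: lerD => //; apply: ler_pM.
apply: (@le_trans _ _ ((b1 + 4 + C0) * (1 + phi w))).
  rewrite mul1r mulrDl lerD//; last by rewrite ler_wpM2l// lerDr.
  by rewrite ler_peMr ?lerDl// addr_ge0// ltW.
by rewrite ler_wpM2r ?(ltW op)// ler_peMr// ltW.
Qed.

(** The factor [1 / (1 + phi)] in the perturbation cancels the term in which [phi'] is
    multiplied by [g] alone; what is left of [phi'] is quadratic in [g]. *)
Lemma perturbation_gain w : 0 < w ->
  0 <= g w * (2 * ((alpha / beta - phi w) / w) + d * derive1 phi w
         - g w / w + d * derive1 g w) + d * derive1 g w * (1 + phi w).
Proof.
move=> wp; rewrite !derive1E.
have [ww|ww] := leP w w0.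
  by rewrite perturbation_low// derive_perturbation_low// mul0r mulr0 mul0r addr0.
have w1 : 1 < w by rewrite (lt_trans _ ww)// expR_gt1 (lt_le_trans _ u01).
have [dphi dp dple] := phi_derive wp.
rewrite (@derive_val _ _ _ _ _ _ _ dp).
rewrite (@derive_val _ _ _ _ _ _ _ (is_derive_high wp dp w1)).
have g0 := perturbation_ge0 w.
have p0 := phi_ge0 (ltW wp); have op := one_phi (ltW wp).
have uw := ln_gt ww; have up : 0 < ln w by rewrite (lt_trans _ uw)// (lt_le_trans _ u01).
have defi := u0_deficit (ltW ww).
have large := u0_large (ltW uw).
have Gle := G_le (ltW uw).
have dGge := dG_ge uw.
have gE : G (ln w) = g w * (1 + phi w) by rewrite /g divfK ?gt_eqF.
rewrite gE in Gle dGge; have u1 : 1 <= ln w := le_trans u01 (ltW uw).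
move: (g w) (phi w) (ln w) (dG (ln w)) (ln w `^ (- b1)) dple g0 p0 op up u1 defi large Gle dGge.
move=> {gE uw ww w1 dp} x f u H P dple x0 f0 of0 u_0 u_1 defi large xP Hge.
rewrite -(@pmulr_rge0 _ w)//.
rewrite [leRHS](_ : _ = x * (d * (alpha - beta * f) - x
  + d * ((H - x * (w * dphi)) / (1 + f))) + d * H); last first.
  by field; rewrite !gt_eqF.
move: (w * dphi) dple => D; rewrite ler_norml => /andP[_ Dle].
have xf : x * f <= x * (1 + f) by rewrite ler_wpM2l// lerDr.
have xx : x <= P by rewrite (le_trans _ xP)// ler_peMr// lerDl.
have q1 : - (b1 * x / u) - C0 * x <= (H - x * D) / (1 + f).
  rewrite ler_pdivlMr// mulrBl; apply: lerB.
    by apply: le_trans Hge; rewrite le_eqVlt; apply/orP; left; apply/eqP; ring.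
  rewrite (le_trans (ler_wpM2l x0 Dle))// mulrCA -mulrA ler_wpM2l//.
have q2 : b1 * x / u <= b1 * x.
  by rewrite ler_pdivrMr// ler_peMr// mulr_ge0// ltW.
have q3 : d * (b1 * x / u) <= d * (b1 * x) by rewrite ler_pM2l.
have q4 : d * (- (b1 * x / u) - C0 * x) <= d * ((H - x * D) / (1 + f)) by rewrite ler_pM2l.
have q5 : d * (b2 / u * (1 + f)) <= d * (alpha - beta * f) by rewrite ler_pM2l.
have q6 : d * - (b1 * (x * (1 + f)) / u) <= d * H by rewrite ler_pM2l.
have q7 : (1 + d * b1 + d * C0) * x <= d * (b2 - b1) / u.
  apply: le_trans large; rewrite ler_wpM2l// !addr_ge0//.
    by rewrite mulr_ge0 ?ltW.
  by rewrite mulr_ge0// ltW.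
have q8 : d * (b2 - b1) / u <= d * (b2 - b1) / u * (1 + f).
  by rewrite ler_peMr ?lerDl// divr_ge0 ?(ltW u_0)// mulr_ge0 ?(ltW d0)// subr_ge0 ltW.
apply: (@le_trans _ _ (x * (d * (b2 - b1) / u * (1 + f) - (1 + d * b1 + d * C0) * x))).
  by rewrite mulr_ge0// subr_ge0 (le_trans q7).
apply: (@le_trans _ _ (x * (d * (b2 / u * (1 + f)) - x + d * (- (b1 * x / u) - C0 * x))
   + d * - (b1 * (x * (1 + f)) / u))); last first.
  apply: lerD => //; apply: ler_wpM2l => //; apply: lerD => //.
  exact: lerD.
rewrite -subr_ge0 [leRHS](_ : _ = x * (d * (b1 * x) - d * (b1 * x / u))); last by ring.
by rewrite mulr_ge0// subr_ge0.
Qed.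

End improvement.

(** The cut-off point [u0] has to be beyond the range where the deficit is unknown and
    large enough for [u `^ (- b1)] to be negligible against [1 / u]. *)
Theorem deficit_improvable (R : realType) (phi : R -> R) (alpha beta C0 b2 : R) :
  0 < beta -> 1 < b2 -> 0 <= C0 ->
  (forall w : R, 0 <= w -> 0 <= phi w) ->
  (forall w : R, 0 < w -> exists2 dphi : R,
     is_derive w 1 phi dphi & `|w * dphi| <= C0 * phi w) ->
  (\forall w \near +oo, b2 / ln w * (1 + phi w) <= alpha - beta * phi w) ->
  exists g : R -> R, exists w0 C : R, [/\ 0 < w0,
    forall w, w <= w0 -> g w = 0,
    forall w, w0 < w -> g w != 0,
    forall w, 0 <= g w <= 1 &
    [/\ forall w, derivable g w 1,
    forall w, `|'D_1 g w| <= C &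
    forall w, 0 < w ->
      0 <= g w * (2 * ((alpha / beta - phi w) / w) + 2 / beta * derive1 phi w
             - g w / w + 2 / beta * derive1 g w)
         + 2 / beta * derive1 g w * (1 + phi w)]].
Proof.
move=> beta0 b21 C0_ge0 phi_ge0 phi_derive [M [_ deficit]].
pose b1 := (1 + b2) / 2; pose d := 2 / beta.
have b11 : 1 < b1 by rewrite /b1; lra.
have b12 : b1 < b2 by rewrite /b1; lra.
have d0 : 0 < d by exact: divr_gt0.
pose A := (1 + d * b1 + d * C0) / (d * (b2 - b1)).
have A0 : 0 <= A.
  have b1p : 0 <= b1 by rewrite (le_trans _ (ltW b11)).
  have d0' := ltW d0.
  apply: divr_ge0; last by apply: mulr_ge0 => //; rewrite subr_ge0 ltW.
  by apply: addr_ge0; [apply: addr_ge0 => //|]; exact: mulr_ge0.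
have b1m : 0 < b1 - 1 by rewrite subr_gt0.
pose u0 := Num.max 1 (Num.max (ln (`|M| + 1)) (A `^ (b1 - 1)^-1)).
have u01 : 1 <= u0 by rewrite le_max lexx.
have u0_deficit w : expR u0 <= w -> b2 / ln w * (1 + phi w) <= alpha - beta * phi w.
  move=> ww; apply: deficit; apply: lt_le_trans ww.
  apply: (@lt_le_trans _ _ (expR (ln (`|M| + 1)))).
    have M1 : 0 < `|M| + 1 by rewrite ltr_wpDl.
    by rewrite lnK ?posrE// (le_lt_trans (ler_norm M))// ltrDl.
  by rewrite ler_expR !le_max lexx orbT.
have u0_large u : u0 <= u -> (1 + d * b1 + d * C0) * u `^ (- b1) <= d * (b2 - b1) / u.
  move=> uu; have up : 0 < u by rewrite (lt_le_trans _ uu)// (lt_le_trans _ u01).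
  have Au : A <= u `^ (b1 - 1).
    have e : A = (A `^ (b1 - 1)^-1) `^ (b1 - 1).
      by rewrite -powRrM mulVf ?powRr1// lt0r_neq0.
    rewrite e; apply: ge0_ler_powR; rewrite ?nnegrE ?powR_ge0 ?(ltW up) ?(ltW b1m)//.
    by apply: le_trans uu; rewrite !le_max lexx !orbT.
  have db : 0 < d * (b2 - b1) by apply: (mulr_gt0 d0); rewrite subr_gt0.
  rewrite (ler_pdivrMr _ _ db) in Au.
  rewrite ler_pdivlMr// -mulrA (_ : u `^ (- b1) * u = u `^ (- (b1 - 1))); last first.
    rewrite -{2}(powRr1 (ltW up)) -powRD ?(gt_eqF up) ?implybT//.
    by congr (_ `^ _); ring.
  by rewrite powRN ler_pdivrMr ?powR_gt0// [leRHS]mulrC.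
exists (perturbation phi b2 u0), (expR u0), (b1 + 4 + C0); split.
- exact: expR_gt0.
- by move=> w; exact: perturbation_low.
- by move=> w; apply: perturbation_neq0.
- by move=> w; apply/andP; split; [apply: perturbation_ge0|apply: perturbation_le1].
- split=> w.
  + exact: (derivable_perturbation (C0 := C0)).
  + exact: derive_perturbation_le.
  + exact: (perturbation_gain (C0 := C0)).
Qed.

(** * Membership of the perturbation in the class *)

Section model_integrability.
Context {R : realType}.
Variables (p n : nat).
Local Notation mu := (@lebesgue_measure R).
Local Notation T1 := (p.-tuple (measurableTypeR R) * measurableTypeR R)%type.
Hypothesis n2 : (2 <= n)%N.
Variables (theta : p.-tuple R) (v : R).
Hypothesis v0 : 0 < v.

Let c : R := v^-1 * v^-1 `^ (n%:R / 2 - 1) / (2 `^ (n%:R / 2) * Gamma (n%:R / 2)).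

Let c_ge0 : 0 <= c.
Proof.
by rewrite !mulr_ge0 ?invr_ge0 ?mulr_ge0 ?powR_ge0 ?Gamma_ge0// ltW.
Qed.

(** The density of the model, written as the product of a function of [x] and a
    multiple of a gamma kernel in [s]. *)
Let pdf (z : T1) : R :=
  (\prod_(i < p) gauss_pdf (tnth theta i) v (tnth z.1 i)) *
  (c * gamma_fun (n%:R / 2) (2 * v)^-1 z.2).

Let pdfE (z : T1) : half_space z -> model_pdf n theta v z.1 z.2 = pdf z.
Proof.
rewrite /half_space/= => s0; rewrite model_pdfE// /pdf; congr (_ * _).
rewrite /chi2_pdf /gamma_fun /c powRM ?invr_ge0 ?(ltW s0) ?(ltW v0)//.
rewrite (_ : - (z.2 / v) / 2 = - ((2 * v)^-1 * z.2)); first by ring.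
by field; rewrite gt_eqF.
Qed.

Let pdf_ge0 z : 0 <= pdf z.
Proof.
apply: mulr_ge0; last by apply: mulr_ge0 => //; exact: gamma_fun_ge0.
by apply: prodr_ge0 => i _; exact: gauss_pdf_ge0.
Qed.

Let measurable_pdf : measurable_fun setT pdf.
Proof.
apply: measurable_funM.
  apply: measurable_prod => i _.
  have mt : measurable_fun setT (fun z : T1 => tnth z.1 i).
    exact: (measurableT_comp (@measurable_tnth _ _ _ i) measurable_fst).
  exact: (measurableT_comp (measurable_gauss_pdf _ _) mt).
apply: measurable_funM => //.
have ms : measurable_fun setT (fun z : T1 => z.2) by exact: measurable_snd.
apply: measurable_funM; first exact: measurable_fun_powR.
by apply: measurable_fun_expR; apply: measurable_funN; exact: measurable_funM.
Qed.

Let mH : measurable (@half_space R p).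
Proof. by rewrite half_spaceE; exact: measurableX. Qed.

Lemma measurable_model_pdf :
  measurable_fun (@half_space R p) (fun z => model_pdf n theta v z.1 z.2).
Proof.
apply: (eq_measurable_fun pdf); first by move=> z /[!inE] z0; rewrite pdfE.
exact: measurable_funTS measurable_pdf.
Qed.

Lemma integrable_model_pdf : (@half_space_measure R p).-integrable (@half_space R p)
  (fun z => (model_pdf n theta v z.1 z.2)%:E).
Proof.
apply/integrableP; split; first by apply/measurable_EFinP; exact: measurable_model_pdf.
rewrite (_ : (\int[_]_(z in _) _)%E = (\int[@half_space_measure R p]_(z in
    [set: p.-tuple (measurableTypeR R)] `*` (`]0%R, +oo[ : set (measurableTypeR R)))
    (pdf z)%:E)%E); last first.
  rewrite -half_spaceE; apply: eq_integral => z /[!inE] z0.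
  by rewrite (pdfE z0)/= ger0_norm ?pdf_ge0.
have m0y : measurable (`]0%R, +oo[ : set (measurableTypeR R)) by exact: measurable_itv.
have mp : measurable_fun (setT `*` (`]0%R, +oo[ : set (measurableTypeR R)))
    (fun z : T1 => (pdf z)%:E).
  by apply: measurable_funTS; apply/measurable_EFinP.
have p0 (t : p.-tuple (measurableTypeR R)) (s : measurableTypeR R) : [set: _] t ->
    `]0%R, +oo[%classic s -> (0 <= (fun z : T1 => (pdf z)%:E) (t, s))%E.
  by move=> _ _; rewrite lee_fin pdf_ge0.
rewrite [ltLHS](tonelli_on2 _ _ measurableT m0y mp p0).
rewrite (_ : (\int[_]_(s in _) _)%E =
    (\int[mu]_(s in `]0%R, +oo[) (c * gamma_fun (n%:R / 2) (2 * v)^-1 s)%:E)%E); last first.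
  apply: eq_integral => s _.
  rewrite /pdf/=; under eq_integral do rewrite EFinM.
  have mg i : measurable_fun setT (gauss_pdf (tnth theta i) v).
    exact: measurable_gauss_pdf.
  rewrite ge0_integralZr//; last 3 first.
  - by apply/measurable_EFinP; apply: measurable_prod => i _; exact: (measurable_comp_tnth i (mg i)).
  - by move=> t _; rewrite lee_fin prodr_ge0// => i _; exact: gauss_pdf_ge0.
  - by rewrite lee_fin mulr_ge0// gamma_fun_ge0.
  rewrite (@integral_lebesgue_tuple_prod R p (fun i => gauss_pdf (tnth theta i) v))//; last first.
    by move=> i t; exact: gauss_pdf_ge0.
  by rewrite big1 ?mul1e// => i _; exact: integral_gauss_pdf.
have n1 : 1 <= n%:R / 2 :> R by rewrite ler_pdivlMr// mul1r ler_nat.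
have v2 : 0 < (2 * v)^-1 by rewrite invr_gt0 mulr_gt0.
have /integrableP[_] := integrableZl m0y c (integrable_gamma_fun n1 v2).
apply: le_lt_trans; apply: ge0_le_integral => //.
- by move=> s _; rewrite lee_fin mulr_ge0// gamma_fun_ge0.
- by apply/measurable_EFinP; apply: measurable_funM => //; exact: measurable_gamma_fun.
- apply: measurableT_comp => //; apply/measurable_EFinP; apply: measurable_funM => //.
  exact: measurable_gamma_fun.
- by move=> s _; rewrite /= lee_fin ler_norm.
Qed.

End model_integrability.

Section perturbation_class.
Context {R : realType}.
Implicit Types (g h : R -> R) (C : R).

Lemma measurable_Wstat p :
  measurable_fun setT (fun z : p.-tuple (measurableTypeR R) * measurableTypeR R => Wstat z.1 z.2).
Proof.
apply: measurable_funM; last by apply: measurable_funV; exact: measurable_snd.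
apply: measurable_sum => i; apply: measurable_funX.
apply: (measurableT_comp (@measurable_tnth _ _ _ i)); exact: measurable_fst.
Qed.

Lemma finite_expectation_bounded p n h C : (2 <= n)%N -> measurable_fun setT h ->
  (forall w, `|h w| <= C) -> finite_expectation p n h.
Proof.
move=> n2 mh hC theta v v0.
have mH : measurable (@half_space R p) by rewrite half_spaceE; exact: measurableX.
have C0 : 0 <= C by rewrite (le_trans _ (hC 0)).
have := integrableZl mH C (integrable_model_pdf n2 theta v0).
apply: le_integrable => //.
  apply/measurable_EFinP; apply: measurable_funM; last exact: measurable_model_pdf.
  by apply: measurable_funTS; exact: (measurableT_comp mh (@measurable_Wstat p)).
move=> z z0; rewrite lee_fin !normrM (ger0_norm C0); apply: ler_pM => //.
Qed.

Lemma lipschitz_absolutely_continuous g C a b :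
  (forall x y, `|g x - g y| <= C * `|x - y|) -> absolutely_continuous a b g.
Proof.
move=> gC e e0.
have C0 : 0 <= C by have := le_trans (normr_ge0 _) (gC 1 0); rewrite subr0 normr1 mulr1.
have C1 : 0 < C + 1 by rewrite ltr_wpDl.
exists (e / (C + 1)); first exact: divr_gt0.
move=> s /andP[/allP sab _] sd.
apply: (@le_lt_trans _ _ (\sum_(I <- s) C * (I.2 - I.1))).
  rewrite [leLHS]big_seq [leRHS]big_seq; apply: ler_sum => I /sab/and3P[_ I12 _].
  by rewrite (le_trans (gC _ _))// ger0_norm// subr_ge0.
have s0 : 0 <= \sum_(I <- s) (I.2 - I.1).
  rewrite big_seq; apply: sumr_ge0 => I /sab/and3P[_ I12 _]; by rewrite subr_ge0.
rewrite -mulr_sumr; rewrite ltr_pdivlMr// in sd; apply: le_lt_trans sd.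
by rewrite mulrC ler_wpM2l// lerDl.
Qed.

Variables (g : R -> R) (w0 C : R).
Hypothesis w00 : 0 < w0.
Hypothesis g_low : forall w, w <= w0 -> g w = 0.
Hypothesis g01 : forall w, 0 <= g w <= 1.
Hypothesis dg : forall w : R, derivable g w 1.
Hypothesis dgC : forall w : R, `|'D_1 g w| <= C.

Let continuous_g : continuous g.
Proof. by move=> w; apply: differentiable_continuous; apply/derivable1_diffP. Qed.

Let lipschitz_g x y : `|g x - g y| <= C * `|x - y|.
Proof.
wlog xy : x y / y <= x.
  by move=> h; have [|/ltW] := leP y x; [|rewrite distrC [`|x - y|]distrC]; exact: h.
have [||c _ ->] := @MVT_segment R g (fun w => 'D_1 g w) y x xy.
- by move=> z _; exact: derivableP.
- exact: continuous_subspaceT.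
by rewrite normrM ler_wpM2r.
Qed.

Let measurable_g : measurable_fun setT g.
Proof. exact: continuous_measurable_fun. Qed.

(** A derivative is a limit of difference quotients along a sequence. *)
Let measurable_dg : measurable_fun setT (derive1 g).
Proof.
apply: (@measurable_fun_cvg _ _ _ _ (fun (m : nat) (w : R) => m.+1%:R * (g (m.+1%:R^-1 + w) - g w))).
  move=> m; apply: measurable_funM => //; apply: measurable_funB => //.
  by apply: (measurableT_comp measurable_g); apply: measurable_funD.
move=> w _; rewrite derive1E.
have : derivable g w 1 by exact: dg.
rewrite /derivable => /cvgr_dnbhsP/(_ (fun m => m.+1%:R^-1)).
have h : (forall m, (m.+1%:R^-1 : R) != 0) /\ (fun m => m.+1%:R^-1 : R) @ \oo --> (0 : R).
  by split => [m|]; [rewrite invr_neq0|exact: cvg_harmonic].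
move=> /(_ h); rewrite -/('D_1 g w).
by apply: cvg_trans; apply: near_eq_cvg; near=> m; rewrite /GRing.scale/= mulr1 invrK.
Unshelve. all: end_near. Qed.

Let div_le w : `|g w / w| <= w0^-1.
Proof.
have [ww|ww] := leP w w0; first by rewrite g_low// mul0r normr0 invr_ge0 ltW.
have wp : 0 < w := lt_trans w00 ww; have /andP[g0 g1] := g01 w.
rewrite ger0_norm ?divr_ge0 ?(ltW wp)// -[leRHS]mul1r.
by apply: ler_pM; rewrite ?invr_ge0 ?(ltW wp)// lef_pV2 ?posrE// ltW.
Qed.

(** As [g] vanishes near zero, [g w / w] is bounded, and all four functions whose
    expectation is required to be finite are bounded and measurable. *)
Lemma class_Phi_smooth p n : (2 <= n)%N -> class_Phi p n g.
Proof.
move=> n2; split.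
  by move=> a b _ _; exact: lipschitz_absolutely_continuous lipschitz_g.
have g1 w : `|g w| <= 1 by have /andP[g0 ?] := g01 w; rewrite ger0_norm.
have minv : measurable_fun setT (fun w : R => w^-1) by exact: measurable_invr.
split.
- apply: (@finite_expectation_bounded _ _ _ w0^-1) => //.
    by apply: measurable_funM => //; exact: measurable_funX.
  move=> w; rewrite expr2 -mulrA normrM -[leRHS]mul1r.
  by apply: ler_pM.
- apply: (@finite_expectation_bounded _ _ _ w0^-1) => //.
  exact: measurable_funM.
- apply: (@finite_expectation_bounded _ _ _ C) => //.
  by move=> w; rewrite derive1E.
- apply: (@finite_expectation_bounded _ _ _ C) => //.
    exact: measurable_funM.
  by move=> w; rewrite derive1E normrM -[leRHS]mul1r; apply: ler_pM.
Qed.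

End perturbation_class.

(** * Slowly varying functions *)

Section power_integral.
Context {R : realType}.
Local Notation mu := (@lebesgue_measure R).

(** Monotone convergence along the segments [[1 / (i + 2), 1]], where the antiderivative
    is regular. *)
Lemma integrable_powR_unit (r : R) : -1 < r ->
  mu.-integrable `]0%R, 1%R[ (EFin \o (fun l => l `^ r)).
Proof.
move=> r1; have q0 : 0 < r + 1 by move: r1; lra.
pose F i : set (measurableTypeR R) := `[i.+2%:R^-1, 1%R]%classic.
have mF i : measurable (F i) by exact: measurable_itv.
have i2 i : (0 : R) < i.+2%:R^-1 by rewrite invr_gt0.
have mp (D : set (measurableTypeR R)) : measurable_fun D (fun l => (l `^ r)%:E).
  by apply/measurable_EFinP; apply: measurable_fun_powR; exact: measurable_id.
have FE i : (\int[mu]_(l in F i) (l `^ r)%:E <= (r + 1)^-1%:E)%E.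
  pose P (l : R) := (r + 1)^-1 * l `^ (r + 1).
  have dP (l : R) : 0 < l -> is_derive l 1 P (l `^ r).
    move=> l0; have d := is_deriveZ (r + 1)^-1 (is_derive_powR (r + 1) l0).
    by apply: (is_derive_eq d); rewrite /GRing.scale/= addrK mulrA mulVf ?mul1r ?gt_eqF.
  have cP (l : R) : 0 < l -> {for l, continuous P}.
    move=> l0; apply: differentiable_continuous; apply/derivable1_diffP.
    exact: (@ex_derive _ _ _ _ _ _ _ (dP l l0)).
  rewrite (@continuous_FTC2 R (fun l => l `^ r) P).
  - rewrite /P powR1 mulr1 -EFinB lee_fin gerBl mulr_ge0 ?powR_ge0// invr_ge0 ltW//.
  - by rewrite invf_lt1// ltr1n.
  - apply: continuous_in_subspaceT => l; rewrite inE/= in_itv/= => /andP[h _].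
    have l0 := lt_le_trans (i2 i) h.
    apply: differentiable_continuous; apply/derivable1_diffP.
    exact: (@ex_derive _ _ _ _ _ _ _ (is_derive_powR r l0)).
  - split.
    + move=> l; rewrite in_itv/= => /andP[h _]; have l0 := lt_trans (i2 i) h.
      exact: (@ex_derive _ _ _ _ _ _ _ (dP l l0)).
    + exact/cvg_at_right_filter/cP.
    + exact/cvg_at_left_filter/cP.
  - move=> l; rewrite in_itv/= => /andP[h _]; have l0 := lt_trans (i2 i) h.
    by rewrite derive1E; exact: (@derive_val _ _ _ _ _ _ _ (dP l l0)).
apply/integrableP; split; first exact: mp.
rewrite (_ : (\int[mu]_(l in _) _)%E = (\int[mu]_(l in `]0%R, 1%R[) (l `^ r)%:E)%E); last first.
  by apply: eq_integral => l _; rewrite /= ger0_norm ?powR_ge0.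
have ndF : nondecreasing_seq F.
  move=> i j ij; rewrite subsetEset => l; rewrite /F /= !in_itv/= => /andP[h ->].
  by rewrite andbT (le_trans _ h)// lef_pV2 ?posrE// ler_nat !ltnS.
have f0 i (x : measurableTypeR R) : F i x -> (0 <= (x `^ r)%:E)%E.
  by move=> _; rewrite lee_fin powR_ge0.
have cv := ge0_nondecreasing_set_cvg_integral ndF mF (fun i => mp (F i)) f0 (mu := mu).
apply: (@le_lt_trans _ _ (\int[mu]_(l in \bigcup_i F i) (l `^ r)%:E)%E).
  apply: ge0_subset_integral => //.
  - exact: bigcup_measurable.
  - by move=> l _; rewrite lee_fin powR_ge0.
  - move=> l; rewrite /= in_itv/= => /andP[l0 l1].
    exists (Num.truncn l^-1) => //; rewrite /F/= in_itv/= (ltW l1) andbT.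
    rewrite -[leRHS]invrK lef_pV2 ?posrE ?invr_gt0// ltW//.
    rewrite (lt_trans (truncnS_gt _))// ltr_nat//.
apply: (@le_lt_trans _ _ (r + 1)^-1%:E); last exact: ltry.
by apply: cvge_le cv; exact: nearW.
Qed.

End power_integral.

Section slow_variation.
Context {R : realType}.
Implicit Types (y d : R).

(** The logarithmic derivative [b / t - e] is nonpositive past [b / e]. *)
Lemma powR_expRN_ge b e (t t' : R) : 0 <= b -> 0 < t -> t <= t' -> b <= e * t ->
  t' `^ b * expR (- (e * t')) <= t `^ b * expR (- (e * t)).
Proof.
move=> b0 t0 tt' bet; have t'0 : 0 < t' := lt_le_trans t0 tt'.
rewrite !powR_expR// -!expRD ler_expR.
have l : ln (t' / t) <= t' / t - 1.
  have := @le_ln1Dx R (t' / t - 1); rewrite [1 + _]addrC subrK; apply.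
  by rewrite ltrBrDr addNr divr_gt0.
rewrite ln_div ?posrE// in l.
have h : ln t' - ln t <= (t' - t) / t.
  by rewrite mulrBl divff ?gt_eqF.
have : b * (ln t' - ln t) <= b * ((t' - t) / t) by rewrite ler_wpM2l.
have : b * ((t' - t) / t) <= e * t * ((t' - t) / t).
  by rewrite ler_wpM2r// divr_ge0 ?subr_ge0 ?(ltW t0).
rewrite (_ : e * t * ((t' - t) / t) = e * (t' - t)); last by field; rewrite gt_eqF.
by move=> h1 h2; have := le_trans h2 h1; rewrite !mulrBr; lra.
Qed.

Variable L : R -> R.
Hypothesis L_ge0 : forall y : R, 1 <= y -> 0 <= L y.
Hypothesis svL : slowly_varying L.
Hypothesis dL : differentiable_from1 L.

(** Where [L] vanishes so does the quotient [L (2 * y) / L y], which tends to one. *)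
Lemma slowly_varying_gt0 : \forall y \near +oo, 0 < L y.
Proof.
have /cvgrPdist_lt/(_ 1 ltr01) h := svL (ltr0Sn R 1).
near=> y.
have y1 : 1 <= y by near: y; apply: nbhs_pinfty_ge; exact: num_real.
rewrite lt_neqAle L_ge0// andbT eq_sym; apply/eqP => Ly0.
have : `|1 - L (2 * y) / L y| < 1 by near: y; exact: h.
by rewrite Ly0 invr0 mulr0 subr0 normr1 ltxx.
Unshelve. all: end_near. Qed.

Lemma slowly_varying_le (c d : R) : 0 < c -> 1 < d -> \forall y \near +oo, L (c * y) <= d * L y.
Proof.
move=> c0 d1; have d10 : 0 < d - 1 by rewrite subr_gt0.
have /cvgrPdist_lt/(_ _ d10) h := svL c0.
have pos := slowly_varying_gt0.
near=> y; have Ly : 0 < L y by near: y.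
rewrite -ler_pdivrMr//.
have : `|1 - L (c * y) / L y| < d - 1 by near: y; exact: h.
by rewrite ltr_norml => /andP[h1 _]; move: h1; rewrite ltrBrDl; lra.
Unshelve. all: end_near. Qed.

Let derL y : 1 < y -> derivable L y 1.
Proof. by case: dL => h _; exact: h. Qed.

Let contL y : 1 < y -> {for y, continuous L}.
Proof.
by move=> y1; apply: differentiable_continuous; apply/derivable1_diffP; exact: derL.
Qed.

(** Differentiability from the right bounds [L] near the endpoint, continuity elsewhere. *)
Lemma bounded_on_segment M : exists2 K, 0 <= K & forall y, 1 <= y <= M -> L y <= K.
Proof.
case: dL => _ /cvg_ex[l /cvgrPdist_lt/(_ 1 ltr01)[d /= d0 hd]].
pose m := 1 + d / 2.
have m1 : 1 < m by rewrite ltrDl divr_gt0.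
pose M1 := Num.max m M.
have [||c cM hc] := @EVT_max R L m M1; first by rewrite le_max lexx.
  apply: continuous_in_subspaceT => y; rewrite inE/= in_itv/= => /andP[my _].
  by apply: contL; exact: lt_le_trans my.
pose K := L 1 + (`|l| + 1) * d + L c.
have L1 : 0 <= L 1 by exact: L_ge0.
have Lc : 0 <= L c.
  by apply: L_ge0; move: cM; rewrite in_itv/= => /andP[mc _]; rewrite ltW// (lt_le_trans m1).
have l1 : 0 <= (`|l| + 1) * d by rewrite mulr_ge0 ?addr_ge0// ltW.
exists K; first by rewrite /K !addr_ge0.
move=> y /andP[y1 yM]; have [my|ym] := leP m y.
  apply: (@le_trans _ _ (L c)); last by rewrite /K lerDr addr_ge0.
  by apply: hc; rewrite in_itv/= my le_max yM orbT.
apply: (@le_trans _ _ (L 1 + (`|l| + 1) * d)); last by rewrite /K lerDl.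
move: y1; rewrite le_eqVlt => /orP[/eqP <-|y1]; first by rewrite lerDl.
pose h := y - 1; have h0 : 0 < h by rewrite subr_gt0.
have hm : h < d / 2 by rewrite ltrBlDl.
have hd2 : h < d by rewrite (lt_trans hm)// ltr_pdivrMr// ltr_pMr// ltr1n.
have h0d : ball_ [eta Num.Def.normr] 0 d h by rewrite /= sub0r normrN (gtr0_norm h0).
have := hd h h0d h0.
have -> : 1 + h = y by rewrite addrC subrK.
rewrite ltr_norml => /andP[q1 _].
have q2 : h^-1 * (L y - L 1) <= `|l| + 1 by have := ler_norm l; move: q1; lra.
rewrite ler_pdivrMl// in q2; rewrite -lerBlDl (le_trans q2)// [leLHS]mulrC.
by rewrite ler_wpM2l ?addr_ge0// ltW.
Qed.

(** Doubling the argument multiplies a slowly varying function by less than any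
    factor larger than one; iterating gives a bound by any positive power. *)
Lemma slowly_varying_powR_le e : 0 < e -> exists2 K, 0 <= K &
  forall y, 1 <= y -> L y <= K * y `^ e.
Proof.
move=> e0.
have d1 : 1 < 2 `^ e :> R.
  by rewrite powR_expR// expR_gt1 mulr_gt0// ln_gt0// ltr1n.
have [y0 [_ hy0]] := slowly_varying_le (ltr0Sn R 1) d1.
pose y1 := Num.max 1 (y0 + 1).
have y11 : 1 <= y1 by rewrite le_max lexx.
have hy1 y : y1 <= y -> L (2 * y) <= 2 `^ e * L y.
  by move=> yy; apply: hy0; rewrite (lt_le_trans _ yy)// lt_max ltrDl ltr01 orbT.
have [K K0 hK] := bounded_on_segment (2 * y1).
exists K => //.
have ind (m : nat) : forall y, 1 <= y -> y <= 2 ^+ m * y1 -> L y <= K * y `^ e.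
  elim: m => [|m IH] y yge yle.
    apply: (@le_trans _ _ K).
      apply: hK; rewrite yge (le_trans yle)// expr0 ler_wpM2r//.
        exact: le_trans ler01 y11.
      by rewrite ler1n.
    by rewrite ler_peMr// -[leLHS](powRr0 y) ler_powR// ltW.
  have yp : 0 <= y by exact: le_trans ler01 yge.
  have [y2|y2] := leP y (2 * y1).
    apply: (@le_trans _ _ K); first by apply: hK; rewrite yge.
    by rewrite ler_peMr// -[leLHS](powRr0 y) ler_powR// ltW.
  have yh : y1 <= y / 2 by rewrite ler_pdivlMr// mulrC ltW.
  rewrite -[y in L y](divfK (x := 2)) ?pnatr_eq0// mulrC.
  apply: (le_trans (hy1 _ yh)).
  have -> : K * y `^ e = 2 `^ e * (K * (y / 2) `^ e).
    by rewrite mulrCA -powRM ?divr_ge0// [2 * _]mulrC divfK ?pnatr_eq0.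
  rewrite ler_wpM2l ?powR_ge0// IH//; first exact: le_trans y11 yh.
  by rewrite ler_pdivrMr// mulrAC -exprSr.
move=> y yge; apply: (ind (Num.truncn y).+1) => //.
have : y <= (Num.truncn y).+1%:R by apply: ltW; exact: truncnS_gt.
move=> h; apply: (le_trans h); rewrite -[leLHS]mulr1; apply: ler_pM => //.
by rewrite -natrX ler_nat ltnW// ltn_expl.
Qed.

Lemma measurable_slowly_varying_inv :
  measurable_fun (`]0%R, 1%R[ : set (measurableTypeR R)) (fun l => L l^-1).
Proof.
apply: (@open_continuous_measurable_fun R); first exact: interval_open.
move=> l; rewrite inE/= in_itv/= => /andP[l0 l1].
apply: (@continuous_comp _ _ _ (fun l : R => l^-1) L).
  by apply: inv_continuous; rewrite gt_eqF.
by apply: contL; rewrite invf_gt1.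
Qed.

Hypothesis mL : ultimately_monotone (derive1 L).

(** If [L'] is nondecreasing, the slope at [y] is at least the slope of the chord from
    [y / 2], and slow variation makes the chord flat relative to [L y].  If [L'] is
    nonincreasing, a negative value of it would drive [L] below zero. *)
Lemma slowly_varying_derive_ge d : 0 < d ->
  \forall y \near +oo, 0 <= d * L y + y * 'D_1 L y.
Proof.
move=> d0.
have mvt x y : 1 < x -> x < y -> exists2 c, x < c < y & L y - L x = 'D_1 L c * (y - x).
  move=> x1 xy; have [||c cxy e] := @MVT R L (fun y => 'D_1 L y) x y xy.
  - move=> z; rewrite in_itv/= => /andP[xz _]; apply: derivableP.
    by apply: derL; exact: lt_trans xz.
  - apply: continuous_in_subspaceT => z; rewrite inE/= in_itv/= => /andP[xz _].
    by apply: contL; exact: lt_le_trans xz.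
  - by exists c => //; move: cxy; rewrite in_itv.
case: mL => -[y0 my0].
- have d2 : 1 < 1 + d / 2 by rewrite ltrDl divr_gt0.
  have h2 : (0 : R) < 2^-1 by rewrite invr_gt0.
  have sl := slowly_varying_le h2 d2.
  near=> y.
  have y1 : 2 < y by near: y; apply: nbhs_pinfty_gt; exact: num_real.
  have yy0 : 2 * y0 < y by near: y; apply: nbhs_pinfty_gt; exact: num_real.
  have y00 : y0 < y by near: y; apply: nbhs_pinfty_gt; exact: num_real.
  have Lh : L (2^-1 * y) <= (1 + d / 2) * L y by near: y; exact: sl.
  have yh1 : 1 < 2^-1 * y by move: y1; lra.
  have yh2 : 2^-1 * y < y by move: y1; lra.
  have [c /andP[c1 c2] e] := mvt _ _ yh1 yh2.
  have : 'D_1 L c <= 'D_1 L y.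
    rewrite -!derive1E; apply: my0; last exact: ltW.
      by rewrite in_itv/= andbT; move: yy0 c1; lra.
    by rewrite in_itv/= andbT ltW.
  move=> h; have : 'D_1 L c * (y - 2^-1 * y) <= 'D_1 L y * (y - 2^-1 * y).
    by rewrite ler_wpM2r// subr_ge0 ltW.
  rewrite -e mulrBr; rewrite mulrDl mul1r in Lh.
  rewrite (_ : 'D_1 L y * (2^-1 * y) = 'D_1 L y * y / 2); last by ring.
  rewrite [y * _]mulrC (_ : d / 2 * L y = d * L y / 2) in Lh *; last by ring.
  move: ('D_1 L y * y) (d * L y) Lh => A B; lra.
- near=> y.
  have y1 : 1 < y by near: y; apply: nbhs_pinfty_gt; exact: num_real.
  have y00 : y0 < y by near: y; apply: nbhs_pinfty_gt; exact: num_real.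
  have Ly := L_ge0 (ltW y1).
  have yp : 0 <= y by rewrite ltW// (lt_trans _ y1).
  apply: addr_ge0; first by rewrite mulr_ge0// ltW.
  apply: mulr_ge0 => //.
  rewrite leNgt; apply/negP => Dy.
  pose m := - 'D_1 L y; have m0 : 0 < m by rewrite oppr_gt0.
  pose z := y + (L y + 1) / m.
  have yz : y < z by rewrite ltrDl divr_gt0// ltr_wpDl.
  have [c /andP[c1 c2] e] := mvt _ _ y1 yz.
  have : 'D_1 L c <= 'D_1 L y.
    rewrite -!derive1E; apply: my0; last exact: ltW.
      by rewrite in_itv/= andbT ltW// (lt_trans y00).
    by rewrite in_itv/= andbT ltW.
  move=> h; have : 'D_1 L c * (z - y) <= 'D_1 L y * (z - y).
    by rewrite ler_wpM2r// subr_ge0 ltW.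
  have zy : z - y = (L y + 1) / m by rewrite /z addrAC subrr add0r.
  rewrite -e zy (_ : 'D_1 L y * ((L y + 1) / m) = - (L y + 1)); last first.
    by rewrite -[X in X * _]opprK -/m mulNr mulrCA mulfV ?mulr1// gt_eqF.
  have : 0 <= L z by apply: L_ge0; rewrite ltW// (lt_trans y1).
  lra.
Unshelve. all: end_near. Qed.

(** The derivative of [y `^ d * L y] has the sign of [d * L y + y * L' y]. *)
Lemma slowly_varying_powR_nondecreasing d : 0 < d ->
  \forall y0 \near +oo, forall y y', y0 <= y -> y <= y' ->
    y `^ d * L y <= y' `^ d * L y'.
Proof.
move=> d0; have [y1 [_ hy1]] := slowly_varying_derive_ge d0.
near=> y0 => y y' yy0 yy'.
have y01 : 1 < y0 by near: y0; apply: nbhs_pinfty_gt; exact: num_real.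
have y0y1 : y1 < y0 by near: y0; apply: nbhs_pinfty_gt; exact: num_real.
have dd (z : R) : 1 < z -> is_derive z 1 (fun y => y `^ d * L y)
    (z `^ (d - 1) * (d * L z + z * 'D_1 L z)).
  move=> z1; have z0 : 0 < z by exact: lt_trans z1.
  have := is_deriveM (is_derive_powR d z0) (derivableP (derL z1)).
  rewrite /GRing.scale/= => h; apply: (is_derive_eq h).
  have -> : z `^ d = z * z `^ (d - 1).
    rewrite -{2}(powRr1 (ltW z0)) -powRD ?(gt_eqF z0) ?implybT//.
    by congr (_ `^ _); ring.
  ring.
have y'1 : 1 < y by exact: lt_le_trans yy0.
have [||c] := @MVT_segment R (fun z => z `^ d * L z) (fun z => z `^ (d - 1) * (d * L z + z * 'D_1 L z)) y y' yy'.
- by move=> z; rewrite in_itv/= => /andP[yz _]; apply: dd; exact: lt_trans yz.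
- apply: continuous_in_subspaceT => z; rewrite inE/= in_itv/= => /andP[yz _].
  have z1 : 1 < z by exact: lt_le_trans yz.
  apply: differentiable_continuous; apply/derivable1_diffP.
  exact: (@ex_derive _ _ _ _ _ _ _ (dd z z1)).
- rewrite in_itv/= => /andP[yc _] e; rewrite -subr_ge0 e mulr_ge0 ?subr_ge0//.
  rewrite mulr_ge0 ?powR_ge0// hy1// (lt_le_trans y0y1)// (le_trans yy0)//.
Unshelve. all: end_near. Qed.

End slow_variation.

(** * Quasi-inadmissibility *)

Section mixing_density.
Context {R : realType}.
Local Notation mu := (@lebesgue_measure R).
Variables (p n : nat) (a : R) (L : R -> R).
Hypotheses (hp : (3 <= p)%N) (hn : (3 <= n)%N) (ha : 0 < p%:R / 2 + a + 1).
Hypothesis L_ge0 : forall y : R, 1 <= y -> 0 <= L y.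
Hypothesis svL : slowly_varying L.
Hypothesis dL : differentiable_from1 L.
Variables (b y0 : R).
Hypothesis b1 : 1 < b.
(** Under [y = 1 / l], the condition on the mixing density near zero that makes
    [shrink_deficit] applicable. *)
Hypothesis weight_mono : forall y y' : R, y0 <= y -> y <= y' ->
  y `^ (- 2 - a) * L y / ln y `^ b <= y' `^ (- 2 - a) * L y' / ln y' `^ b.

Local Notation kap := (mixing p a L).
Local Notation alpha := (p%:R / 2 - 1 : R).
Local Notation beta := (n%:R / 2 + 1 : R).
Local Notation k := ((p + n)%:R / 2 + 1 : R).

Let alpha0 : 0 < alpha.
Proof.
have : 3%:R <= p%:R :> R by rewrite ler_nat.
by move: (p%:R : R) => x; lra.
Qed.

Let beta0 : 0 < beta. Proof. by apply: ltr_wpDl => //; exact: divr_ge0. Qed.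

Let kE : k = alpha + beta + 1. Proof. by rewrite natrD; ring. Qed.

Let k0 : 0 <= k. Proof. by rewrite kE; move: alpha0 beta0; lra. Qed.

Let Linv_ge0 (l : R) : 0 < l < 1 -> 0 <= L l^-1.
Proof. by move=> /andP[l0 l1]; rewrite L_ge0// invf_ge1// ltW. Qed.

Let mL := measurable_slowly_varying_inv dL.

Let kap_ge0 (l : R) : 0 < l < 1 -> 0 <= kap l.
Proof. by move=> l01; rewrite mulr_ge0 ?powR_ge0 ?Linv_ge0. Qed.

Let measurable_kap : measurable_fun (`]0%R, 1%R[ : set (measurableTypeR R)) kap.
Proof. exact: measurable_mixing. Qed.

Let kap_int : mu.-integrable `]0%R, 1%R[ (EFin \o kap).
Proof.
pose e := (p%:R / 2 + a + 1) / 2; have e0 : 0 < e by exact: divr_gt0.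
have [K K0 hK] := slowly_varying_powR_le L_ge0 svL dL e0.
have r1 : -1 < p%:R / 2 + a - e.
  by rewrite /e; move: ha; move: (p%:R / 2) => x; lra.
have m01 : measurable (`]0%R, 1%R[%classic : set (measurableTypeR R)) by exact: measurable_itv.
have := integrableZl m01 K (integrable_powR_unit r1).
apply: le_integrable => //; first by apply/measurable_EFinP; exact: measurable_kap.
move=> l; rewrite /= in_itv/= => l01; have /andP[l0 l1] := l01.
rewrite lee_fin (ger0_norm (kap_ge0 l01)) ger0_norm ?mulr_ge0 ?powR_ge0//.
rewrite /mixing [in leRHS]powRD ?(gt_eqF l0) ?implybT// mulrCA ler_wpM2l ?powR_ge0//.
apply: (le_trans (hK _ _)); first by rewrite invf_ge1// ltW.
by rewrite -[l^-1](powR_inv1 (ltW l0)) -powRrM mulN1r.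
Qed.

Let exists_cut : exists Y : R, [/\ 1 < Y, y0 <= Y & forall y, Y <= y -> 0 < L y].
Proof.
have [M [_ hM]] := slowly_varying_gt0 L_ge0 svL.
exists (Num.max 2 (Num.max y0 (M + 1))); split.
- by rewrite lt_max ltr1n.
- by rewrite !le_max lexx orbT.
- move=> y yy; apply: hM; rewrite (lt_le_trans _ yy)// !lt_max ltrDl ltr01 !orbT//.
Qed.

Let kap_gt0 : (0 < \int[mu]_(l in `]0%R, 1%R[) (kap l)%:E)%E.
Proof.
have [Y [Y1 _ hY]] := exists_cut; have Y0 : 0 < Y by exact: lt_trans Y1.
have Yi : Y^-1 < 1 by rewrite invf_lt1.
apply: (@integral_gt0_on _ _ _ mu _ (`]0%R, Y^-1[%classic : set (measurableTypeR R))) => //.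
- by move=> l; rewrite /= !in_itv/= => /andP[-> h]; exact: lt_trans Yi.
- have mu1 : mu (`]0%R, Y^-1[%classic : set R) = (Y^-1)%:E.
    by rewrite lebesgue_measure_itv/= lte_fin invr_gt0 Y0 -EFinB subr0.
  by rewrite [ltRHS](_ : _ = (Y^-1)%:E) ?lte_fin ?invr_gt0//; exact: mu1.
- by apply/measurable_EFinP; exact: measurable_kap.
- move=> l; rewrite /= in_itv/= => /andP[l0 lY]; rewrite lte_fin mulr_gt0 ?powR_gt0//.
  by apply: hY; rewrite -[leLHS]invrK lef_pV2 ?posrE ?invr_gt0// ltW.
Qed.

(** The exponents [p / 2 + a] and [1 - alpha = 2 - p / 2] add up to [2 + a]. *)
Let weightE (l : R) : 0 < l -> kap l * l `^ (1 - alpha) = l^-1 `^ (- 2 - a) * L l^-1.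
Proof.
move=> l0; rewrite /mixing mulrAC -powRD ?(gt_eqF l0) ?implybT//; congr (_ * _).
rewrite -[l^-1](powR_inv1 (ltW l0)) -powRrM; congr (_ `^ _); ring.
Qed.

Let shrink_mixing_deficit : exists2 b2 : R, 1 < b2 & \forall w \near +oo,
  b2 / ln w * (1 + shrink kap k w) <= alpha - beta * shrink kap k w.
Proof.
have [Y [Y1 Yy0 hY]] := exists_cut; have Y0 : 0 < Y by exact: lt_trans Y1.
have l01 : 0 < Y^-1 < 1 by rewrite invr_gt0 Y0 invf_lt1.
have kap_mono (l l' : R) : 0 < l -> l <= l' -> l' <= Y^-1 ->
    kap l' * l' `^ (1 - alpha) / (- ln l') `^ b <= kap l * l `^ (1 - alpha) / (- ln l) `^ b.
  move=> l0 ll' l'Y; have l'0 : 0 < l' := lt_le_trans l0 ll'.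
  rewrite !weightE// -!lnV ?posrE//; apply: weight_mono.
    by rewrite (le_trans Yy0)// -[leLHS]invrK lef_pV2 ?posrE ?invr_gt0.
  by rewrite lef_pV2 ?posrE.
have kapY : 0 < kap Y^-1.
  by rewrite mulr_gt0 ?powR_gt0 ?invr_gt0// invrK hY.
have [K K0 hK] := bounded_on_segment L_ge0 dL Y.
pose r := p%:R / 2 + a.
have kap_le (l : R) : Y^-1 <= l < 1 -> kap l <= (1 + Y^-1 `^ r) * K.
  move=> /andP[Yl l1]; have l0 : 0 < l by rewrite (lt_le_trans _ Yl)// invr_gt0.
  apply: ler_pM; rewrite ?powR_ge0 ?Linv_ge0 ?l0//.
    have [r0|r0] := leP 0 r.
      apply: (@le_trans _ _ 1); last by rewrite lerDl powR_ge0.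
      by rewrite -[leRHS](powRr0 l) ger_powR// l0 ltW.
    apply: (@le_trans _ _ (Y^-1 `^ r)); last by rewrite lerDr.
    rewrite -/r -(opprK r) !(powRN _ (- r)) lef_pV2 ?posrE ?powR_gt0 ?invr_gt0//.
    by rewrite ge0_ler_powR ?nnegrE ?oppr_ge0 ?invr_ge0 ?(ltW r0) ?(ltW Y0) ?(ltW l0).
  apply: hK; rewrite invf_ge1// (ltW l1)/=.
  by rewrite -[leRHS]invrK lef_pV2 ?posrE ?invr_gt0.
have [b2 b21 hb2] := shrink_deficit kap_ge0 kap_int alpha0 beta0 b1 l01 kap_mono kapY kap_le.
exists b2 => //; near=> w.
have w0 : 0 < w by near: w; exact: nbhs_pinfty_gt.
have : b2 / ln w * (moment kap 0 k w + w * moment kap 1 k w) <=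
  alpha * moment kap 0 k w - beta * (w * moment kap 1 k w) by rewrite kE; near: w.
have m0 := moment_gt0 kap_ge0 kap_int kap_gt0 0 k0 (ltW w0).
have -> : w * moment kap 1 k w = shrink kap k w * moment kap 0 k w.
  by rewrite /shrink divfK// gt_eqF.
rewrite -[X in X + _](mul1r (moment kap 0 k w)) -mulrDl mulrA.
by rewrite mulrA -mulrBl ler_pM2r.
Unshelve. all: end_near. Qed.

Theorem quasi_inadmissible_of_weight : quasi_inadmissible n (@generalized_Bayes R p n a L).
Proof.
have n2 : (2 <= n)%N by exact: ltnW.
exists (shrink kap k); split.
  by move=> x s s0; apply: generalized_Bayes_shrink.
have [b2 b21 deficit] := shrink_mixing_deficit.
have C0 : 0 <= 1 + 2 * k by rewrite addr_ge0// mulr_ge0.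
have phi_ge0 (w : R) : 0 <= w -> 0 <= shrink kap k w by exact: shrink_ge0.
have phi_derive (w : R) : 0 < w -> exists2 dphi : R,
    is_derive w 1 (shrink kap k) dphi & `|w * dphi| <= (1 + 2 * k) * shrink kap k w.
  exact: is_derive_shrink.
have [g [w0 [C [w00 g_low g_neq0 g01 [dg dgC gain]]]]] :=
  deficit_improvable beta0 b21 C0 phi_ge0 phi_derive deficit.
exists g; split.
- exact: (class_Phi_smooth w00 g_low g01 dg dgC).
- by exists w0, (w0 + 1); split; rewrite ?(ltW w00) ?ltrDl// => w /andP[/g_neq0].
(* Only w = 0 has to be excluded. *)
- exists [set 0]; split => //; first exact: lebesgue_measure_set1.
  move=> w /= nw; apply: contrapT => w0'; apply: nw => wge.
  split; last exact: dg.
    by rewrite lt_neqAle wge andbT eq_sym; apply/eqP.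
  have wp : 0 < w by rewrite lt_neqAle wge andbT eq_sym; apply/eqP.
  by have [dphi hd _] := phi_derive w wp; exact: ex_derive.
- move=> w [wp _ _]; rewrite /Delta.
  have -> : c_pn R p n = alpha / beta.
    by rewrite /c_pn; field; rewrite gt_eqF// ltr_wpDl.
  have -> : d_n R n = 2 / beta.
    by rewrite /d_n; field; rewrite gt_eqF// ltr_wpDl.
  exact: gain.
Qed.

End mixing_density.

Theorem theorem3p4 (R : realType) (p n : nat) (a : R) (L : R -> R)
    (hp : (3 <= p)%N) (hn : (3 <= n)%N)
    (ha : 0 < p%:R / 2 + a + 1)
    (L_ge0 : forall y : R, 1 <= y -> 0 <= L y)
    (hL : L_assumptions L) :
  (a = - 2 ->
   (exists2 b : R, 1 < b & ultimately_nonincreasing (fun y => ln y `^ b / L y)) ->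
   quasi_inadmissible n (@generalized_Bayes R p n a L))
  /\
  (a < - 2 -> quasi_inadmissible n (@generalized_Bayes R p n a L)).
Proof.
have [svL _ dL mL] := hL; split.
- move=> a2 [b b1 [y1 mono]].
  have [M [_ hM]] := slowly_varying_gt0 L_ge0 svL.
  apply: (@quasi_inadmissible_of_weight R p n a L hp hn ha L_ge0 svL dL b
    (Num.max 2 (Num.max y1 (M + 1))) b1).
  move=> y y'; rewrite !ge_max => /andP[y2 /andP[yy1 yM]] yy'.
  rewrite a2 opprK addNr !powRr0 !mul1r.
  have y'2 : 2 <= y' := le_trans y2 yy'.
  have Ly : 0 < L y by apply: hM; rewrite (lt_le_trans _ yM)// ltrDl.
  have Ly' : 0 < L y' by apply: hM; rewrite (lt_le_trans _ (le_trans yM yy'))// ltrDl.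
  have lny : 0 < ln y `^ b by rewrite powR_gt0// ln_gt0// (lt_le_trans _ y2)// ltr1n.
  have lny' : 0 < ln y' `^ b by rewrite powR_gt0// ln_gt0// (lt_le_trans _ y'2)// ltr1n.
  have := mono y' y; rewrite !in_itv/= !andbT => /(_ (le_trans yy1 yy') yy1 yy').
  rewrite -[leLHS]invf_div -[leRHS]invf_div lef_pV2 ?posrE ?divr_gt0//.
- move=> a2; pose d := (- 2 - a) / 2.
  have d0 : 0 < d by rewrite /d; lra.
  have [M [_ hM]] := slowly_varying_powR_nondecreasing L_ge0 svL dL mL d0.
  have b1 : (1 : R) < 2 by rewrite ltr1n.
  apply: (@quasi_inadmissible_of_weight R p n a L hp hn ha L_ge0 svL dL 2
    (Num.max 2 (Num.max (M + 1) (expR (2 / d)))) b1).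
  move=> y y'; rewrite !ge_max => /andP[y2 /andP[yM yd]] yy'.
  have y'2 : 2 <= y' := le_trans y2 yy'.
  have y0 : 0 < y by exact: lt_le_trans y2.
  have y'0 : 0 < y' by exact: lt_le_trans y'2.
  have yL : y `^ d * L y <= y' `^ d * L y'.
    by apply: (hM (M + 1)) => //; rewrite ltrDl.
  have u0 : 0 < ln y by rewrite ln_gt0// (lt_le_trans _ y2)// ltr1n.
  have u'0 : 0 < ln y' by rewrite ln_gt0// (lt_le_trans _ y'2)// ltr1n.
  (* One half of the power goes with L, the other with the logarithm. *)
  have split_weight (z : R) : 0 < z -> 0 < ln z -> z `^ (- 2 - a) * L z / ln z `^ 2 =
      z `^ d * L z * (ln z `^ 2 * expR (- (d * ln z)))^-1.
    move=> z0 lz; rewrite (_ : - 2 - a = d + d); last by rewrite /d; field.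
    rewrite powRD ?(gt_eqF z0) ?implybT// invfM expRN invrK -powR_expR//.
    ring.
  rewrite !split_weight//; apply: ler_pM => //.
  + by rewrite mulr_ge0 ?powR_ge0// L_ge0// (le_trans _ y2)// ler1n.
  + by rewrite invr_ge0 mulr_ge0 ?powR_ge0 ?expR_ge0.
  + rewrite lef_pV2 ?posrE ?mulr_gt0 ?powR_gt0 ?expR_gt0//.
    apply: powR_expRN_ge => //; first by rewrite ler_ln.
    by rewrite mulrC -ler_pdivrMr// -[leLHS]expRK ler_ln ?posrE ?expR_gt0.
Qed.
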